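(* For each given $n$, the two continuous-time Markov chains defined in the context, namely $\boldsymbol{q}_n$ when the load balancing policy is JLMU and $(\boldsymbol{q}_n,\boldsymbol{r}_n)$ when the load balancing policy is SLTA, are irreducible and positive-recurrent (on their respective state spaces $S_n$). In particular, each of these Markov chains has a unique stationary distribution $\pi_n$.
   Context: Ranking. Let $\mathbb{N}=\{0,1,2,\dots\}$ and $m\geq 1$. For $i=1,\dots,m$ let $u_i:[0,\infty)\to\mathbb{R}$ be a concave function (only its values on $\mathbb{N}$ matter) and $\Delta(i,j)=u_i(j+1)-u_i(j)$ for $j\in\mathbb{N}$. Let $\mathcal{I}=\{1,\dots,m\}\times\mathbb{N}$ and $\mathcal{I}_+=\{(i,j)\in\mathcal{I}:j\geq 1\}$. Define a total order $\vartriangleleft$ on $\mathcal{I}_+$ by: $(i,j)\vartriangleleft(i',j')$ iff either $\Delta(i,j-1)<\Delta(i',j'-1)$, or $\Delta(i,j-1)=\Delta(i',j'-1)$ and $(i,j)$ is strictly larger than $(i',j')$ in the lexicographic order. Write $\vartriangleright$ for the reverse order and $\trianglerighteq$ for its non-strict version. Every nonempty subset of $\mathcal{I}_+$ has a largest element for $\vartriangleleft$; $(i_k,j_k)$, $k\geq 1$, denotes the $k$-th largest element of $\mathcal{I}_+$. System. $\lambda,\mu>0$, $\rho=\lambda/\mu$. There are $n$ server pools divided into $m$ classes, $A_n(i)$ of them of class $i$, and $\alpha_n(i)=A_n(i)/n$. Tasks arrive as a Poisson process of rate $n\lambda$ and have independent exponential service times with mean $1/\mu$; all tasks are executed in parallel.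 The occupancy state is $q=(q(i,j))_{(i,j)\in\mathcal{I}}$, where $q(i,j)$ is the number of server pools of class $i$ with at least $j$ tasks divided by $n$. $Q_n$ is the set of absolutely summable $q\in\mathbb{R}^{\mathcal I}$ with $nq(i,j)\in\mathbb{N}$ and $q(i,j+1)\leq q(i,j)\leq q(i,0)=\alpha_n(i)$ for all $(i,j)\in\mathcal{I}$. Departures: in state $q$, for each $(i,j)\in\mathcal{I}_+$, $q(i,j)$ decreases by $1/n$ at rate $n\mu j[q(i,j)-q(i,j+1)]$. Arrivals occur at rate $n\lambda$; a task assigned to coordinates $(i,j)\in\mathcal{I}_+$ (a pool of class $i$ with exactly $j-1$ tasks) increases $q(i,j)$ by $1/n$. JLMU: an arrival in state $q$ is assigned to coordinates $\sigma(q)=\max\{(i,j)\in\mathcal{I}_+:q(i,j-1)>q(i,j)\}$, the maximum being with respect to $\vartriangleleft$. The state space $S_n$ of $\boldsymbol{q}_n$ is the set of states in $Q_n$ reachable from the empty occupancy state (all pools with zero tasks). SLTA, with parameter $\beta_n>0$: the state is $(q,r)$ with $q\in Q_n$ and $r\geq 1$ an integer. Let $\ell_i(r)=\max\{j\geq 0: j=0\text{ or }(i,j)\vartriangleright(i_r,j_r)\}$. A server pool of class $i$ with exactly $j-1$ tasks has a green token if $j-1<\ell_i(r)$, and a yellow token if $i=i_r$ and $j-1\leq\ell_i(r)$ (it can have both). When a task arrives: if there are green tokens of classes $i\neq i_{r-1}$, one of these is picked uniformly at random and the task is sent to the corresponding pool; if the only green tokens are of class $i_{r-1}$, one of these is picked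 uniformly at random; if there are only yellow tokens, a yellow token is picked uniformly at random; if there are no tokens, the task is sent to a pool chosen uniformly at random. In addition, depending on the state right before the arrival, after the task is dispatched: $r$ is decreased by one if $r>1$, there are at least $n\beta_n$ green tokens and at least one of them belongs to a pool of class $i_{r-1}$; $r$ is increased by one if there are no green tokens and at most one yellow token; otherwise $r$ is unchanged. The state space $S_n$ of $(\boldsymbol{q}_n,\boldsymbol{r}_n)$ is the set of states reachable from the empty occupancy state with $r=1$. Standing assumptions on the sequence of systems. As $n\to\infty$, $\alpha_n(i)\to\alpha(i)\in(0,1)$ for all $i$. For SLTA also: with $\sigma_*$ the unique element of $\mathcal{I}_+$ such that $\sum_{(i,j)\vartriangleright\sigma_*}\alpha(i)\leq\rho<\sum_{(i,j)\trianglerighteq\sigma_*}\alpha(i)$, the first inequality is strict; and there is $\gamma_0\in(0,1/2)$ with $\lim_n\beta_n=0$ and $\liminf_nn^{\gamma_0}\beta_n>0$.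
   Formalization: For SLTA the claim is shown for each n at which every class has a server pool and β_n ≤ α_n(i_1), conditions shown to hold for all large n; otherwise r may be unable to decrease, so the chain need not be irreducible. *)

(* Defs.v *)
From HB Require Import structures.
From Stdlib Require Export Relations.Relation_Operators.
From mathcomp Require Export all_boot all_order all_algebra.
From mathcomp Require Export archimedean.
From mathcomp Require Export all_classical all_reals all_analysis.

Set Implicit Arguments.
Unset Strict Implicit.
Unset Printing Implicit Defensive.

Import Order.TTheory GRing.Theory Num.Theory.
Import numFieldNormedType.Exports.
Local Open Scope classical_set_scope.
Local Open Scope ring_scope.

Section MarkovChains.
Variables (R : realType) (T : choiceType) (S : set T) (rate : T -> T -> R).

(* S is meant to be countable and closed under jumps of positive rate. *)
Definition exit_rate (x : T) : R :=
  fine (\esum_(y in S `\ x) (rate x y)%:E)%E.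

Definition jump_prob (x y : T) : R :=
  if x == y then 0 else rate x y / exit_rate x.

Definition reachable_from (x : T) : set T :=
  [set y | clos_refl_trans T (fun a b => 0 < rate a b) x y].

(* A chain with state space S and off-diagonal jump rates [rate], given by its
   jump chain and its holding times under a family of laws [law x], where x is
   the initial state.  [chain_fdd] says that, under [law x], the jump chain is
   a discrete-time Markov chain started at x with transition matrix [jump_prob]
   and that, given the jump chain, the holding times are independent
   exponentials whose rates are the exit rates of the successive states.
   Holding times are real, so no state is absorbing.  [law x] is meaningful
   only for x in S. *)
Record ctmc := Ctmc {
  ctmc_display : measure_display;
  ctmc_space : measurableType ctmc_display;
  law : T -> probability ctmc_space R;
  jump_chain : nat -> ctmc_space -> T;
  holding_time : nat -> ctmc_space -> R;
  jump_chain_in : forall k w, S (jump_chain k w);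
  measurable_jump_chain : forall k y,
    measurable [set w | jump_chain k w = y];
  measurable_holding_time : forall k,
    measurable_fun setT (holding_time k);
  chain_fdd : forall x, S x -> forall (k : nat) (y : nat -> T) (t : nat -> R),
    (forall i, (i <= k)%N -> S (y i)) -> (forall i, (i <= k)%N -> 0 <= t i) ->
    law x [set w | forall i, (i <= k)%N ->
                     jump_chain i w = y i /\ t i < holding_time i w] =
    ((x == y 0%N)%:R
      * (\prod_(i < k) jump_prob (y i) (y i.+1))
      * (\prod_(i < k.+1) expR (- (exit_rate (y i) * t i))))%:E
}.

Section Properties.
Variable X : ctmc.

Definition jump_time (k : nat) (w : ctmc_space X) : R :=
  \sum_(i < k) holding_time i w.

(* The event X_t = y; after an explosion the chain is in no state. *)
Definition chain_at (t : R) (y : T) : set (ctmc_space X) :=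
  [set w | exists k, jump_time k w <= t < jump_time k.+1 w /\
                     jump_chain k w = y].

Definition transition (t : R) (x y : T) : \bar R := law X x (chain_at t y).

Definition irreducible : Prop :=
  forall x y, S x -> S y -> exists t, 0 <= t /\ (0 < transition t x y)%E.

(* inf {t >= J_1 : X_t = x}, where J_1 is the first jump time *)
Definition passage_time (x : T) (w : ctmc_space X) : \bar R :=
  ereal_inf [set t%:E | t in [set t | jump_time 1 w <= t /\ chain_at t x w]].

Definition positive_recurrent : Prop :=
  forall x, S x -> (\int[law X x]_w passage_time x w < +oo)%E.

Definition is_distribution (pi : T -> R) : Prop :=
  [/\ forall x, 0 <= pi x, forall x, ~ S x -> pi x = 0 &
      (\esum_(x in S) (pi x)%:E = 1)%E].

Definition stationary (pi : T -> R) : Prop :=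
  is_distribution pi /\
  forall t y, 0 <= t -> S y ->
    (\esum_(x in S) ((pi x)%:E * transition t x y) = (pi y)%:E)%E.

End Properties.
End MarkovChains.

(* Classes are numbered from 0 and there are m.+1 of them. *)

Section Ranking.
Variables (R : realType) (m : nat) (u : 'I_m.+1 -> R -> R).

Definition coord : choiceType := ('I_m.+1 * nat)%type.

Definition Iplus : set coord := [set p | (1 <= p.2)%N].

Definition Delta (i : 'I_m.+1) (j : nat) : R := u i j.+1%:R - u i j%:R.

Definition lex_lt (p q : coord) : bool :=
  (p.1 < q.1)%N || ((p.1 == q.1) && (p.2 < q.2)%N).

Definition rank_lt (p q : coord) : bool :=
  (Delta p.1 p.2.-1 < Delta q.1 q.2.-1)
  || ((Delta p.1 p.2.-1 == Delta q.1 q.2.-1) && lex_lt q p).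

Definition rank_le (p q : coord) : bool := (p == q) || rank_lt p q.

(* Every nonempty subset of [Iplus] has a largest element when the u i are
   concave; the default value (0, 0) is not in [Iplus]. *)
Definition rank_max (A : set coord) : coord :=
  xget (ord0, 0%N) [set p | A p /\ forall q, A q -> rank_le q p].

(* (i_k, j_k), for k >= 1 *)
Definition ranked (k : nat) : coord :=
  xget (ord0, 0%N)
    [set p | Iplus p /\ ([set q | Iplus q /\ rank_lt p q] #= `I_k.-1)%card].

Definition ell (r : nat) (i : 'I_m.+1) : nat :=
  let L := [set j | j = 0%N \/ (Iplus (i, j) /\ rank_lt (ranked r) (i, j))] in
  xget 0%N [set j | L j /\ forall j', L j' -> (j' <= j)%N].

End Ranking.

Section System.
Variables (R : realType) (m : nat) (u : 'I_m.+1 -> R -> R).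
Variables (lambda mu : R) (n : nat) (A : 'I_m.+1 -> nat).

Definition occupancy : choiceType := ('I_m.+1 -> nat -> R).

Definition alpha_ (i : 'I_m.+1) : R := (A i)%:R / n%:R.

Definition Qn : set occupancy :=
  [set q | summable setT (fun p : coord m => (q p.1 p.2)%:E) /\
    forall i j, [/\ n%:R * q i j \is a Num.nat, q i j.+1 <= q i j,
                    q i j <= q i 0%N & q i 0%N = alpha_ i]].

Definition empty_state : occupancy :=
  fun i j => if j == 0%N then alpha_ i else 0.

Definition shift (q : occupancy) (p : coord m) (c : R) : occupancy :=
  fun i j => if (i, j) == p then q i j + c else q i j.

(* A sum over the infinite set [Iplus] with at most one nonzero term, since
   distinct p lead to distinct states; likewise in [slta_rate]. *)
Definition departure_rate (q q' : occupancy) : R :=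
  \sum_(p \in @Iplus m)
    (q' == shift q p (- n%:R^-1))%:R
      * (n%:R * mu * p.2%:R * (q p.1 p.2 - q p.1 p.2.+1)).

Definition sigma (q : occupancy) : coord m :=
  rank_max u [set p | Iplus p /\ q p.1 p.2 < q p.1 p.2.-1].

Definition jlmu_rate (q q' : occupancy) : R :=
  departure_rate q q'
  + (q' == shift q (sigma q) n%:R^-1)%:R * (n%:R * lambda).

Definition jlmu_states : set occupancy :=
  Qn `&` reachable_from jlmu_rate empty_state.

Variable beta : R.

Definition slta_state : choiceType := (occupancy * nat)%type.

Section Tokens.
Variables (q : occupancy) (r : nat).

(* number of pools of class i with exactly k tasks *)
Definition pools (i : 'I_m.+1) (k : nat) : R := n%:R * (q i k - q i k.+1).

Definition has_green (i : 'I_m.+1) (k : nat) : bool := (k < ell u r i)%N.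

Definition has_yellow (i : 'I_m.+1) (k : nat) : bool :=
  (i == (ranked u r).1) && (k <= ell u r i)%N.

(* i_{r-1}; irrelevant for r = 1, when there are no green tokens *)
Definition prev_class : 'I_m.+1 := (ranked u r.-1).1.

Definition green_class (i : 'I_m.+1) : R := \sum_(k < ell u r i) pools i k.

Definition green : R := \sum_(i < m.+1) green_class i.

Definition green_other : R := \sum_(i < m.+1 | i != prev_class) green_class i.

Definition yellow : R :=
  \sum_(k < (ell u r (ranked u r).1).+1) pools (ranked u r).1 k.

(* probability that an arriving task is sent to coordinates p *)
Definition assign_prob (p : coord m) : R :=
  let i := p.1 in let k := p.2.-1 in
  if 0 < green_other then
    if has_green i k && (i != prev_class) then pools i k / green_other else 0
  else if 0 < green then
    if has_green i k && (i == prev_class) then pools i k / green else 0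
  else if 0 < yellow then
    if has_yellow i k then pools i k / yellow else 0
  else pools i k / n%:R.

Definition next_r : nat :=
  if [&& (1 < r)%N, n%:R * beta <= green & 0 < green_class prev_class] then r.-1
  else if (green == 0) && (yellow <= 1) then r.+1
  else r.

End Tokens.

Definition slta_rate (s s' : slta_state) : R :=
  (s'.2 == s.2)%:R * departure_rate s.1 s'.1
  + (s'.2 == next_r s.1 s.2)%:R
    * \sum_(p \in @Iplus m)
        (s'.1 == shift s.1 p n%:R^-1)%:R
          * (n%:R * lambda * assign_prob s.1 s.2 p).

Definition slta_states : set slta_state :=
  [set s | [/\ Qn s.1, (1 <= s.2)%N &
               reachable_from slta_rate (empty_state, 1%N) s]].

(* Every class has a pool, and the threshold for decreasing r does not exceed
   the number of pools of the top class i_1; without this r may never return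
   to 1 after having left it. *)
Definition slta_nondegenerate : Prop :=
  (forall i, (0 < A i)%N) /\ beta <= alpha_ (ranked u 1).1.

End System.

Definition is_sigma_star (R : realType) (m : nat) (u : 'I_m.+1 -> R -> R)
    (alpha : 'I_m.+1 -> R) (rho : R) (s : coord m) : Prop :=
  [/\ Iplus s,
      (\esum_(p in [set p | Iplus p /\ rank_lt u s p]) (alpha p.1)%:E
         <= rho%:E)%E &
      (rho%:E <
         \esum_(p in [set p | Iplus p /\ rank_le u s p]) (alpha p.1)%:E)%E].

(* Main.v *)
(* Both chains are driven by the number N of tasks, which dies at rate mu * N and
   grows at rate n * lambda; under SLTA the index r grows only when no pool has
   a green token, which forces N >= r - 1, and it decreases at every arrival
   that finds the system empty. Hence an explicit function of (N, r) has, for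
   the embedded jump chain, drift at most a negative constant off the empty
   state, and adding a multiple of the indicator of "not b" moves the
   exceptional state along any edge a -> b, hence to every state.

   From such a function for x, the mass of the excursions from x that last more
   than k jumps is summable in k, which bounds the mean return time to x. The
   expected numbers of visits during an excursion, divided by the exit rates,
   give after normalization a measure pi with pi Q <= 0 and total flow
   sum_x pi(x) q(x) finite. Induction on the number of jumps, using only the
   memoryless property on finer and finer time grids, gives pi P_t <= pi; under
   pi the expected number of jumps before t is at most t * sum_x pi(x) q(x), so
   there is no explosion and pi P_t = pi. Uniqueness follows from irreducibility
   by comparing two stationary distributions with their minimum. *)
Require Import Defs.
From Stdlib Require Import Relations.Operators_Properties.
From mathcomp Require Import ring lra zify measurable_realfun.

Set Implicit Arguments.
Unset Strict Implicit.
Unset Printing Implicit Defensive.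

Import Order.TTheory GRing.Theory Num.Theory.
Import numFieldNormedType.Exports.
Local Open Scope classical_set_scope.
Local Open Scope ring_scope.

(** * Countable sums *)

Section CountableSums.
Local Open Scope ereal_scope.

(** A chain is known only through the joint laws of its jumps and holding times: neither the
    semigroup property of the transition function nor the Kolmogorov equations are at hand, and
    explosion is possible a priori. Stationarity is therefore reached through an inequality, which
    needs only events with finitely many jumps; once no mass is lost, an inequality between two
    measures of the same finite mass is an equality. Exit rates grow with the number of tasks, so
    the drift is measured per jump. The lower bound [n * lambda] on exit rates turns jumps into
    time, and the finite mean number of jumps of an excursion is the finite flow that excludes
    explosion. Under SLTA the index r is unbounded, and a decrease is guaranteed only when an
    arrival finds no task. The drift function must therefore reward draining even while r may be
    growing, which is why it combines linear terms with bounded geometric ones. JLMU uses the same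
    function with r frozen. *)

Lemma measure_bigcup_countable (R : realType) d (W : measurableType d)
    (P : {measure set W -> \bar R}) (T : choiceType) (S : set T)
    (F : T -> set W) :
  countable S -> (forall y, S y -> measurable (F y)) -> trivIset S F ->
  measurable (\bigcup_(y in S) F y) /\
  P (\bigcup_(y in S) F y) = \esum_(y in S) P (F y).
Proof.
move=> /countable_injP[f finj] mF tF.
pose G n := \bigcup_(y in S `&` [set y | f y = n]) F y.
have GE y : S y -> G (f y) = F y.
  move=> Sy; apply/seteqP; split=> [w [z [Sz fzy] Fzw]|w Fyw]; last by exists y.
  by rewrite -(finj _ _ _ _ fzy)// inE.
have mG n : (f @` S) n -> measurable (G n).
  by move=> [y Sy <-]; rewrite GE//; exact: mF.
have -> : \bigcup_(y in S) F y = \bigcup_(n in f @` S) G n.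
  by rewrite bigcup_image; apply: eq_bigcupr => y Sy; rewrite GE.
split; first exact: bigcup_measurable.
rewrite measure_bigcup //; last first.
  move=> _ _ [y Sy <-] [z Sz <-] [w]; rewrite !GE// => Fw.
  by congr f; apply: tF => //; exists w.
rewrite nneseries_esum//.
rewrite (_ : [set x | _] = f @` S); last first.
  by apply/seteqP; split => x /=; rewrite inE.
rewrite esum_image; last by move=> x y xS yS; apply: finj.
by apply: eq_esum => y Sy; rewrite GE.
Qed.

Lemma esumZl (R : realType) (T : choiceType) (S : set T) (a : T -> \bar R)
    (c : R) : (0 <= c)%R -> (forall x, S x -> 0 <= a x) ->
  \esum_(x in S) (c%:E * a x) = c%:E * \esum_(x in S) a x.
Proof.
rewrite le_eqVlt => /predU1P[<-|c0] a0.
  by rewrite mul0e esum1// => i _; rewrite mul0e.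
(* Used with [c] and, for the converse, with [c^-1] and the family [c * a]. *)
have le_half (b : T -> \bar R) (k : R) : (0 < k)%R ->
    (forall x, S x -> 0 <= b x) ->
    \esum_(x in S) (k%:E * b x) <= k%:E * \esum_(x in S) b x.
  move=> k0 b0; apply: ge_ereal_sup => _ [X [finX XS] <-].
  rewrite (_ : \sum_(x \in X) _ = k%:E * \sum_(x \in X) b x).
    rewrite lee_pmul2l// ?lte_fin//; apply: ereal_sup_ubound; exists X => //.
  rewrite !fsbig_finite//= big_seq [in RHS]big_seq ge0_sume_distrr// => i.
  by rewrite in_fset_set// inE => /XS /b0.
apply/eqP; rewrite eq_le le_half//=.
have ca0 x : S x -> 0 <= c%:E * a x by move=> /a0 ?; rewrite mule_ge0// lee_fin ltW.
have ci0 : (0 < c^-1)%R by rewrite invr_gt0.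
rewrite -lee_pdivlMl// (le_trans _ (le_half _ _ ci0 ca0))//.
apply: le_esum => x Sx; rewrite muleA -EFinM mulVf ?mul1e// gt_eqF//.
Qed.

Lemma esum_interchange (R : realType) (T U : choiceType) (S : set T) (V : set U)
    (a : T -> U -> \bar R) : (forall x y, S x -> V y -> 0 <= a x y) ->
  \esum_(x in S) \esum_(y in V) a x y = \esum_(y in V) \esum_(x in S) a x y.
Proof.
move=> a0; rewrite (@esum_esum _ _ _ S (fun=> V))//.
rewrite (@esum_esum _ _ _ V (fun=> S) (fun y x => a x y))//; last first.
  by move=> i j Vi Sj; apply: a0.
rewrite (reindex_esum (V `*`` (fun=> S)) _ (fun x => (x.2, x.1)))//; split=> /=.
- by move=> [i j] [].
- by move=> [i1 i2] [j1 j2] /= _ _ [] -> ->.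
- by move=> [i1 i2] [Pi1 Qi2] /=; exists (i2, i1).
Qed.

Lemma esumD1 (R : realType) (T : choiceType) (S : set T) (f : T -> \bar R) y :
  S y -> (forall x, S x -> 0 <= f x) ->
  \esum_(x in S) f x = f y + \esum_(x in S `\ y) f x.
Proof.
move=> Sy f0; rewrite (esumID [set y])// setDE; congr (_ + _).
rewrite (_ : S `&` [set y] = [set y]) ?esum_set1 ?f0//.
by apply/seteqP; split => [x []//|x ->].
Qed.

(** A deficit at [y] could not be made up by the other terms, which are dominated too. This turns
    sub-invariance without loss of mass into invariance. *)
Lemma eq_of_le_esum (R : realType) (T : choiceType) (S : set T)
    (f g : T -> \bar R) :
  (forall x, S x -> 0 <= f x <= g x) -> \esum_(x in S) g x \is a fin_num ->
  \esum_(x in S) g x <= \esum_(x in S) f x -> forall y, S y -> f y = g y.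
Proof.
move=> fg gfin gf y Sy.
have f0 x : S x -> 0 <= f x by move=> /fg/andP[].
have g0 x : S x -> 0 <= g x by move=> /fg/andP[f0' /(le_trans f0')].
have le_rest : \esum_(x in S `\ y) f x <= \esum_(x in S `\ y) g x.
  by apply: le_esum => x [/fg/andP[]].
have /andP[_ fgy] := fg y Sy.
move: gfin gf; rewrite (esumD1 Sy f0) (esumD1 Sy g0) fin_numD => /andP[gy gr] gf.
apply/eqP; rewrite eq_le fgy/= -(leeD2rE _ _ gr).
by apply: le_trans gf _; rewrite leeD2l.
Qed.

End CountableSums.

(** * Independence of the future from the past of the jump chain *)

Section ChainLaw.
Variables (R : realType) (T : choiceType) (S : set T) (rate : T -> T -> R).

(** [exit_rate] is a [fine], which sends [+oo] to 0, so positivity excludes infinite exit rates as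
    well as absorbing states. *)
Definition conservative : Prop :=
  [/\ countable S, forall x, S x -> 0 < exit_rate S rate x,
      forall x y, S x -> 0 <= jump_prob S rate x y &
      forall x, S x -> (\esum_(y in S) (jump_prob S rate x y)%:E = 1)%E].

Variable X : ctmc S rate.
Local Notation q := (exit_rate S rate).
Local Notation p := (jump_prob S rate).
Local Notation W := (ctmc_space X).
Local Notation Y := (@jump_chain R T S rate X).
Local Notation H := (@holding_time R T S rate X).

(** A general initial law: stationarity is obtained by running the chain under a mixture of the
    measures [law x], and the estimates below serve both cases. *)
Definition started_from (nu : T -> R) (P : set W -> \bar R) : Prop :=
  forall (k : nat) (y : nat -> T) (t : nat -> R),
    (forall i, (i <= k)%N -> S (y i)) -> (forall i, (i <= k)%N -> 0 <= t i) ->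
    P [set w | forall i, (i <= k)%N -> Y i w = y i /\ t i < H i w] =
    (nu (y 0%N)
      * (\prod_(i < k) p (y i) (y i.+1))
      * (\prod_(i < k.+1) expR (- (q (y i) * t i))))%:E.

Definition pos_hold : set W := [set w | forall i, 0 < H i w].

Definition at_path (k : nat) (y : nat -> T) : set W :=
  [set w | forall i, (i < k)%N -> Y i w = y i].

Definition cylinder (k l : nat) (B : nat -> set T) (C : nat -> set R) : set W :=
  [set w | (forall i, (i < k)%N -> B i (Y i w)) /\
           (forall i, (i < l)%N -> C i (H i w))].

(* Holding times are positive only almost surely, hence the guard [0 < x]. *)
Definition ray (C : set R) (s : R) : Prop :=
  [/\ measurable C, 0 <= s & forall x, 0 < x -> C x <-> s < x].

(** States and holding times are counted separately: the law of a holding time is taken given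
    [past k.+1 k], that of the next state given [past k.+1 k.+1]. Rays are sets to which the
    finite-dimensional laws assign a probability, and they are stable under intersection. *)
Definition past_gen (k l : nat) : set (set W) :=
  [set D | exists B C, (forall i, exists s, ray (C i) s) /\
                       D = cylinder k l B C].

Definition past (k l : nat) : set (set W) := <<s past_gen k l>>.

Hypothesis consS : conservative.

Let Scount : countable S. Proof. by case: consS. Qed.

Lemma measurable_jump_in i (B : set T) : measurable [set w : W | B (Y i w)].
Proof.
have -> : [set w : W | B (Y i w)] =
    \bigcup_(y in S `&` B) [set w | Y i w = y].
  apply/seteqP; split => [w Bw|w [y [_ By] /= ->]//].
  by exists (Y i w) => //; split => //; exact: jump_chain_in.
(* Only the measurability half is wanted here; the Dirac measure is a placeholder. *)
apply: (@measure_bigcup_countable R _ W (dirac point) _ _ _ _ _ _).1.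
- exact: (sub_countable (subset_card_le (@subIsetl _ _ _)) Scount).
- by move=> y _; exact: measurable_jump_chain.
- by move=> y z _ _ [w [h1 h2]]; rewrite -(h1 : _ = y) -(h2 : _ = z).
Qed.

Lemma measurable_at_path k y : measurable (at_path k y).
Proof.
have -> : at_path k y = \bigcap_(i in `I_k) [set w | Y i w = y i].
  by apply/seteqP; split.
by apply: bigcap_measurableType => i _; exact: measurable_jump_chain.
Qed.

Lemma measurable_hold_in i (C : set R) :
  measurable C -> measurable [set w : W | C (H i w)].
Proof. by move=> mC; rewrite -[X in measurable X]setTI; exact: measurable_holding_time. Qed.

Lemma measurable_cylinder k l B C : (forall i, measurable (C i)) ->
  measurable (cylinder k l B C).
Proof.
move=> mC.
have -> : cylinder k l B C = \bigcap_(i in `I_k) [set w | B i (Y i w)] `&`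
    \bigcap_(i in `I_l) [set w | C i (H i w)].
  by apply/seteqP; split.
apply: measurableI; apply: bigcap_measurableType => i _.
- exact: measurable_jump_in.
- exact: measurable_hold_in.
Qed.

Lemma measurable_pos_hold : measurable pos_hold.
Proof.
have -> : pos_hold = \bigcap_i [set w | (`]0, +oo[%classic : set R) (H i w)].
  apply/seteqP; split => [w w0 i _|w w0 i]; rewrite /= ?in_itv/= ?andbT//.
  by have := w0 i Logic.I; rewrite /= in_itv/= andbT.
by apply: bigcap_measurableType => i _; apply: measurable_hold_in.
Qed.

Lemma past_measurable k l D : past k l D -> measurable D.
Proof.
apply: smallest_sub; last first.
  by move=> _ [B [C [rC ->]]]; apply: measurable_cylinder => i; have [s []] := rC i.
exact: sigma_algebra_measurable.
Qed.

Variables (nu : T -> R) (P : {measure set W -> \bar R}).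
Hypotheses (PT : P setT = 1%E) (nu_ge0 : forall x, 0 <= nu x)
  (nu1 : (\esum_(x in S) (nu x)%:E = 1)%E).
Hypothesis fddP : started_from nu P.

Lemma measure_partition j D : measurable D ->
  P D = (\esum_(z in S) P (D `&` [set w | Y j w = z]))%E.
Proof.
move=> mD.
have [|//|_ <-] := @measure_bigcup_countable R _ W P _ S
  (fun z => D `&` [set w | Y j w = z]) Scount.
- by move=> z _; apply: measurableI => //; exact: measurable_jump_chain.
- by move=> z z' _ _ [w [[_ /= <-] [_ /= <-]]].
congr (P _); apply/seteqP; split => [w Dw|w [z _ []]//].
by exists (Y j w) => //; exact: jump_chain_in.
Qed.

Let path_upd (y : nat -> T) (j : nat) (z : T) (i : nat) : T :=
  if (i < j)%N then y i else z.

Let at_pathS j y z :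
  at_path j y `&` [set w | Y j w = z] = at_path j.+1 (path_upd y j z).
Proof.
apply/seteqP; split => [w [yw zw] i|w yw].
  rewrite ltnS leq_eqVlt /path_upd => /predU1P[->|ij]; first by rewrite ltnn.
  by rewrite ij yw.
split => [i ij|]; last by rewrite /= yw// /path_upd ltnn.
by rewrite yw /path_upd ?ij// ltnS ltnW.
Qed.

(** The finite-dimensional laws mention a holding time only together with its state. The states
    after [j] are released one at a time by summing over them, the rows of the jump matrix having
    sum 1. *)
Let pos_path d : forall j y, (forall i, (i <= j)%N -> S (y i)) ->
  P (at_path j.+1 y `&` [set w | forall i, (i <= j + d)%N -> 0 < H i w])
  = (nu (y 0%N) * \prod_(i < j) p (y i) (y i.+1))%:E.
Proof.
elim: d => [|d IHd] j y Sy.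
  have := fddP Sy (t := fun=> 0) (fun _ _ => lexx _).
  rewrite [X in _ * X]big1 ?mulr1; last by move=> i _; rewrite mulr0 oppr0 expR0.
  move=> <-; congr (P _); rewrite addn0; apply/seteqP; split => [w [yw pw] i ij|w yw].
    by split; [exact: yw|exact: pw].
  by split => i ij; case: (yw i).
rewrite (measure_partition j.+1); last first.
  apply: measurableI; first exact: measurable_at_path.
  have -> : [set w | forall i, (i <= j + d.+1)%N -> 0 < H i w] =
      cylinder 0 (j + d.+1).+1 (fun=> setT) (fun=> `]0, +oo[%classic).
    apply/seteqP; split => [w pw|w [_ pw] i ij].
      by split => // i ij; rewrite /= in_itv/= andbT; exact: pw.
    by have := pw _ ij; rewrite /= in_itv/= andbT.
  by apply: measurable_cylinder.
have upd_lt z i : (i <= j)%N -> path_upd y j.+1 z i = y i.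
  by move=> ij; rewrite /path_upd ltnS ij.
transitivity (\esum_(z in S)
    ((nu (y 0%N) * \prod_(i < j) p (y i) (y i.+1))%:E * (p (y j) z)%:E))%E.
  apply: eq_esum => z Sz; rewrite setIAC at_pathS addnS -addSn IHd.
    rewrite big_ord_recr/= -EFinM -mulrA upd_lt//; congr (_ * (_ * _))%:E.
      by apply: eq_bigr => i _; rewrite !upd_lt// ltnW.
    by rewrite upd_lt// /path_upd ltnn.
  by move=> i _; rewrite /path_upd; case: ifPn => //; exact: Sy.
have [_ _ p0 p1] := consS; have Syj := Sy _ (leqnn j).
rewrite esumZl; first by rewrite p1// mule1.
- apply: mulr_ge0 => //; apply: prodr_ge0 => i _.
  by apply: p0; apply: Sy; exact: ltnW.
- by move=> z _; rewrite lee_fin p0.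
Qed.

Lemma law_le1 D : measurable D -> (P D <= 1)%E.
Proof. by move=> mD; rewrite -PT le_measure ?inE. Qed.

Lemma law_fin D : measurable D -> P D \is a fin_num.
Proof.
move=> mD; rewrite ge0_fin_numE//; exact: le_lt_trans (law_le1 mD) (ltry _).
Qed.

Let pos_upto k : P [set w | forall i, (i <= k)%N -> 0 < H i w] = 1%E.
Proof.
rewrite (measure_partition 0%N); last first.
  have -> : [set w : W | forall i, (i <= k)%N -> 0 < H i w] =
      cylinder 0 k.+1 (fun=> setT) (fun=> `]0, +oo[%classic).
    apply/seteqP; split => [w pw|w [_ pw] i ij].
      by split => // i ij; rewrite /= in_itv/= andbT; exact: pw.
    by have := pw _ ij; rewrite /= in_itv/= andbT.
  by apply: measurable_cylinder.
rewrite -[RHS]nu1; apply: eq_esum => z Sz.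
have := @pos_path k 0%N (fun=> z) (fun _ _ => Sz).
rewrite big_ord0 mulr1 add0n => <-; congr (P _).
apply/seteqP; split => [w [pw /= zw]|w [zw pw]]; first by split => // -[].
by split => //; exact: zw.
Qed.

Lemma pos_hold_ae : P (~` pos_hold) = 0%E.
Proof.
have mC k : measurable [set w : W | H k w <= 0].
  have := @measurable_hold_in k `]-oo, 0] (measurable_itv _).
  by congr measurable; apply/seteqP; split => w; rewrite /= in_itv.
have -> : ~` pos_hold = \bigcup_k [set w | H k w <= 0].
  apply/seteqP; split => [w /existsNP[k /negP]|w [k _ /= Hk] /(_ k)].
    by rewrite -leNgt => Hk; exists k.
  by rewrite ltNge Hk.
apply/eqP; rewrite -measure_le0.
apply: (le_trans (measure_sigma_subadditive _ _ _ (@subset_refl _ _))) => //.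
  exact: bigcup_measurable.
rewrite eseries0// => k _ _; apply/eqP; rewrite -measure_le0.
have mp : measurable [set w : W | forall i, (i <= k)%N -> 0 < H i w].
  have -> : [set w : W | forall i, (i <= k)%N -> 0 < H i w] =
      \bigcap_(i in `I_k.+1) ~` [set w | H i w <= 0].
    apply/seteqP; split => [w pw i ik /=|w pw i ik].
      by apply/negP; rewrite -ltNge; apply: pw.
    by rewrite ltNge; apply/negP; exact: (pw i).
  by apply: bigcap_measurableType => i _; exact: measurableC.
have : (P ([set w | (H k w <= 0)%R] `|`
    [set w | forall i, (i <= k)%N -> (0 < H i w)%R]) <= 1)%E.
  by apply: law_le1; exact: measurableU.
rewrite measureU//; first by rewrite [X in (_ + X <= _)%E](pos_upto k) -[leRHS]add0e leeD2rE.
apply/seteqP; split => w //= [Hk /(_ k (leqnn _))].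
by rewrite ltNge Hk.
Qed.

Lemma law_pos D : measurable D -> P (D `&` pos_hold) = P D.
Proof.
move=> mD; have mp := measurable_pos_hold.
rewrite [RHS](measureDI P mD mp) [X in _ = (X + _)%E]( _ : _ = 0%E) ?add0e//.
apply/eqP; rewrite -measure_le0 -pos_hold_ae setDE.
by apply: measureIr => //; exact: measurableC.
Qed.

(** Many later inclusions rely on positive holding times; intersecting with this almost sure event
    costs nothing. *)
Lemma le_law_pos D E : measurable D -> measurable E ->
  D `&` pos_hold `<=` E -> (P D <= P E)%E.
Proof.
move=> mD mE DE; rewrite -(law_pos mD); apply: le_measure => //; rewrite inE//.
by apply: measurableI => //; exact: measurable_pos_hold.
Qed.

Lemma eq_law_pos D E : measurable D -> measurable E ->
  (forall w, pos_hold w -> D w <-> E w) -> P D = P E.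
Proof.
move=> mD mE DE; apply/eqP; rewrite eq_le !le_law_pos//.
- by move=> w [Ew /DE[_ ]]; exact.
- by move=> w [Dw /DE[+ _]]; exact.
Qed.

(** Rays allow a holding time to be left unconstrained: [setT] is a ray with threshold 0, and its
    exponential factor is 1. *)
Lemma fdd_ray k y C s :
  (forall i, (i <= k)%N -> S (y i)) -> (forall i, ray (C i) (s i)) ->
  P (at_path k.+1 y `&` [set w | forall i, (i <= k)%N -> C i (H i w)]) =
  (nu (y 0%N) * \prod_(i < k) p (y i) (y i.+1) *
   \prod_(i < k.+1) expR (- (q (y i) * s i)))%:E.
Proof.
move=> Sy rC.
have mC i : measurable (C i) by have [] := rC i.
rewrite -(fddP Sy); last by move=> i _; have [] := rC i.
have mD C' : (forall i, measurable (C' i)) -> measurable (at_path k.+1 y `&`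
     [set w : W | forall i, (i <= k)%N -> C' i (H i w)]).
  move=> mC'; rewrite (_ : _ `&` _ = cylinder k.+1 k.+1 (fun i => [set y i]) C').
    exact: measurable_cylinder.
  by apply/seteqP; split => w [].
have -> : [set w : W | forall i, (i <= k)%N -> Y i w = y i /\ s i < H i w] =
    at_path k.+1 y `&` [set w | forall i, (i <= k)%N -> `]s i, +oo[%classic (H i w)].
  apply/seteqP; split => [w yw|w [yw sw] i ik].
    by split => i /yw[] //; rewrite /= in_itv/= andbT.
  by split; [exact: yw|have := sw _ ik; rewrite /= in_itv/= andbT].
apply: eq_law_pos; [exact: mD|by apply: (mD (fun i => `]s i, +oo[%classic))|].
move=> w pw; split => -[yw Cw]; split => // i ik; have [_ _ /(_ _ (pw i)) Ci] := rC i.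
- by rewrite /= in_itv/= andbT; apply/Ci/Cw.
- by apply/Ci; have := Cw _ ik; rewrite /= in_itv/= andbT.
Qed.

Section PastIndependence.
Variables (k l : nat) (F E : set W) (c : R).
Hypotheses (mF : measurable F) (mE : measurable E) (c0 : 0 <= c).
Hypothesis indep_path : forall y C s,
  (forall i, (i < k)%N -> S (y i)) -> (forall i, ray (C i) (s i)) ->
  P (at_path k y `&` [set w | forall i, (i < l)%N -> C i (H i w)] `&` F `&` E) =
  (c%:E * P (at_path k y `&` [set w | forall i, (i < l)%N -> C i (H i w)] `&` F))%E.

Let indep D := P (D `&` F `&` E) = (c%:E * P (D `&` F))%E.

(** A cylinder constrains states to arbitrary sets, whereas [indep_path] treats prescribed paths:
    states are fixed one after the other, by induction on the number [d] of those still free. *)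
Let indep_cylinder_path d B C :
  (forall i, exists s, ray (C i) s) ->
  forall j y, (j + d)%N = k -> (forall i, (i < j)%N -> S (y i)) ->
  indep (cylinder k l B C `&` at_path j y).
Proof.
move=> rC.
have mC i : measurable (C i) by have [s []] := rC i.
elim: d => [|d IHd] j y; rewrite ?addn0 => jk Sy; rewrite /indep.
  subst j.
  have /choice[s Cs] := rC.
  have [By|nBy] := pselect (forall i, (i < k)%N -> B i (y i)); last first.
    have -> : cylinder k l B C `&` at_path k y = set0.
      apply/seteqP; split => // w [[Bw _] yw]; apply: nBy => i ik.
      by rewrite -yw//; exact: Bw.
    by rewrite !set0I measure0 mule0.
  have -> : cylinder k l B C `&` at_path k y =
      at_path k y `&` [set w | forall i, (i < l)%N -> C i (H i w)].
    apply/seteqP; split => [w [[Bw Cw] yw]|w [yw Cw]]; first by split.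
    by split => //; split => // i ik; rewrite yw//; exact: By.
  by apply: indep_path; eassumption.
have mD : measurable (cylinder k l B C `&` at_path j y `&` F).
  apply: measurableI => //; apply: measurableI; last exact: measurable_at_path.
  exact: measurable_cylinder.
rewrite (measure_partition j); last exact: measurableI.
rewrite (measure_partition j mD) -esumZl//.
apply: eq_esum => z Sz.
have regroup V : cylinder k l B C `&` at_path j y `&` V `&` [set w | Y j w = z]
    = cylinder k l B C `&` at_path j.+1 (path_upd y j z) `&` V.
  by rewrite -at_pathS setIAC !setIA.
rewrite -[_ `&` F `&` E]setIA !regroup setIA.
apply: IHd; first by rewrite addSnnS.
by move=> i _; rewrite /path_upd; case: ifPn => //; exact: Sy.
Qed.

Let indep_gen D : past_gen k l D -> indep D.
Proof.
move=> [B [C [rC ->]]].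
have := @indep_cylinder_path k B C rC 0%N (fun=> Y 0 point) (add0n _).
rewrite (_ : at_path 0 _ = setT) ?setIT; first by apply=> // -[].
by apply/seteqP; split.
Qed.

(** Dynkin's pi-lambda argument: cylinders are stable under intersection, and the sets satisfying
    the identity form a lambda-system. The product form avoids dividing by the probability of the
    conditioning event. *)
Lemma past_indep D : past k l D -> P (D `&` F `&` E) = (c%:E * P (D `&` F))%E.
Proof.
have mpast := @past_measurable k l.
suff : past k l `<=` [set A | measurable A /\ indep A] by move=> sub /sub[].
apply: (@lambda_system_subset _ (past_gen k l) _ setT) => //.
- move=> _ _ [B [C [rC ->]]] [B' [C' [rC' ->]]].
  exists (fun i => B i `&` B' i), (fun i => C i `&` C' i); split.
    move=> i; have [s [mC s0 Cs]] := rC i; have [s' [mC' s0' Cs']] := rC' i.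
    exists (Num.max s s'); split; first exact: measurableI.
      by rewrite le_max s0.
    move=> x x0; rewrite gt_max; split=> [[/(Cs _ x0)-> /(Cs' _ x0)->]//|].
    by move=> /andP[sx sx']; split; [exact/Cs|exact/Cs'].
  apply/seteqP; split => [w [[Bw Cw] [Bw' Cw']]|w [BBw CCw]].
    by split => i il; split; [exact: Bw|exact: Bw'|exact: Cw|exact: Cw'].
  by split; split => i il; [case: (BBw i il)|case: (CCw i il)|case: (BBw i il)|case: (CCw i il)].
- have indepT : indep setT.
    apply: indep_gen; exists (fun=> setT), (fun=> setT); split.
      by move=> i; exists 0; split.
    by apply/seteqP; split.
  apply/dynkin_lambda_system; split; first by split.
    move=> A [mA iA]; split; first exact: measurableC.
    have DE V : ~` A `&` V = V `\` A by rewrite setDE setIC.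
    have mFE : measurable (F `&` E) by exact: measurableI.
    move: indepT iA; rewrite /indep !setTI -!setIA !DE !(setIC A).
    rewrite (measureDI P mFE mA) (measureDI P mF mA) ge0_muleDr// => + AE.
    have finA : (c%:E * P (F `&` A))%E \is a fin_num.
      by rewrite fin_numM//; apply: law_fin; exact: measurableI.
    by rewrite [X in (_ + X = _)%E]AE => /(congr1 (fun x => x - c%:E * P (F `&` A))%E); rewrite !addeK.
  move=> A tA AE; have mA n : measurable (A n) by case: (AE n).
  split; first exact: bigcupT_measurable.
  rewrite /indep -setIA !setI_bigcupl !measure_bigcup//; last first.
  - by apply: trivIset_setIr.
  - by move=> n _; apply: measurableI => //; exact: measurableI.
  - by apply: trivIset_setIr.
  - by move=> n _; exact: measurableI.
  rewrite -nneseriesZl//; apply: eq_eseriesr => n _.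
  by have [_] := AE n; rewrite /indep -setIA.
- move=> D' D'G; split; last exact: indep_gen.
  by apply: mpast; exact: sub_sigma_algebra.
Qed.

End PastIndependence.

Lemma ray_setT : ray setT 0.
Proof. by split. Qed.

Lemma ray_itv t : ray `]t, +oo[ (Num.max t 0).
Proof.
split; [exact: measurable_itv|by rewrite le_max lexx orbT|move=> x x0].
by rewrite /= in_itv/= andbT gt_max x0 andbT.
Qed.

Lemma measurable_hold_gt k t : measurable [set w : W | t < H k w].
Proof.
have := @measurable_hold_in k `]t, +oo[ (measurable_itv _).
by congr measurable; apply/seteqP; split => w; rewrite /= in_itv/= andbT.
Qed.

Lemma hold_indep k D y t : past k.+1 k D -> S y -> 0 <= t ->
  P (D `&` [set w | Y k w = y] `&` [set w | t < H k w]) =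
  ((expR (- (q y * t)))%:E * P (D `&` [set w | Y k w = y]))%E.
Proof.
move=> + Sy t0; apply: past_indep.
- exact: measurable_jump_chain.
- exact: measurable_hold_gt.
- by rewrite expR_ge0.
move=> yy C s Syy rC.
have [yk|/eqP yk] := eqVneq (yy k) y; last first.
  rewrite (_ : _ `&` [set w | Y k w = y] = set0) ?set0I ?measure0 ?mule0//.
  by apply/seteqP; split => // w [[yw _] /= Yk]; apply: yk; rewrite -Yk yw.
(* Slot [k] receives [setT] for the conditioning event and []t, +oo[] for the event with a long
   stay; the two probabilities differ by the exponential factor of that slot. *)
pose C' A i := if (i < k)%N then C i else A.
pose s' t i := if (i < k)%N then s i else t.
have rC' A r : ray A r -> forall i, ray (C' A i) (s' r i).
  by move=> rA i; rewrite /C' /s'; case: ifPn.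
have C'E A : at_path k.+1 yy `&` [set w | forall i, (i <= k)%N -> C' A i (H i w)] =
    at_path k.+1 yy `&` [set w | forall i, (i < k)%N -> C i (H i w)] `&`
    [set w | Y k w = y] `&` [set w | A (H k w)].
  apply/seteqP; split => [w [yw Cw]|w [[[yw Cw] Yk] Ak]]; split => //.
  - split; last by rewrite /= yw.
    by split => // i ik; have := Cw i (ltnW ik); rewrite /C' ik.
  - by have := Cw k (leqnn _); rewrite /C' ltnn.
  - move=> i; rewrite leq_eqVlt /C' => /predU1P[->|ik]; first by rewrite ltnn.
    by rewrite ik; exact: Cw.
have Syy' i : (i <= k)%N -> S (yy i) by exact: Syy.
have := fdd_ray Syy' (rC' _ _ (ray_itv t)).
have := fdd_ray Syy' (rC' _ _ ray_setT).
rewrite !C'E setIT => ->; rewrite max_l//.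
rewrite (_ : [set w | `]t, +oo[%classic (H k w)] = [set w | t < H k w]); last first.
  by apply/seteqP; split => w; rewrite /= in_itv/= andbT.
move=> ->; rewrite -EFinM !big_ord_recr/= /s' ltnn yk mulr0 oppr0 expR0 mulr1.
congr EFin; rewrite [RHS]mulrC -!mulrA; congr (_ * (_ * (_ * _))).
by apply: eq_bigr => i _; rewrite ltn_ord.
Qed.

Lemma jump_indep k D y z : past k.+1 k.+1 D -> S y -> S z ->
  P (D `&` [set w | Y k w = y] `&` [set w | Y k.+1 w = z]) =
  ((p y z)%:E * P (D `&` [set w | Y k w = y]))%E.
Proof.
move=> + Sy Sz; have [_ _ p0 _] := consS.
apply: past_indep; [exact: measurable_jump_chain|exact: measurable_jump_chain|exact: p0|].
move=> yy C s Syy rC.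
have [yk|/eqP yk] := eqVneq (yy k) y; last first.
  rewrite (_ : _ `&` [set w | Y k w = y] = set0) ?set0I ?measure0 ?mule0//.
  by apply/seteqP; split => // w [[yw _] /= Yk]; apply: yk; rewrite -Yk yw.
pose C' i := if (i < k.+1)%N then C i else setT.
pose s' i := if (i < k.+1)%N then s i else 0.
have rC' i : ray (C' i) (s' i) by rewrite /C' /s'; case: ifPn => // _; exact: ray_setT.
have Syy' i : (i <= k)%N -> S (yy i) by exact: Syy.
have Syz i : (i <= k.+1)%N -> S (path_upd yy k.+1 z i).
  by rewrite /path_upd; case: ifPn => // ik _; exact: Syy.
have E1 : at_path k.+2 (path_upd yy k.+1 z) `&`
      [set w | forall i, (i <= k.+1)%N -> C' i (H i w)] =
    at_path k.+1 yy `&` [set w | forall i, (i < k.+1)%N -> C i (H i w)] `&`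
    [set w | Y k w = y] `&` [set w | Y k.+1 w = z].
  rewrite -at_pathS; apply/seteqP; split => [w [[yw zw] Cw]|w [[[yw Cw] Yk] Yz]].
    do !split => //; last by rewrite /= yw.
    by move=> i ik; have := Cw i (ltnW ik); rewrite /C' ik.
  by split => // i; rewrite /C'; case: ifPn => // ik _; exact: Cw.
have E2 : at_path k.+1 yy `&` [set w | forall i, (i < k.+1)%N -> C i (H i w)] `&`
    [set w | Y k w = y] =
    at_path k.+1 yy `&` [set w | forall i, (i <= k)%N -> C i (H i w)].
  by apply/seteqP; split => [w [[yw Cw] Yk]|w [yw Cw]]; do !split => //=; rewrite yw.
have := fdd_ray Syz rC'; rewrite E1 => ->; rewrite E2 (fdd_ray Syy' rC) -EFinM.
have upd i : (i < k.+1)%N -> path_upd yy k.+1 z i = yy i by rewrite /path_upd => ->.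
rewrite (_ : \prod_(i < k.+1) p _ _ = (\prod_(i < k) p (yy i) (yy i.+1)) * p y z).
  rewrite (_ : \prod_(i < k.+2) _ = \prod_(i < k.+1) expR (- (q (yy i) * s i))).
    by rewrite upd//; congr EFin; ring.
  rewrite big_ord_recr/= /s' ltnn mulr0 oppr0 expR0 mulr1.
  by apply: eq_bigr => i _; rewrite ltn_ord upd.
rewrite big_ord_recr/= upd// yk /path_upd ltnn; congr (_ * _).
by apply: eq_bigr => i _; rewrite ltnS ltnW// ltnS ltn_ord.
Qed.

Lemma past_jump_time k l j (A : set R) : (j <= l)%N -> measurable A ->
  past k l [set w | A (jump_time j w)].
Proof.
move=> jl mA; rewrite -[X in past _ _ X]setTI.
apply: (_ : measurable_fun (setT : set (g_sigma_algebraType (past_gen k l)))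
  (jump_time j)) => //.
apply: measurable_sum => i.
apply: (measurability _ (RGenOInfty.measurableE R)) => //.
move=> _ [_ [t ->] <-]; rewrite setTI.
apply: sub_sigma_algebra.
exists (fun=> setT), (fun n : nat => if n == i then `]t, +oo[%classic else setT); split.
  by move=> n; case: eqP => _; [exists (Num.max t 0); exact: ray_itv|exists 0; exact: ray_setT].
apply/seteqP; split => [w tw|w [_ /(_ i (leq_trans (ltn_ord i) jl))]]; last by rewrite eqxx.
by split => // n _; case: eqP => // ->.
Qed.

End ChainLaw.

(** * Occupation of states at a fixed time *)

Section JumpTimes.
Variables (R : realType) (T : choiceType) (S : set T) (rate : T -> T -> R).
Variable X : ctmc S rate.
Local Notation q := (exit_rate S rate).
Local Notation p := (jump_prob S rate).
Local Notation W := (ctmc_space X).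
Local Notation Y := (@jump_chain R T S rate X).
Local Notation H := (@holding_time R T S rate X).
Local Notation J := (@jump_time R T S rate X).

Definition occupied (k : nat) (y : T) (t : R) : set W :=
  [set w | Y k w = y] `&` [set w | J k w <= t < J k.+1 w].

Definition entered (k : nat) (y : T) (s s' : R) : set W :=
  [set w | Y k w = y] `&` [set w | s < J k w <= s'].

(** The stay of index [k] ends at [J k.+1], so an entry of index [k.+1] is a departure of index [k];
    this drives the induction on the number of jumps. *)
Definition departed (k : nat) (y : T) (s s' : R) : set W :=
  [set w | Y k w = y] `&` [set w | s < J k.+1 w <= s'].

Lemma jump_timeS k w : J k.+1 w = J k w + H k w.
Proof. by rewrite /jump_time big_ord_recr. Qed.

Lemma jump_time0 w : J 0 w = 0.
Proof. by rewrite /jump_time big_ord0. Qed.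

Lemma measurable_jump_time k : measurable_fun setT (J k).
Proof. by apply: measurable_sum => i; exact: measurable_holding_time. Qed.

Lemma measurable_jump_time_in k (A : set R) :
  measurable A -> measurable [set w : W | A (J k w)].
Proof. by move=> mA; rewrite -[X in measurable X]setTI; exact: measurable_jump_time. Qed.

Lemma measurable_occupied k y t : measurable (occupied k y t).
Proof.
apply: measurableI; first exact: measurable_jump_chain.
have -> : [set w | J k w <= t < J k.+1 w] =
    [set w | `]-oo, t]%classic (J k w)] `&` [set w | `]t, +oo[%classic (J k.+1 w)].
  apply/seteqP; split => w; rewrite /= !in_itv/= andbT; first by case/andP.
  by case=> -> ->.
by apply: measurableI; apply: measurable_jump_time_in; exact: measurable_itv.
Qed.

Lemma measurable_entered k y s s' : measurable (entered k y s s').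
Proof.
apply: measurableI; first exact: measurable_jump_chain.
have := @measurable_jump_time_in k `]s, s'] (measurable_itv _).
by congr measurable; apply/seteqP; split => w; rewrite /= in_itv.
Qed.

Lemma measurable_departed k y s s' : measurable (departed k y s s').
Proof.
apply: measurableI; first exact: measurable_jump_chain.
have := @measurable_jump_time_in k.+1 `]s, s'] (measurable_itv _).
by congr measurable; apply/seteqP; split => w; rewrite /= in_itv.
Qed.

Hypothesis consS : conservative S rate.
Variables (nu : T -> R) (P : {measure set W -> \bar R}).
Hypotheses (PT : P setT = 1%E) (nu_ge0 : forall x, 0 <= nu x)
  (nu1 : (\esum_(x in S) (nu x)%:E = 1)%E).
Hypothesis fddP : started_from nu P.

Let Pfin := law_fin PT.
Let q_gt0 : forall x, S x -> 0 < q x. Proof. by case: consS. Qed.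

Let measurable_survive k y t s :
  measurable ([set w : W | Y k w = y] `&` [set w | J k w <= t] `&` [set w | s < J k.+1 w]).
Proof.
apply: measurableI; [apply: measurableI|].
- exact: measurable_jump_chain.
- have := @measurable_jump_time_in k `]-oo, t] (measurable_itv _).
  by congr measurable; apply/seteqP; split => w; rewrite /= in_itv.
- have := @measurable_jump_time_in k.+1 `]s, +oo[ (measurable_itv _).
  by congr measurable; apply/seteqP; split => w; rewrite /= in_itv/= andbT.
Qed.

(* Conditioning on the cell of a grid of mesh [e] that contains [J k]. *)
Let survive_grid k y t h e : S y -> 0 <= h -> 0 < e -> exists Z : \bar R,
  ((expR (- (q y * (h + e))))%:E * Z <=
   P ([set w | Y k w = y] `&` [set w | (J k w <= t)%R] `&` [set w | (t + h < J k.+1 w)%R]) <=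
   (expR (- (q y * h)))%:E * Z)%E /\ 
  ((expR (- (q y * e)))%:E * Z <=
   P ([set w | Y k w = y] `&` [set w | (J k w <= t)%R] `&` [set w | (t < J k.+1 w)%R]) <=
    Z)%E.
Proof.
move=> Sy h0 e0; have q0 := ltW (q_gt0 Sy).
pose I i := [set w | t - e *+ i.+1 < J k w <= t - e *+ i].
have mI i : measurable (I i).
  have := @measurable_jump_time_in k `](t - e *+ i.+1), (t - e *+ i)] (measurable_itv _).
  by congr measurable; apply/seteqP; split => w; rewrite /= in_itv.
have tI : trivIset setT (fun i => I i).
  move=> i j _ _ [w [/andP[i1 i2] /andP[j1 j2]]].
  have ij : e *+ i < e *+ j.+1 by lra.
  have ji : e *+ j < e *+ i.+1 by lra.
  move: ij ji; rewrite !ltr_pMn2l//; rewrite !ltnS => ij ji.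
  by apply/eqP; rewrite eqn_leq ij ji.
have cover : [set w | J k w <= t] = \bigcup_i I i.
  apply/seteqP; split => [w /= Jt|w [i _ /andP[_ /= Ji]]]; last first.
    by rewrite /= (le_trans Ji)// gerBl mulrn_wge0// ltW.
  have d0 : 0 <= (t - J k w) / e by rewrite divr_ge0 ?subr_ge0// ltW.
  exists (Num.truncn ((t - J k w) / e)) => //.
  have /andP[n1 n2] := truncn_itv d0.
  move: n1 n2; rewrite ler_pdivlMr// ltr_pdivrMr// !mulr_natl /I /= => n1 n2.
  by apply/andP; split; lra.
(* [Z] does not depend on [h]. On the cell [I i] the elapsed stay [t - J k] lies between [e *+ i]
   and [e *+ i.+1], so survival up to [t + h] is known up to a factor [expR (- (q y * e))];
   comparing [h] with 0 then eliminates [Z]. *)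
pose Z := (\sum_(i <oo) ((expR (- (q y * (e *+ i))))%:E *
  P ([set w | Y k w = y] `&` I i)))%E; exists Z.
have split_cells s : P ([set w | Y k w = y] `&` [set w | J k w <= t] `&` [set w | s < J k.+1 w]) =
   (\sum_(i <oo) P (([set w | Y k w = y] `&` I i) `&` [set w | (s < J k.+1 w)%R]))%E.
  rewrite cover setI_bigcupr setI_bigcupl measure_bigcup//; last first.
  - by apply: trivIset_setIr; apply: trivIset_setIl.
  - move=> i _; apply: measurableI; first by apply: measurableI => //; exact: measurable_jump_chain.
    have := @measurable_jump_time_in k.+1 `]s, +oo[ (measurable_itv _).
    by congr measurable; apply/seteqP; split => w; rewrite /= in_itv/= andbT.
  by apply: eq_eseriesl => i; rewrite in_setT.
have mHJ s i : measurable (([set w | Y k w = y] `&` I i) `&` [set w | (s < J k.+1 w)%R]).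
  apply: measurableI; first by apply: measurableI => //; exact: measurable_jump_chain.
  have := @measurable_jump_time_in k.+1 `]s, +oo[ (measurable_itv _).
  by congr measurable; apply/seteqP; split => w; rewrite /= in_itv/= andbT.
have cell i r : 0 <= r -> P (([set w | Y k w = y] `&` I i) `&` [set w | r < H k w]) =
    ((expR (- (q y * r)))%:E * P ([set w | Y k w = y] `&` I i))%E.
  move=> r0; rewrite (setIC _ (I i)); apply: hold_indep nu_ge0 nu1 fddP _ _ _ _ _ _ _ => //.
  have := @past_jump_time R T S rate X k.+1 k k `](t - e *+ i.+1), (t - e *+ i)] (leqnn _) (measurable_itv _).
  by congr past; apply/seteqP; split => w; rewrite /= in_itv.
suff main h' : 0 <= h' -> ((expR (- (q y * (h' + e))))%:E * Z <=
   P ([set w | Y k w = y] `&` [set w | (J k w <= t)%R] `&` [set w | (t + h' < J k.+1 w)%R]) <=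
   (expR (- (q y * h')))%:E * Z)%E.
  split; first exact: main.
  by have := main 0 (lexx _); rewrite add0r addr0 mulr0 oppr0 expR0 mul1e.
move=> h'0; rewrite split_cells /Z -!nneseriesZl//; apply/andP; split.
  apply: lee_nneseries => i _ //; rewrite muleA -EFinM -expRD.
  rewrite (_ : _ + _ = - (q y * (h' + e *+ i.+1))); last by rewrite mulrS; ring.
  rewrite -cell ?addr_ge0 ?mulrn_wge0 ?(ltW e0)//.
  apply: le_measure; rewrite ?inE; [|exact: mHJ|].
    by apply: measurableI; [apply: measurableI => //; exact: measurable_jump_chain|exact: measurable_hold_gt].
  by move=> w [[Yk Ii] /= Hk]; split=> //; case/andP: Ii => J1 J2; rewrite /= jump_timeS; lra.
apply: lee_nneseries => i _ //; rewrite muleA -EFinM -expRD.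
rewrite (_ : - _ + - _ = - (q y * (h' + e *+ i))); last by ring.
rewrite -cell ?addr_ge0 ?mulrn_wge0 ?(ltW e0)//.
apply: le_measure; rewrite ?inE; [exact: mHJ| |].
  by apply: measurableI; [apply: measurableI => //; exact: measurable_jump_chain|exact: measurable_hold_gt].
by move=> w [[Yk Ii]]; rewrite /= jump_timeS => Hs; split=> //; case/andP: Ii => J1 J2 /=; lra.
Qed.

Definition pr (E : set W) : R := fine (P E).

Lemma prE E : measurable E -> P E = (pr E)%:E.
Proof. by move=> mE; rewrite fineK// Pfin. Qed.

Lemma pr_ge0 E : 0 <= pr E.
Proof. by rewrite fine_ge0. Qed.

Lemma pr_le1 E : measurable E -> pr E <= 1.
Proof. by move=> mE; rewrite -lee_fin -prE// law_le1. Qed.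

Lemma le_pr D E : measurable D -> measurable E ->
  D `&` @pos_hold R T S rate X `<=` E -> pr D <= pr E.
Proof. by move=> mD mE DE; rewrite -lee_fin -!prE//; apply: (le_law_pos consS PT nu_ge0 nu1 fddP). Qed.

Lemma prU D E : measurable D -> measurable E -> D `&` E = set0 ->
  pr (D `|` E) = pr D + pr E.
Proof.
move=> mD mE DE0; apply: EFin_inj; rewrite EFinD -!prE ?measureU//.
exact: measurableU.
Qed.

Lemma le_prU D E F : measurable D -> measurable E -> measurable F ->
  D `&` @pos_hold R T S rate X `<=` E `|` F -> pr D <= pr E + pr F.
Proof.
move=> mD mE mF DEF; apply: (@le_trans _ _ (pr (E `|` F))).
  by apply: le_pr => //; exact: measurableU.
rewrite -lee_fin EFinD -!prE//; last exact: measurableU.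
exact: measureU2.
Qed.

Let le_mesh (a x y : R) : 0 <= x -> 0 < a ->
  (forall e, 0 < e -> (1 - a * e) * x <= y) -> x <= y.
Proof.
move=> x0 a0 H'; apply/ler_addgt0Pr => e e0.
have ax : 0 < a * (x + 1) by rewrite mulr_gt0// ltr_wpDl.
have := H' (e / (a * (x + 1))) (divr_gt0 e0 ax).
rewrite (_ : a * _ = e / (x + 1)); last first.
  by field; rewrite !gt_eqF// ltr_wpDl.
have : e / (x + 1) * x <= e.
  by rewrite mulrAC ler_pdivrMr ?ltr_wpDl// ler_pM2l// lerDl.
lra.
Qed.

(** The memoryless property at a fixed time instead of a jump time. Letting the mesh of
    [survive_grid] tend to 0 takes the place of an integral against the law of [J k]. *)
Let survive k y t h : S y -> 0 <= h ->
  pr ([set w | Y k w = y] `&` [set w | (J k w <= t)%R] `&` [set w | (t + h < J k.+1 w)%R])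
  = expR (- (q y * h)) * pr (occupied k y t).
Proof.
move=> Sy h0; set u := pr _; set u0 := pr _; have q0 := q_gt0 Sy.
have occE : occupied k y t =
    [set w | Y k w = y] `&` [set w | (J k w <= t)%R] `&` [set w | (t < J k.+1 w)%R].
  by apply/seteqP; split => [w [Yk /andP[]]//|w [[Yk Jt] tJ]]; split => //; apply/andP.
have expge e : 1 - q y * e <= expR (- (q y * e)) by rewrite expR_ge1Dx.
have grid e : 0 < e -> exists z, [/\ expR (- (q y * h)) * expR (- (q y * e)) * z <= u,
    u <= expR (- (q y * h)) * z, expR (- (q y * e)) * z <= u0 & u0 <= z].
  move=> e0; have [Z] := @survive_grid k y t h e Sy h0 e0.
  rewrite -occE (prE (measurable_survive _ _ _ _)) (prE (measurable_occupied _ _ _)).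
  rewrite -/u -/u0; case: Z => [z| |].
  - rewrite !lee_fin => -[/andP[z1 z2] /andP[z3 z4]]; exists z; split => //.
    by rewrite -expRD -opprD -mulrDr.
  - by rewrite gt0_muley ?lte_fin ?expR_gt0// => -[] /=.
  - by move=> [_ /andP[_]].
have u_ge0 : 0 <= u by exact: pr_ge0.
have u0_ge0 : 0 <= u0 by exact: pr_ge0.
apply/eqP; rewrite eq_le; apply/andP; split.
  apply: (@le_mesh (q y)) => // e e0; have [z [z1 z2 z3 z4]] := grid e e0.
  apply: (@le_trans _ _ (expR (- (q y * e)) * u)); first by rewrite ler_wpM2r.
  apply: (@le_trans _ _ (expR (- (q y * e)) * (expR (- (q y * h)) * z))).
    by rewrite ler_wpM2l// expR_ge0.
  by rewrite mulrCA ler_wpM2l// expR_ge0.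
apply: (@le_mesh (q y)) => //; first by rewrite mulr_ge0// expR_ge0.
move=> e e0; have [z [z1 z2 z3 z4]] := grid e e0.
apply: le_trans z1; rewrite mulrCA -mulrA ler_wpM2l ?expR_ge0//.
apply: (@le_trans _ _ (expR (- (q y * e)) * u0)); first by rewrite ler_wpM2r.
by rewrite ler_wpM2l// expR_ge0.
Qed.

Lemma prD D E : measurable D -> measurable E -> E `<=` D ->
  pr (D `\` E) = pr D - pr E.
Proof.
move=> mD mE ED; apply/eqP; rewrite eq_sym subr_eq -prU//; last first.
- by apply/seteqP; split => // w [[]].
- exact: measurableD.
by rewrite setUC setDUK.
Qed.

Lemma occupied_step k y t h : S y -> 0 <= h ->
  pr (occupied k y (t + h)) <=
  expR (- (q y * h)) * pr (occupied k y t) + pr (entered k y t (t + h)).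
Proof.
move=> Sy h0; rewrite -survive//; apply: le_prU.
- exact: measurable_occupied.
- exact: measurable_survive.
- exact: measurable_entered.
move=> w [[Yk /andP[Jth thJ]] _]; have [Jt|Jt] := leP (J k w) t.
  by left; split.
by right; split => //; apply/andP.
Qed.

(** A stay ending in the window was in progress at [s] or began inside the window; either way it
    ended within [h], which has conditional probability at most [1 - expR (- (q y * h))], hence at
    most [q y * h]. *)
Lemma departed_bound k y s h : S y -> 0 <= h ->
  pr (departed k y s (s + h)) <=
  q y * h * (pr (occupied k y s) + pr (entered k y s (s + h))).
Proof.
move=> Sy h0; have q0 := q_gt0 Sy.
pose G := [set w | Y k w = y] `&` [set w | (J k w <= s)%R] `&` [set w | (s + h < J k.+1 w)%R].
pose F := entered k y s (s + h) `&` [set w | h < H k w].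
have mG : measurable G by exact: measurable_survive.
have mo := measurable_occupied k y s.
have me := measurable_entered k y s (s + h).
have mF : measurable F by apply: measurableI => //; exact: measurable_hold_gt.
have sub : departed k y s (s + h) `&` @pos_hold R T S rate X `<=`
    (occupied k y s `\` G) `|` (entered k y s (s + h) `\` F).
  move=> w [[Yk /andP[sJ Jsh]] /(_ k) Hk]; move: (sJ) (Jsh); rewrite jump_timeS => sJ' Jsh'.
  have [Js|Js] := leP (J k w) s.
    left; split; first by split => //; apply/andP.
    by move=> [_ /=]; rewrite ltNge Jsh.
  right; split; last by move=> [_ /= hH]; lra.
  by split => //; apply/andP; split => //; lra.
apply: le_trans (le_prU (measurable_departed _ _ _ _) _ _ sub) _.
- exact: measurableD.
- exact: measurableD.
have GO : G `<=` occupied k y s.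
  by move=> w [[Yk /= Js] /= sJ]; split => //; apply/andP; split => //; lra.
rewrite prD// prD//; last by move=> w [].
have -> : pr F = expR (- (q y * h)) * pr (entered k y s (s + h)).
  apply: EFin_inj; rewrite EFinM -(prE mF) -(prE me).
  rewrite /F /entered (setIC [set w | Y k w = y]).
  apply: (hold_indep consS PT nu_ge0 nu1 fddP) => //.
  have := @past_jump_time R T S rate X k.+1 k k `]s, (s + h)] (leqnn _) (measurable_itv _).
  by congr past; apply/seteqP; split => w; rewrite /= in_itv.
rewrite survive//.
have := expR_ge1Dx (- (q y * h)).
have a0 := pr_ge0 (occupied k y s); have b0 := pr_ge0 (entered k y s (s + h)).
set a := pr _ in a0 *; set b := pr _ in b0 *; set c := expR _ => cge.
rewrite (_ : a - c * a + (b - c * b) = (1 - c) * (a + b)); last by ring.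
by rewrite ler_wpM2r ?addr_ge0//; lra.
Qed.

Lemma departed_split k y s s' s'' : s <= s' -> s' <= s'' ->
  pr (departed k y s s'') = pr (departed k y s s') + pr (departed k y s' s'').
Proof.
move=> ss' ss''; rewrite -prU; [|exact: measurable_departed|exact: measurable_departed|].
  congr pr; apply/seteqP; split => [w [Yk /andP[J1 J2]]|w [] [Yk /andP[J1 J2]]].
  - have [Js|Js] := leP (J k.+1 w) s'; [left|right]; split => //; exact/andP.
  - by split => //; apply/andP; split => //; lra.
  - by split => //; apply/andP; split => //; lra.
by apply/seteqP; split => // w [[_ /andP[J1 J2]] [_ /andP[J3 J4]]]; move: J3; rewrite ltNge J2.
Qed.

Lemma entered_split k y s s' s'' : s <= s' -> s' <= s'' ->
  pr (entered k y s s'') = pr (entered k y s s') + pr (entered k y s' s'').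
Proof.
move=> ss' ss''; rewrite -prU; [|exact: measurable_entered|exact: measurable_entered|].
  congr pr; apply/seteqP; split => [w [Yk /andP[J1 J2]]|w [] [Yk /andP[J1 J2]]].
  - have [Js|Js] := leP (J k w) s'; [left|right]; split => //; exact/andP.
  - by split => //; apply/andP; split => //; lra.
  - by split => //; apply/andP; split => //; lra.
by apply/seteqP; split => // w [[_ /andP[J1 J2]] [_ /andP[J3 J4]]]; move: J3; rewrite ltNge J2.
Qed.

Lemma entered_succ k y s s' : S y ->
  P (entered k.+1 y s s') = (\esum_(z in S) ((p z y)%:E * P (departed k z s s')))%E.
Proof.
move=> Sy; rewrite (measure_partition consS P k); last exact: measurable_entered.
apply: eq_esum => z Sz; rewrite /departed (setIC [set w | Y k w = z]).
rewrite -(jump_indep consS PT nu_ge0 nu1 fddP)//.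
  by congr (P _); apply/seteqP; split => w [[? ?] ?].
have := @past_jump_time R T S rate X k.+1 k.+1 k.+1 `]s, s'] (leqnn _) (measurable_itv _).
by congr past; apply/seteqP; split => w; rewrite /= in_itv.
Qed.

Let le_of_eq (a b : R) : a = b -> a <= b. Proof. by move=> ->. Qed.
Let le_harmonic (x a b : R) : 0 <= b ->
  (forall m, x <= a + b / m.+1%:R) -> x <= a.
Proof.
move=> b0 xab; apply/ler_addgt0Pr => e e0.
apply: le_trans (xab (Num.truncn (b / e))) _.
rewrite lerD2l ler_pdivrMr// mulrC -ler_pdivrMr//.
by apply: ltW; have /andP[] := truncn_itv (divr_ge0 b0 (ltW e0)).
Qed.

Hypothesis nu_sub : forall y, S y ->
  (\esum_(z in S) (nu z * q z * p z y)%:E <= (nu y * q y)%:E)%E.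

Let occupation K z t := \sum_(k < K) pr (occupied k z t).

(** On each cell of a grid, [departed_bound] costs the mass present plus the entries inside the
    cell. Entries over all cells add up to at most [K] whatever the mesh, so their contribution is
    of order [1 / m.+1] and vanishes. *)
Let departed_sum K z s s' : S z -> 0 <= s -> s <= s' ->
  (forall t, 0 <= t -> occupation K z t <= nu z) ->
  \sum_(k < K) pr (departed k z s s') <= q z * (s' - s) * nu z.
Proof.
move=> Sz s0 ss' occ; have q0 := ltW (q_gt0 Sz).
have grid h n : 0 <= h -> \sum_(k < K) pr (departed k z s (s + h * n%:R)) <=
    q z * h * (n%:R * nu z + \sum_(k < K) pr (entered k z s (s + h * n%:R))).
  move=> h0; elim: n => [|n IHn].
    rewrite mulr0 addr0 mul0r add0r [leLHS]big1; last first.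
      move=> k _; rewrite (_ : departed k z s s = set0) /pr ?measure0//.
      by apply/seteqP; split => // w [_ /andP[s1 s2]]; lra.
    by rewrite !mulr_ge0// sumr_ge0// => k _; exact: pr_ge0.
  have sn0 : s <= s + h * n%:R by rewrite lerDl mulr_ge0.
  have snS : s + h * n%:R <= s + h * n.+1%:R by rewrite lerD2l ler_wpM2l// ler_nat.
  under eq_bigr do rewrite (departed_split _ _ sn0 snS).
  under [X in _ <= _ * (_ + X)]eq_bigr do rewrite (entered_split _ _ sn0 snS).
  rewrite !big_split/= -[n.+1]addn1 natrD mulrDl mul1r.
  have -> : s + h * (n%:R + 1) = s + h * n%:R + h by ring.
  have step : \sum_(k < K) pr (departed k z (s + h * n%:R) (s + h * n%:R + h)) <=
      q z * h * (nu z + \sum_(k < K) pr (entered k z (s + h * n%:R) (s + h * n%:R + h))).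
    apply: (@le_trans _ _ (\sum_(k < K) q z * h * (pr (occupied k z (s + h * n%:R)) +
        pr (entered k z (s + h * n%:R) (s + h * n%:R + h))))).
      by apply: ler_sum => k _; exact: departed_bound.
    rewrite -mulr_sumr big_split/= ler_wpM2l ?mulr_ge0// lerD2r.
    by apply: occ; rewrite addr_ge0// mulr_ge0.
  by apply: le_trans (lerD IHn step) _; rewrite -mulrDr; apply/le_of_eq; ring.
apply: (@le_harmonic _ _ (q z * (s' - s) * K%:R)).
  by rewrite !mulr_ge0// subr_ge0.
move=> m; have m0 : (0 : R) < m.+1%:R by [].
have := grid ((s' - s) / m.+1%:R) m.+1.
rewrite divfK ?gt_eqF// (_ : s + (s' - s) = s'); last by ring.
move=> /(_ _)/le_trans; apply; first by rewrite divr_ge0// subr_ge0.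
have : \sum_(k < K) pr (entered k z s s') <= K%:R.
  apply: (@le_trans _ _ (\sum_(k < K) 1)); last by rewrite sumr_const card_ord.
  by apply: ler_sum => k _; apply: pr_le1; exact: measurable_entered.
move=> /(ler_wpM2l (_ : 0 <= q z * ((s' - s) / m.+1%:R))) H1.
rewrite mulrDr; apply: le_trans (lerD (lexx _) (H1 _)) _.
  by rewrite mulr_ge0// divr_ge0// subr_ge0.
by apply/le_of_eq; field; rewrite gt_eqF.
Qed.

Let entered_sum K y s s' : S y -> 0 <= s -> s <= s' ->
  (forall z t, S z -> 0 <= t -> occupation K z t <= nu z) ->
  \sum_(k < K.+1) pr (entered k y s s') <= q y * (s' - s) * nu y.
Proof.
move=> Sy s0 ss' occ; have [_ _ p0 _] := consS.
(* The entry of index 0 occurs at time 0, never in []s, s']]; this is how one jump is gained over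
   the hypothesis on [occupation K]. *)
rewrite big_ord_recl (_ : entered _ _ _ _ = set0); last first.
  by apply/seteqP; split => // w [_ /andP[]]; rewrite jump_time0 ltNge s0.
rewrite {1}/pr measure0 add0r -lee_fin -sumEFin.
rewrite (eq_bigr (fun k : 'I_K => \esum_(z in S) ((p z y)%:E * P (departed k z s s')))%E);
  last by move=> k _; rewrite -prE ?entered_succ//; exact: measurable_entered.
rewrite -esum_sum; last by move=> z k Sz _; rewrite mule_ge0// lee_fin p0.
apply: (@le_trans _ _ (\esum_(z in S) ((s' - s)%:E * (nu z * q z * p z y)%:E))%E).
  apply: le_esum => z Sz.
  rewrite -ge0_sume_distrr//.
  under eq_bigr => k _ do rewrite (prE (measurable_departed _ _ _ _)).
  rewrite sumEFin -!EFinM lee_fin.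
  apply: le_trans (ler_wpM2l (p0 z y Sz) (departed_sum Sz s0 ss' (fun t => occ z t Sz))) _.
  by apply/le_of_eq; ring.
rewrite esumZl ?subr_ge0//; last first.
  by move=> z Sz; rewrite lee_fin !mulr_ge0 ?p0// ltW// q_gt0.
apply: le_trans (lee_wpmul2l _ (nu_sub Sy)) _; first by rewrite lee_fin subr_ge0.
by rewrite -EFinM lee_fin; apply/le_of_eq; ring.
Qed.

(** With [a = q y * h], one grid step sends a bound [x] to [expR (- a) * x + a * nu y]. Since
    [expR (- a) * (1 + a) <= 1], it preserves the bound [nu y * (1 + a)], whose excess vanishes with
    the mesh. *)
Lemma occupation_le K y t : S y -> 0 <= t ->
  \sum_(k < K) pr (occupied k y t) <= nu y.
Proof.
elim: K y t => [|K IHK] y t Sy t0; first by rewrite big_ord0.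
have q0 := ltW (q_gt0 Sy).
apply: (@le_harmonic _ _ (nu y * (q y * t))); first by rewrite !mulr_ge0.
move=> m; pose h := t / m.+1%:R; have h0 : 0 <= h by rewrite divr_ge0.
have -> : nu y + nu y * (q y * t) / m.+1%:R = nu y * (1 + q y * h).
  by rewrite /h; field; rewrite gt_eqF.
suff grid n : occupation K.+1 y (h * n%:R) <= nu y * (1 + q y * h).
  by have := grid m.+1; rewrite /h divfK// gt_eqF.
have qh0 : 0 <= q y * h by rewrite mulr_ge0.
elim: n => [|n IHn].
  apply: (@le_trans _ _ (nu y)); last by rewrite ler_peMr// lerDl.
  (* At time 0 only the stay of index 0 is in progress, up to a null event, and its mass is at most
     [nu y]. *)
  rewrite mulr0 /occupation big_ord_recl big1 => [|k _]; last first.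
    apply/eqP; rewrite eq_le pr_ge0 andbT -[leRHS](_ : pr set0 = 0); last by rewrite /pr measure0.
    apply: le_pr => //; first exact: measurable_occupied.
    move=> w [[_ /andP[+ _]] pw]; rewrite [lift _ _]/= jump_timeS => Jk.
    have Jk0 : 0 <= J k w by apply: sumr_ge0 => i _; exact/ltW/pw.
    by have := pw k; lra.
  rewrite addr0 -lee_fin -prE; last exact: measurable_occupied.
  have := fddP (k := 0%N) (y := fun=> y) (t := fun=> 0) (fun _ _ => Sy) (fun _ _ => lexx _).
  rewrite big_ord0 big_ord_recl big_ord0 !mulr1 mulr0 oppr0 expR0 mulr1 => <-.
  apply: (le_law_pos consS PT nu_ge0 nu1 fddP).
  - exact: measurable_occupied.
  - rewrite (_ : [set w | _] = [set w | Y 0 w = y] `&` [set w | 0 < H 0 w]).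
      by apply: measurableI; [exact: measurable_jump_chain|exact: measurable_hold_gt].
    apply/seteqP; split => [w /(_ 0%N (leqnn _))//|w [Yw Hw] i].
    by rewrite leqn0 => /eqP->.
  - by move=> w [[Yw _] pw] i; rewrite leqn0 => /eqP->.
have hn0 : 0 <= h * n%:R by rewrite mulr_ge0.
apply: (@le_trans _ _ (expR (- (q y * h)) * occupation K.+1 y (h * n%:R) +
   \sum_(k < K.+1) pr (entered k y (h * n%:R) (h * n.+1%:R)))).
  rewrite /occupation mulr_sumr -big_split/=; apply: ler_sum => k _.
  have -> : h * n.+1%:R = h * n%:R + h by rewrite -natr1; ring.
  exact: occupied_step.
apply: (@le_trans _ _ (expR (- (q y * h)) * (nu y * (1 + q y * h)) +
   q y * h * nu y)).
  apply: lerD; first by rewrite ler_wpM2l// expR_ge0.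
  apply: le_trans (entered_sum Sy hn0 _ _) _ => //.
    by rewrite ler_wpM2l// ler_nat.
  by apply/le_of_eq; rewrite -natr1; ring.
have := expR_ge1Dx (q y * h); have e0 := expR_gt0 (- (q y * h)).
move=> /(ler_wpM2l (ltW e0)); rewrite -expRD addNr expR0 => H1.
rewrite mulrCA (_ : nu y * (1 + _) = nu y * 1 + q y * h * nu y); last by ring.
by rewrite lerD2r ler_wpM2l.
Qed.

Lemma jump_time_mono w k k' : @pos_hold R T S rate X w -> (k <= k')%N ->
  J k w <= J k' w.
Proof.
move=> pw /subnK <-; elim: (k' - k)%N => [|d IHd]; first by rewrite add0n.
by rewrite addSn jump_timeS (le_trans IHd)// lerDl ltW.
Qed.

Lemma chain_atE t y : @chain_at R T S rate X t y = \bigcup_k occupied k y t.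
Proof.
by apply/seteqP; split => [w [k [Jk Yk]]|w [k _ [Yk Jk]]]; exists k.
Qed.

Lemma measurable_chain_at t y : measurable (@chain_at R T S rate X t y).
Proof. by rewrite chain_atE; apply: bigcupT_measurable => k; exact: measurable_occupied. Qed.

(** On [pos_hold] the stays are disjoint time intervals, which makes the events [chain_at t y]
    disjoint for different [y]. *)
Let alive t := \bigcup_(y in S) (@chain_at R T S rate X t y `&` @pos_hold R T S rate X).

Let alive_mass t : measurable (alive t) /\
  P (alive t) = (\esum_(y in S) P (@chain_at R T S rate X t y))%E.
Proof.
have mp := measurable_pos_hold X; have mc := measurable_chain_at t.
have [|y Sy|y z _ _ [w [[[k [Jk <-]] pw] [[k' [Jk' <-]] _]]]|mA ->] :=
  @measure_bigcup_countable R _ W P _ S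
    (fun y => @chain_at R T S rate X t y `&` @pos_hold R T S rate X).
- by case: consS.
- exact: measurableI.
- suff -> : k = k' by [].
  apply/eqP; rewrite eqn_leq (leqNgt k) (leqNgt k').
  have le_lt a b : J a w <= t < J a.+1 w -> J b w <= t < J b.+1 w -> ~~ (a < b)%N.
    move=> /andP[_ ta] /andP[bt _]; apply/negP => /(jump_time_mono pw) ab.
    by have := lt_le_trans ta (le_trans ab bt); rewrite ltxx.
  by rewrite !le_lt.
split => //; apply: eq_esum => y Sy.
exact: (law_pos consS PT nu_ge0 nu1 fddP).
Qed.

Lemma chain_at_mass_le1 t : (\esum_(y in S) P (@chain_at R T S rate X t y) <= 1)%E.
Proof. by have [mA <-] := alive_mass t; exact: law_le1. Qed.

Hypothesis nu_flow : (\esum_(z in S) (nu z * q z)%:E < +oo)%E.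

Let explosion t := \bigcap_k [set w | 0 < J k.+1 w <= t].

(** On [explosion t] each of the first [K] jumps falls in []0, t]], so [K] times its probability is
    at most the expected number of such jumps, which [departed_sum] bounds uniformly in [K]. *)
Let explosion0 t : 0 <= t -> measurable (explosion t) /\ P (explosion t) = 0%E.
Proof.
move=> t0.
have mJ k : measurable [set w | 0 < J k.+1 w <= t].
  have := @measurable_jump_time_in k.+1 `]0, t] (measurable_itv _).
  by congr measurable; apply/seteqP; split => w; rewrite /= in_itv.
have mE : measurable (explosion t) by exact: bigcapT_measurable.
split => //; have q0 z (Sz : S z) := ltW (q_gt0 Sz).
have flow := nu_flow; set C := (\esum_(z in S) _)%E in flow.
have Cfin : C \is a fin_num.
  rewrite ge0_fin_numE//; apply: esum_ge0 => z Sz.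
  by rewrite lee_fin mulr_ge0// q0.
have bound K : K%:R * pr (explosion t) <= t * fine C.
  rewrite -lee_fin !EFinM -(prE mE) fineK//.
  apply: (@le_trans _ _ (\sum_(k < K) P [set w | (0 < J k.+1 w <= t)%R])%E).
    rewrite (prE mE) -EFinM mulr_natl -{1}[K]card_ord -sumr_const -sumEFin.
    apply: lee_sum => k _; rewrite -prE//.
    by apply: le_measure; rewrite ?inE//; exact: bigcap_inf.
  under eq_bigr => k _ do rewrite (measure_partition consS P k (mJ k)).
  rewrite -esum_sum//; rewrite -esumZl//; last first.
    by move=> z Sz; rewrite lee_fin mulr_ge0// q0.
  apply: le_esum => z Sz.
  under eq_bigr => k _ do rewrite setIC (prE (measurable_departed k z 0 t)).
  rewrite sumEFin -EFinM lee_fin.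
  apply: le_trans (departed_sum Sz (lexx 0) t0 (fun t t0 => occupation_le K Sz t0)) _.
  by apply/le_of_eq; ring.
rewrite prE//; congr EFin; apply/eqP; rewrite eq_le pr_ge0 andbT.
apply: (@le_harmonic _ _ (t * fine C)).
  by rewrite mulr_ge0// fine_ge0// esum_ge0// => z Sz; rewrite lee_fin mulr_ge0// q0.
by move=> m; rewrite add0r ler_pdivlMr// mulrC.
Qed.

(** [occupation_le] passes to the limit in the number of jumps. Up to a null event [alive t] and
    [explosion t] cover the whole space, and the latter is null, so the masses at time [t] add up to
    1 and [eq_of_le_esum] applies. *)
Lemma law_chain_at t y : 0 <= t -> S y -> P (@chain_at R T S rate X t y) = (nu y)%:E.
Proof.
move=> t0; move: y; apply: eq_of_le_esum.
- move=> y Sy; rewrite measure_ge0/= chain_atE.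
  have mo k := measurable_occupied k y t.
  apply: (le_trans (measure_sigma_subadditive _ _ _ (@subset_refl _ _))) => //.
    exact: bigcupT_measurable.
  apply: lime_le; first exact: is_cvg_nneseries.
  apply: nearW => K; rewrite big_mkord.
  under eq_bigr do rewrite prE//.
  by rewrite sumEFin lee_fin occupation_le.
- by rewrite nu1.
have [mA <-] := alive_mass t; have [mE E0] := explosion0 t0.
rewrite nu1 -PT -[leRHS]adde0 -E0.
apply: le_trans (measureU2 _ mA mE).
apply: (le_law_pos consS PT nu_ge0 nu1 fddP) => //; first exact: measurableU.
move=> w [_ pw].
have [[k tk]|/forallNP nk] := pselect (exists k, t < J k.+1 w); last first.
  right => k _; apply/andP; split; last by rewrite leNgt; apply/negP/nk.
  have Jk0 : 0 <= J k w by apply: sumr_ge0 => i _; exact/ltW/pw.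
  by rewrite jump_timeS; have := pw k; lra.
left.
have exk : exists k, t < J k.+1 w by exists k.
case: (ex_minnP exk) => {tk}k tk kmin.
exists (Y k w); first exact: jump_chain_in.
split => //; exists k; split => //; apply/andP; split => //.
case: k tk kmin => [|k] tk kmin; first by rewrite jump_time0.
by rewrite leNgt; apply/negP => /kmin; rewrite ltnn.
Qed.

End JumpTimes.

(** * Recurrence and stationary distributions *)

Section IntegralBound.
Local Open Scope ereal_scope.

(** Meant for [passage_time], an infimum over an uncountable set of times: the integral of a
    positive part is a supremum over simple functions below it, so monotonicity persists for a
    possibly non-measurable [f]. *)
Lemma integral_le_ge0 d (W : measurableType d) (R : realType)
    (mu : {measure set W -> \bar R}) (f g : W -> \bar R) :
  (forall w, 0 <= g w) -> (forall w, f w <= g w) ->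
  \int[mu]_w f w <= \int[mu]_w g w.
Proof.
move=> g0 fg; rewrite integralE -[leRHS]sube0; apply: leeB; last first.
  by apply: integral_ge0 => w _; exact: funeneg_ge0.
rewrite !ge0_integralTE//.
apply: ereal_sup_le => _ [h hf <-]; exists h => // w.
by apply: le_trans (hf w) _; rewrite funeposE ge_max fg g0.
Qed.

Lemma eseries_expRN_lty (R : realType) :
  \sum_(n <oo) (expR (- n%:R : R))%:E < +oo.
Proof.
pose r : R := expR (-1); have r1 : (r < 1)%R by rewrite expR_lt1 ltrN10.
apply: (@le_lt_trans _ _ ((1 - r)^-1)%:E); last exact: ltry.
apply: lime_le; first by apply: is_cvg_nneseries => n _ _; rewrite lee_fin expR_ge0.
apply: nearW => N; rewrite sumEFin lee_fin -[leRHS]div1r ler_pdivlMr ?subr_gt0//.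
rewrite big_mkord (eq_bigr (fun i : 'I_N => r ^+ i)%R); last first.
  by move=> i _; rewrite /r -expRM_natl mulrN1.
have -> : ((\sum_(i < N) r ^+ i) * (1 - r) = 1 - r ^+ N)%R.
  by rewrite -[(1 - r)%R]opprB mulrN mulrC -subrX1 opprB.
by rewrite gerBl exprn_ge0// expR_ge0.
Qed.

End IntegralBound.

(** * Uniqueness of the stationary distribution *)

Section Uniqueness.
Variables (R : realType) (T : choiceType) (S : set T) (rate : T -> T -> R).
Variable X : ctmc S rate.
Hypothesis irrX : irreducible X.
Hypothesis massX : forall t x, 0 <= t -> S x ->
  (\esum_(y in S) transition X t x y <= 1)%E.

(** The minimum [k] satisfies [k P_t <= k], so the excess [d] of [pi1] over it satisfies
    [d <= d P_t]. As [P_t] creates no mass, [d] is invariant, and irreducibility makes it positive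
    everywhere or nowhere on [S]. Either way one distribution dominates the other, and equal masses
    force equality. *)
Lemma stationary_unique pi1 pi2 : stationary X pi1 -> stationary X pi2 -> pi1 = pi2.
Proof.
move=> [[p10 p1S p11] st1] [[p20 p2S p21] st2].
pose k x := Num.min (pi1 x) (pi2 x); pose d x := pi1 x - k x.
have k0 x : 0 <= k x by rewrite le_min p10 p20.
have d0 x : 0 <= d x by rewrite subr_ge0 ge_min lexx.
have tr0 t x y : (0 <= transition X t x y)%E by exact: measure_ge0.
have le_k t y : 0 <= t -> S y ->
    (\esum_(x in S) ((k x)%:E * transition X t x y) <= (k y)%:E)%E.
  move=> t0 Sy; rewrite EFin_min le_min -(st1 t y t0 Sy) -(st2 t y t0 Sy).
  by apply/andP; split; apply: le_esum => x Sx; rewrite lee_wpmul2r// lee_fin ge_min lexx ?orbT.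
have d_step t y : 0 <= t -> S y ->
    (\esum_(x in S) ((d x)%:E * transition X t x y) +
     \esum_(x in S) ((k x)%:E * transition X t x y) = (pi1 y)%:E)%E.
  move=> t0 Sy; rewrite -(st1 t y t0 Sy) -esumD; last 2 first.
  - by move=> x _; rewrite mule_ge0// lee_fin.
  - by move=> x _; rewrite mule_ge0// lee_fin.
  apply: eq_esum => x _; rewrite -ge0_muleDl ?lee_fin// -EFinD.
  by rewrite /d subrK.
have d_le1 : (\esum_(x in S) (d x)%:E <= 1)%E.
  by rewrite -p11; apply: le_esum => x _; rewrite lee_fin gerBl.
have d_inv t y : 0 <= t -> S y ->
    (d y)%:E = (\esum_(x in S) ((d x)%:E * transition X t x y))%E.
  move=> t0; move: y; apply: eq_of_le_esum.
  - move=> y Sy; rewrite lee_fin d0/=.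
    have := d_step t y t0 Sy; have := le_k t y t0 Sy.
    set a := (\esum_(x in S) _)%E; set b := (\esum_(x in S) _)%E.
    rewrite [in X in _ -> X]addeC; case: b => [b| |]//.
      by case: a => [a| |]//; rewrite !lee_fin /d => ak [] ab; lra.
      by move=> _ _; rewrite leey.
    by case: a => [a| |].
  - rewrite ge0_fin_numE; last first.
      by apply: esum_ge0 => y _; apply: esum_ge0 => x _; rewrite mule_ge0// lee_fin.
    apply: (@le_lt_trans _ _ 1%E); last exact: ltry.
    rewrite -p11; apply: le_esum => y Sy.
    rewrite -(d_step t y t0 Sy) leeDl// esum_ge0// => x _.
    by rewrite mule_ge0// lee_fin.
  rewrite esum_interchange; last by move=> x y _ _; rewrite mule_ge0// lee_fin.
  apply: le_esum => x Sx; rewrite esumZl// -[leRHS]mule1.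
  by rewrite lee_wpmul2l ?lee_fin//; exact: massX.
have d_pos x y : S x -> S y -> 0 < d x -> 0 < d y.
  move=> Sx Sy dx; have [t [t0 txy]] := irrX Sx Sy.
  rewrite -lte_fin (d_inv t y t0 Sy) (esumD1 Sx); last first.
    by move=> z _; rewrite mule_ge0// lee_fin.
  apply: (@lt_le_trans _ _ ((d x)%:E * transition X t x y)%E).
    by rewrite mule_gt0// lte_fin.
  by rewrite leeDl// esum_ge0// => z _; rewrite mule_ge0// lee_fin.
have eq_on (pi pi' : T -> R) : (\esum_(x in S) (pi x)%:E = 1)%E ->
    (\esum_(x in S) (pi' x)%:E = 1)%E -> (forall x, 0 <= pi x) ->
    (forall x, S x -> pi x <= pi' x) -> forall x, S x -> pi x = pi' x.
  move=> s1 s2 pi0 le_pi x Sx; apply: EFin_inj.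
  apply: (@eq_of_le_esum R T S (fun x => (pi x)%:E) (fun x => (pi' x)%:E)) => //.
  - by move=> z Sz; rewrite !lee_fin pi0 le_pi.
  - by rewrite s2.
  - by rewrite s1 s2.
suff eqS x : S x -> pi1 x = pi2 x.
  apply/funext => x; have [/eqS//|nSx] := pselect (S x).
  by rewrite p1S// p2S.
move: x; have [[z [Sz dz]]|/forallNP nd] := pselect (exists z, S z /\ 0 < d z).
  move=> x Sx; symmetry; move: x Sx; apply: eq_on => // x Sx.
  have := d_pos z x Sz Sx dz; rewrite /d /k subr_gt0 gt_min ltxx /=.
  exact: ltW.
apply: eq_on => // x Sx; rewrite leNgt; apply/negP => lt12.
by apply: (nd x); split => //; rewrite subr_gt0 gt_min lt12 orbT.
Qed.

End Uniqueness.
Lemma law_mixture (R : realType) (T : choiceType) (S : set T)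
    (rate : T -> T -> R) (X : ctmc S rate) (nu : T -> R) :
  conservative S rate -> (forall x, 0 <= nu x) ->
  exists P : {measure set (ctmc_space X) -> \bar R},
    forall A, P A = (\esum_(x in S) ((nu x)%:E * law X x A))%E.
Proof.
move=> [+ _ _ _] nu0; have [[x0 Sx0]|nS] := pselect (S !=set0); last first.
  by move=> _; exists mzero => A; rewrite esum1// => x Sx; case: nS; exists x.
move=> /countable_injP[f finj].
(* [e] inverts the enumeration on its range; elsewhere it returns [x0], with weight 0 by [wt]. *)
pose e n := xget x0 (S `&` [set x | f x = n]).
have ef x : S x -> e (f x) = x.
  move=> Sx; rewrite /e; case: xgetP => [y _ [Sy fyx]|/(_ x)[]//].
  by apply: finj; rewrite ?inE.
pose wt n := if n \in f @` S then nu (e n) else 0.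
have wt0 n : 0 <= wt n by rewrite /wt; case: ifP.
exists (mseries (fun n => mscale (NngNum (wt0 n)) (law X (e n))) 0) => A.
transitivity (\sum_(n <oo) ((wt n)%:E * law X (e n) A))%E; first by [].
rewrite nneseries_esumT; last first.
  by move=> n; rewrite mule_ge0// lee_fin.
transitivity (\esum_(n in f @` S) ((nu (e n))%:E * law X (e n) A))%E.
  rewrite esum_mkcond [RHS]esum_mkcond; apply: eq_esum => n _.
  by rewrite in_setT /wt; case: ifP => // _; rewrite mul0e.
rewrite esum_image; last by move=> y z yS zS; exact: finj.
by apply: eq_esum => x Sx; rewrite ef.
Qed.

(** * Irreducibility from jump paths *)

Section LawFacts.
Variables (R : realType) (T : choiceType) (S : set T) (rate : T -> T -> R).
Hypothesis consS : conservative S rate.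
Variable X : ctmc S rate.
Local Notation q := (exit_rate S rate).
Local Notation p := (jump_prob S rate).
Local Notation W := (ctmc_space X).
Local Notation Y := (@jump_chain R T S rate X).
Local Notation H := (@holding_time R T S rate X).
Local Notation J := (@jump_time R T S rate X).

Definition point_mass (x y : T) : R := (x == y)%:R.

Lemma point_mass_ge0 x y : 0 <= point_mass x y.
Proof. by rewrite ler0n. Qed.

Lemma point_mass1 x : S x -> (\esum_(y in S) (point_mass x y)%:E = 1)%E.
Proof.
move=> Sx; rewrite (esumD1 Sx); last by move=> y _; rewrite lee_fin point_mass_ge0.
rewrite /point_mass eqxx esum1 ?adde0// => y [_ /= yx].
by rewrite eq_sym; case: eqP.
Qed.

Lemma law_started x : S x -> started_from (X := X) (point_mass x) (law X x).
Proof. by move=> Sx k y t; exact: chain_fdd. Qed.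

Definition jump_path (x y : T) : Prop := exists k (s : nat -> T),
  [/\ s 0%N = x, s k = y, forall i, (i <= k)%N -> S (s i) &
      forall i, (i < k)%N -> 0 < p (s i) (s i.+1)].

(** A path from [x] to [y] has positive probability, and on it the chain stays in [y] during a
    nonempty open interval of times, which contains a rational. If [y] had probability 0 at every
    time, the path would be covered by countably many null events. *)
Lemma jump_path_irreducible :
  (forall x y, S x -> S y -> jump_path x y) -> irreducible X.
Proof.
move=> path_xy x y Sx Sy; have [k [s [s0 sk Ss ps]]] := path_xy x y Sx Sy.
apply: contrapT => /forallNP no_t.
pose E := [set w : W | forall i, (i <= k)%N -> Y i w = s i /\ 0 < H i w].
have PE : (0 < law X x E)%E.
  rewrite (law_started Sx)// lte_fin /point_mass s0 eqxx mul1r.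
  by rewrite mulr_gt0// prodr_gt0// => i _; [exact: ps|rewrite expR_gt0].
pose F n := if (choice.unpickle n : option rat) is Some r
  then (if 0 <= r then @chain_at R T S rate X (ratr r) y else set0) else set0.
have mF n : measurable (F n).
  rewrite /F; case: choice.unpickle => [r|]//; case: ifP => _ //.
  exact: measurable_chain_at.
have mE : measurable E.
  have -> : E = \bigcap_(i in `I_k.+1) ([set w | Y i w = s i] `&` [set w | 0 < H i w]).
    by apply/seteqP; split.
  apply: bigcap_measurableType => i _; apply: measurableI.
    exact: measurable_jump_chain.
  exact: measurable_hold_gt.
have : (law X x E <= \sum_(n <oo) law X x (F n))%E.
  apply: measure_sigma_subadditive => // w Ew.
  have Jk0 : 0 <= J k w.
    by apply: sumr_ge0 => i _; have [] := Ew i (ltnW (ltn_ord i)) => _ /ltW.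
  have Jlt : J k w < J k.+1 w by rewrite jump_timeS ltrDl; have [] := Ew k (leqnn _).
  have [r] := rat_in_itvoo Jlt; rewrite in_itv/= => /andP[Jr rJ].
  exists (choice.pickle r); first exact: Logic.I.
  rewrite /F choice.pickleK.
  have -> : 0 <= r by rewrite -(ler0q R); apply/ltW/(le_lt_trans Jk0).
  by exists k; rewrite (ltW Jr) rJ; split => //; rewrite -sk; have [] := Ew k (leqnn _).
rewrite eseries0 ?leNgt ?PE// => n _ _; rewrite /F.
case: choice.unpickle => [r|]; rewrite ?measure0//; case: ifPn => r0; rewrite ?measure0//.
have := no_t (ratr r) => /not_andP[|/negP]; first by rewrite ler0q r0.
by rewrite -leNgt measure_le0 => /eqP.
Qed.

Lemma transition_mass_le1 t x : S x -> (\esum_(y in S) transition X t x y <= 1)%E.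
Proof.
move=> Sx; apply: (chain_at_mass_le1 consS _ (point_mass_ge0 x) (point_mass1 Sx)).
- exact: probability_setT.
- exact: law_started.
Qed.

(** * Excursions from a state: mean return time and invariant measure *)

Section Excursions.
Variable x : T.
Hypothesis Sx : S x.

Let P := law X x.
Let PT : P setT = 1%E. Proof. exact: probability_setT. Qed.
Let nu0 := point_mass_ge0 x.
Let nu1 := point_mass1 Sx.
Let fddx := law_started Sx.
Let p0 : forall x y, S x -> 0 <= p x y. Proof. by case: consS. Qed.
Let p1 : forall x, S x -> (\esum_(y in S) (p x y)%:E = 1)%E. Proof. by case: consS. Qed.

Definition avoid (k : nat) : set W :=
  [set w | forall i, (0 < i <= k)%N -> Y i w <> x].

Lemma past_avoid k l : past (X := X) k.+1 l (avoid k).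
Proof.
apply: sub_sigma_algebra.
exists (fun i => if (0 < i)%N then ~` [set x] else setT), (fun=> setT); split.
  by move=> _; exists 0; exact: ray_setT.
apply/seteqP; split => [w aw|w [aw _] i /andP[i0 ik]].
  by split => // i ik; case: ifPn => // i0; apply: aw; rewrite i0.
by have := aw i ik; rewrite i0.
Qed.

Lemma measurable_avoid k : measurable (avoid k).
Proof. by have := past_measurable consS (@past_avoid k 0). Qed.

(** Taboo probabilities: the law of the jump chain before its first return to [x]. *)
Definition avoid_at (k : nat) (y : T) : \bar R :=
  P (avoid k `&` [set w | Y k w = y]).

Lemma avoid_at_ge0 k y : (0 <= avoid_at k y)%E.
Proof. exact: measure_ge0. Qed.

Lemma law_jump0 y : S y -> P [set w | Y 0 w = y] = (point_mass x y)%:E.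
Proof.
move=> Sy.
have := fddx (k := 0%N) (y := fun=> y) (t := fun=> 0) (fun _ _ => Sy) (fun _ _ => lexx _).
rewrite big_ord0 big_ord_recl big_ord0 !mulr1 mulr0 oppr0 expR0 mulr1 => <-.
apply: (eq_law_pos consS PT nu0 nu1 fddx).
- exact: measurable_jump_chain.
- rewrite (_ : [set w | _] = [set w | Y 0 w = y] `&` [set w | 0 < H 0 w]).
    by apply: measurableI; [exact: measurable_jump_chain|exact: measurable_hold_gt].
  apply/seteqP; split => [w /(_ 0%N (leqnn _))//|w [Yw Hw] i].
  by rewrite leqn0 => /eqP->.
- move=> w pw; split => [Yw i|/(_ 0%N (leqnn _))[]//].
  by rewrite leqn0 => /eqP->.
Qed.

Lemma avoid_at0 y : S y -> avoid_at 0 y = (point_mass x y)%:E.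
Proof.
move=> Sy; rewrite -law_jump0// /avoid_at; congr (P _).
by apply/seteqP; split => [w []//|w Yw]; split => // i; rewrite leqn0; case: i.
Qed.

Lemma avoid_at_start k : (0 < k)%N -> avoid_at k x = 0%E.
Proof.
move=> k0; rewrite /avoid_at (_ : _ `&` _ = set0) ?measure0//.
by apply/seteqP; split => // w [aw /= Yk]; apply: (aw k); rewrite ?k0 ?leqnn.
Qed.

Lemma avoid_mass k : P (avoid k) = (\esum_(y in S) avoid_at k y)%E.
Proof. exact: (measure_partition consS _ _ (measurable_avoid k)). Qed.

Lemma avoid_jump k z : S z ->
  P (avoid k `&` [set w | Y k.+1 w = z]) =
  (\esum_(y in S) (avoid_at k y * (p y z)%:E))%E.
Proof.
move=> Sz; rewrite (measure_partition consS P k); last first.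
  by apply: measurableI; [exact: measurable_avoid|exact: measurable_jump_chain].
apply: eq_esum => y Sy; rewrite setIAC muleC.
by apply: (jump_indep consS PT nu0 nu1 fddx) => //; exact: past_avoid.
Qed.

Lemma avoid_atS k z : S z -> z <> x ->
  avoid_at k.+1 z = (\esum_(y in S) (avoid_at k y * (p y z)%:E))%E.
Proof.
move=> Sz zx; rewrite -avoid_jump//; congr (P _).
apply/seteqP; split => [w [aw Yw]|w [aw Yw]]; split => // i /andP[i0 ik].
  by apply: aw; rewrite i0 leqW.
by move: ik; rewrite leq_eqVlt => /predU1P[->|ik]; [rewrite Yw|apply: aw; rewrite i0].
Qed.

Lemma avoid_return_le1 : (\sum_(k <oo) P (avoid k `&` [set w | Y k.+1 w = x]) <= 1)%E.
Proof.
have mF k : measurable (avoid k `&` [set w | Y k.+1 w = x]).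
  by apply: measurableI; [exact: measurable_avoid|exact: measurable_jump_chain].
rewrite (_ : \sum_(k <oo) _ = P (\bigcup_k (avoid k `&` [set w | Y k.+1 w = x])))%E.
  by apply: law_le1 => //; exact: bigcupT_measurable.
rewrite measure_bigcup//; first by apply: eq_eseriesl => k; rewrite in_setT.
move=> i j _ _ [w [[ai Yi] [aj Yj]]].
have le a b : avoid a w -> Y b.+1 w = x -> (a <= b)%N.
  by move=> aa Yb; rewrite leqNgt; apply/negP => ba; apply: (aa b.+1).
by apply/eqP; rewrite eqn_leq (le i j)// (le j i).
Qed.

(** Foster's condition for the jump chain with [x] as exceptional state; at [x] the mean of [V]
    after a jump is only required to be finite. *)
Definition lyapunov (V : T -> R) (eps : R) : Prop :=
  [/\ forall y, S y -> 0 <= V y, 0 < eps,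
      forall y, S y -> (\esum_(z in S) (p y z * V z)%:E < +oo)%E &
      forall y, S y -> y <> x ->
        (\esum_(z in S) (p y z * V z)%:E + eps%:E <= (V y)%:E)%E].

Variables (V : T -> R) (eps : R).
Hypothesis lyapV : lyapunov V eps.

Let VW k := (\esum_(y in S) (avoid_at k y * (V y)%:E))%E.

Let V0 : forall y, S y -> (0 <= (V y)%:E)%E.
Proof. by case: lyapV => + _ _ _ y Sy; rewrite lee_fin; exact. Qed.

Let VW_ge0 k : (0 <= VW k)%E.
Proof. by apply: esum_ge0 => y Sy; rewrite mule_ge0// ?V0// avoid_at_ge0. Qed.

Let VW_le k : (VW k.+1 <=
  \esum_(y in S) (avoid_at k y * \esum_(z in S) (p y z * V z)%:E))%E.
Proof.
have pV0 y z : S y -> S z -> (0 <= (p y z * V z)%:E)%E.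
  by move=> Sy Sz; rewrite lee_fin mulr_ge0 ?p0// -lee_fin V0.
have avfin y : S y -> avoid_at k y \is a fin_num.
  move=> Sy; apply: law_fin => //; apply: measurableI; first exact: measurable_avoid.
  exact: measurable_jump_chain.
rewrite (eq_esum (b := fun y => \esum_(z in S) (avoid_at k y * (p y z * V z)%:E)))%E; last first.
  move=> y Sy; rewrite -(fineK (avfin y Sy)) esumZl//; last by move=> z Sz; exact: pV0.
  by rewrite fine_ge0// avoid_at_ge0.
rewrite esum_interchange; last first.
  by move=> y z Sy Sz; rewrite mule_ge0// ?pV0// avoid_at_ge0.
apply: le_esum => z Sz.
have [->|/eqP zx] := eqVneq z x.
  rewrite avoid_at_start// mul0e; apply: esum_ge0 => y Sy.
  by rewrite mule_ge0// ?pV0// avoid_at_ge0.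
rewrite avoid_atS// muleC -esumZl; last 2 first.
- by rewrite -lee_fin V0.
- by move=> y Sy; rewrite mule_ge0 ?avoid_at_ge0// lee_fin p0.
by apply: le_esum => y Sy; rewrite muleCA -EFinM (mulrC (V z)).
Qed.

Let VW1 : (VW 1 < +oo)%E.
Proof.
case: lyapV => _ _ pVfin _.
apply: le_lt_trans (VW_le 0) (le_lt_trans _ (pVfin x Sx)).
rewrite (esumD1 Sx); last first.
  move=> y Sy; rewrite mule_ge0 ?avoid_at_ge0// esum_ge0// => z Sz.
  by rewrite lee_fin mulr_ge0 ?p0// -lee_fin V0.
rewrite avoid_at0// /point_mass eqxx mul1e [X in (_ + X)%E]esum1 ?adde0// => y [Sy /= yx].
by rewrite avoid_at0// /point_mass eq_sym; case: eqP => // _; rewrite mul0e.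
Qed.

Let VW_step k : (0 < k)%N -> (VW k.+1 + eps%:E * P (avoid k) <= VW k)%E.
Proof.
move=> k0; case: lyapV => _ eps0 _ drift.
have pV0 y : S y -> (0 <= \esum_(z in S) (p y z * V z)%:E)%E.
  by move=> Sy; apply: esum_ge0 => z Sz; rewrite lee_fin mulr_ge0 ?p0// -lee_fin V0.
rewrite avoid_mass -(esumZl (ltW eps0)); last by move=> y _; exact: avoid_at_ge0.
apply: le_trans (leeD (VW_le k) (lexx _)) _.
rewrite -esumD; last 2 first.
- by move=> y Sy; rewrite mule_ge0 ?avoid_at_ge0// pV0.
- by move=> y Sy; rewrite mule_ge0 ?avoid_at_ge0// lee_fin (ltW eps0).
apply: le_esum => y Sy; rewrite (muleC eps%:E) -ge0_muleDr ?pV0 ?lee_fin ?(ltW eps0)//.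
have [->|/eqP yx] := eqVneq y x; first by rewrite avoid_at_start// !mul0e.
by rewrite lee_wpmul2l ?avoid_at_ge0// drift.
Qed.

(** [VW k], the mean of [V] on excursions still running at step [k], loses at least
    [eps * P (avoid k)] at each step [k > 0], so the losses sum to at most [VW 1]. The telescoping
    starts at 1 because the drift condition exempts the starting state. *)
Lemma avoid_summable : (\sum_(k <oo) P (avoid k) < +oo)%E.
Proof.
case: (lyapV) => _ eps0 _ _.
rewrite nneseries_recl//; apply: lte_add_pinfty.
  by rewrite -ge0_fin_numE// law_fin//; exact: measurable_avoid.
have telescope K : (VW K.+1 + eps%:E * \sum_(k < K) P (avoid k.+1) <= VW 1)%E.
  elim: K => [|K IHK]; first by rewrite big_ord0 mule0 adde0.
  apply: le_trans IHK; rewrite big_ord_recr/= ge0_muleDr ?sume_ge0//.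
  by rewrite addeCA addeC leeD2r// VW_step.
apply: (@le_lt_trans _ _ (eps^-1%:E * VW 1)%E); last first.
  by rewrite lte_mul_pinfty// lee_fin invr_ge0 ltW.
rewrite -nneseries_addn//; under eq_eseriesr do rewrite addn1.
apply: lime_le; first exact: is_cvg_nneseries.
apply: nearW => K; rewrite big_mkord lee_pdivlMl//.
by apply: le_trans (telescope K); rewrite leeDr.
Qed.

Variable qm : R.
Hypotheses (qm_gt0 : 0 < qm) (qm_le : forall y, S y -> qm <= q y).

(** An upper bound on all mean holding times, taken as unit of length: in every state a stay exceeds
    [n] units with probability at most [expR (- n%:R)]. *)
Let c := qm^-1.

Let late k n : set W := avoid k `&` [set w | c *+ n < H k w].

Let measurable_late k n : measurable (late k n).
Proof. by apply: measurableI; [exact: measurable_avoid|exact: measurable_hold_gt]. Qed.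

Let late_le k n : (P (late k n) <= (expR (- n%:R))%:E * P (avoid k))%E.
Proof.
have c0 : 0 < c by rewrite invr_gt0.
rewrite (measure_partition consS P k (measurable_late k n)) avoid_mass.
rewrite -(esumZl (expR_ge0 (- n%:R))); last by move=> y _; exact: avoid_at_ge0.
apply: le_esum => y Sy; rewrite /late setIAC.
have := hold_indep consS PT nu0 nu1 fddx (@past_avoid k k) Sy (mulrn_wge0 n (ltW c0)).
move=> ->; rewrite lee_wpmul2r ?avoid_at_ge0// lee_fin ler_expR lerN2.
by rewrite mulrnAr ler_wMn2r// ler_pdivlMr// mul1r qm_le.
Qed.

Let nonpos k : set W := [set w | H k w <= 0].

Let measurable_nonpos k : measurable (nonpos k).
Proof.
have := @measurable_hold_in R T S rate X k `]-oo, 0] (measurable_itv _).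
by congr measurable; apply/seteqP; split => w; rewrite /= in_itv.
Qed.

(** Summed over [n], the first term dominates the [k]-th holding time while the excursion runs. The
    second has mean 0 and makes the series infinite off [pos_hold], so that [passage_time_le] holds
    for every [w] and not just almost surely. *)
Let bound k n (w : W) : \bar R := (c * \1_(late k n) w)%:E + (\1_(nonpos k) w)%:E.

Let bound_ge0 k n w : (0 <= bound k n w)%E.
Proof. by rewrite adde_ge0// lee_fin// mulr_ge0// invr_ge0 ltW. Qed.

Let hold_le_bound k w : pos_hold w -> avoid k w ->
  ((H k w)%:E <= \sum_(n <oo) bound k n w)%E.
Proof.
move=> pw ak; have c0 : 0 < c by rewrite invr_gt0.
have exN : exists N, H k w <= c *+ N.
  exists (Num.truncn (H k w / c)).+1.
  have /andP[_] := truncn_itv (divr_ge0 (ltW (pw k)) (ltW c0)).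
  by rewrite ltr_pdivrMr// mulr_natl => /ltW.
case: (ex_minnP exN) => N HN minN.
apply: (@le_trans _ _ (\sum_(0 <= n < N) bound k n w)%E); last first.
  by apply: nneseries_lim_ge => n _ _; exact: bound_ge0.
apply: (@le_trans _ _ (\sum_(0 <= n < N) c%:E)%E).
  by rewrite sumEFin lee_fin sumr_const_nat subn0.
rewrite !big_mkord; apply: lee_sum => n _.
rewrite /bound indicE mem_set ?mulr1 ?leeDl ?lee_fin//.
by split => //=; rewrite ltNge; apply/negP => /minN; rewrite leqNgt ltn_ord.
Qed.

Lemma passage_time_le w :
  (@passage_time R T S rate X x w <= \sum_(k <oo) \sum_(n <oo) bound k n w)%E.
Proof.
have c0 : 0 < c by rewrite invr_gt0.
have b0 k : (0 <= \sum_(n <oo) bound k n w)%E by apply: nneseries_ge0 => n _ _; exact: bound_ge0.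
have unbounded (e : R) : 0 < e -> (forall M : nat, ((e *+ M)%:E <= \sum_(k <oo) \sum_(n <oo) bound k n w)%E) ->
    (\sum_(k <oo) \sum_(n <oo) bound k n w = +oo)%E.
  move=> e0 HM; apply/eqP; rewrite -leye_eq leNgt; apply/negP.
  set s := limn _ in HM *; case: s HM => [s| |]// HM _; last by have := HM 0%N.
  have s0 : 0 <= s by have := HM 0%N; rewrite mulr0n lee_fin.
  have := HM (Num.truncn (s / e)).+1; rewrite lee_fin leNgt => /negP; apply.
  have /andP[_] := truncn_itv (divr_ge0 s0 (ltW e0)).
  by rewrite ltr_pdivrMr// mulr_natl.
have [pw|/existsNP[j /negP]] := pselect (pos_hold w); last first.
  rewrite -leNgt => Hj; suff -> : (\sum_(k <oo) \sum_(n <oo) bound k n w = +oo)%E by rewrite leey.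
  apply: (@unbounded 1) => // M.
  apply: (@le_trans _ _ (\sum_(n <oo) bound j n w)%E); last first.
    apply: le_trans (nneseries_lim_ge j.+1 _) => //.
    by rewrite big_nat_recr//= leeDr// sume_ge0.
  apply: le_trans (nneseries_lim_ge M _); last by move=> n _ _; exact: bound_ge0.
  rewrite -[M in X in (X <= _)%E]subn0 -sumr_const_nat -sumEFin; apply: lee_sum => n _.
  by rewrite /bound [\1_(nonpos j) w]indicE mem_set// leeDr// lee_fin mulr_ge0// ltW.
have [[k [k0 Yk]]|/forallNP nret] := pselect (exists k, (0 < k)%N /\ Y k w = x); last first.
  have aw k : avoid k w by move=> i /andP[i0 _] Yi; apply: (nret i).
  (* The excursion never ends: each [k] contributes at least [c] through its term [n = 0], as the
     holding time is positive. *)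
  suff -> : (\sum_(k <oo) \sum_(n <oo) bound k n w = +oo)%E by rewrite leey.
  apply: (unbounded c) => // M.
  apply: le_trans (nneseries_lim_ge M _) => //.
  rewrite -[M in X in (X <= _)%E]subn0 -sumr_const_nat -sumEFin; apply: lee_sum => k _.
  apply: le_trans (nneseries_lim_ge 1 _); last by move=> n _ _; exact: bound_ge0.
  rewrite big_nat1 /bound indicE mem_set ?mulr1 ?leeDl ?lee_fin//.
  by split; [exact: aw|exact: pw].
have exk : exists k, (0 < k)%N && (Y k w == x) by exists k; rewrite k0 Yk eqxx.
case: (ex_minnP exk) => {k0 Yk}k /andP[k0 /eqP Yk] mink.
have aw i : (i < k)%N -> avoid i w.
  move=> ik j /andP[j0 ji] Yj; have := mink j; rewrite j0 Yj eqxx => /(_ isT).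
  by rewrite leqNgt (leq_ltn_trans ji ik).
apply: (@le_trans _ _ (J k w)%:E).
  apply: ereal_inf_lbound; exists (J k w) => //; split.
    exact: jump_time_mono.
  by exists k; split => //; rewrite lexx jump_timeS ltrDl pw.
apply: le_trans (nneseries_lim_ge k _) => //.
rewrite /jump_time -sumEFin big_mkord; apply: lee_sum => i _.
by apply: hold_le_bound => //; exact: aw.
Qed.

Lemma passage_time_lty :
  (\int[law X x]_w @passage_time R T S rate X x w < +oo)%E.
Proof.
have c0 : 0 < c by rewrite invr_gt0.
have b0 k w : (0 <= \sum_(n <oo) bound k n w)%E by apply: nneseries_ge0 => n _ _; exact: bound_ge0.
have mb k n : measurable_fun setT (bound k n).
  apply: emeasurable_funD; apply/measurable_EFinP.
    by apply: measurable_funM => //; apply: measurable_indic; exact: measurable_late.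
  by apply: measurable_indic; exact: measurable_nonpos.
apply: le_lt_trans (integral_le_ge0 _ _ passage_time_le) _.
  by move=> w; apply: nneseries_ge0 => k _ _; exact: b0.
rewrite integral_nneseries//; last first.
  by move=> k; apply: ge0_emeasurable_sum => // n w _ _; exact: bound_ge0.
have int_bound k n : (\int[law X x]_w bound k n w = c%:E * P (late k n))%E.
  have ml : measurable_fun setT (fun w => (\1_(late k n) w : R)%:E).
    by apply/measurable_EFinP; apply: measurable_indic; exact: measurable_late.
  have mn : measurable_fun setT (fun w => (\1_(nonpos k) w : R)%:E).
    by apply/measurable_EFinP; apply: measurable_indic; exact: measurable_nonpos.
  have mcl : measurable_fun setT (fun w => (c * \1_(late k n) w)%:E).
    by apply/measurable_EFinP; apply: measurable_funM; [exact: measurable_cst|exact/measurable_EFinP].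
  have cl0 w : setT w -> (0 <= (c * \1_(late k n) w)%:E)%E.
    by rewrite lee_fin mulr_ge0// ltW.
  have n0 w : setT w -> (0 <= (\1_(nonpos k) w : R)%:E)%E by rewrite lee_fin.
  rewrite (ge0_integralD _ _ cl0 mcl n0 mn)//.
  rewrite [X in (_ + X)%E](_ : _ = 0%E) ?adde0; last first.
    rewrite integral_indic// setIT; apply/eqP; rewrite -measure_le0.
    rewrite -(pos_hold_ae consS PT nu0 nu1 fddx); apply: le_measure; rewrite ?inE//.
      by apply: measurableC; exact: measurable_pos_hold.
    by move=> w /= Hk /(_ k); rewrite ltNge Hk.
  under eq_integral do rewrite EFinM.
  rewrite (ge0_integralZl_EFin _ _ _ ml)// ?ltW//.
  by rewrite integral_indic// setIT.
apply: (@le_lt_trans _ _ (\sum_(k <oo) ((c * fine (\sum_(n <oo) (expR (- n%:R : R))%:E))%:E * P (avoid k)))%E).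
  apply: lee_nneseries => [k _ _|k _]; first by apply: integral_ge0 => w _; exact: b0.
  rewrite integral_nneseries//; under eq_eseriesr do rewrite int_bound.
  rewrite nneseriesZl// EFinM -muleA; apply: lee_wpmul2l; first by rewrite lee_fin ltW.
  apply: (@le_trans _ _ (\sum_(n <oo) ((expR (- n%:R))%:E * P (avoid k)))%E).
    by apply: lee_nneseries => // n _; exact: late_le.
  under eq_eseriesr do rewrite muleC.
  rewrite -(fineK (law_fin PT (measurable_avoid k))) nneseriesZl; last first.
    by move=> n _; rewrite lee_fin expR_ge0.
  rewrite (fineK (_ : (\sum_(n <oo) (expR (- n%:R : R))%:E)%E \is a fin_num)) 1?muleC//.
  rewrite ge0_fin_numE; first exact: eseries_expRN_lty.
  by apply: nneseries_ge0 => n _ _; rewrite lee_fin expR_ge0.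
rewrite nneseriesZl//; apply: lte_mul_pinfty => //.
  rewrite lee_fin mulr_ge0 ?(ltW c0)// fine_ge0//.
  by apply: nneseries_ge0 => n _ _; rewrite lee_fin expR_ge0.
exact: avoid_summable.
Qed.

(** Expected number of visits to [y] during an excursion, counting the start but not the return. *)
Let visits y : \bar R := (\sum_(k <oo) avoid_at k y)%E.

Let visits_ge0 y : (0 <= visits y)%E.
Proof. by apply: nneseries_ge0 => k _ _; exact: avoid_at_ge0. Qed.

Let visits_lty y : (visits y < +oo)%E.
Proof.
apply: le_lt_trans avoid_summable; apply: lee_nneseries => [k _ _|k _]; first exact: avoid_at_ge0.
apply: le_measure; rewrite ?inE//; last exact: measurable_avoid.
by apply: measurableI; [exact: measurable_avoid|exact: measurable_jump_chain].
Qed.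

Let visits_fin y : visits y \is a fin_num.
Proof. by rewrite ge0_fin_numE. Qed.

Let visits_mass : (\esum_(y in S) visits y < +oo)%E.
Proof.
rewrite /visits; under eq_esum => y _.
  rewrite nneseries_esumT; last by move=> k; exact: avoid_at_ge0.
  over.
rewrite esum_interchange; last by move=> y k _ _; exact: avoid_at_ge0.
under eq_esum do rewrite -avoid_mass.
by rewrite -nneseries_esumT//; exact: avoid_summable.
Qed.

Let visits_start : (1 <= visits x)%E.
Proof.
rewrite /visits nneseries_recl//.
rewrite avoid_at0// /point_mass eqxx leeDl//.
by apply: nneseries_ge0 => k _ _; exact: avoid_at_ge0.
Qed.

(** One more jump shifts the series by one index. For [y <> x] only the nonnegative term of index 0
    is missing; at [x] the left side is the probability of a return, at most 1, which the start
    alone contributes on the right. *)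
Let visits_sub y : S y -> (\esum_(z in S) (visits z * (p z y)%:E) <= visits y)%E.
Proof.
move=> Sy.
have ap0 k z : S z -> (0 <= avoid_at k z * (p z y)%:E)%E.
  by move=> Sz; rewrite mule_ge0 ?avoid_at_ge0// lee_fin p0.
apply: (@le_trans _ _ (\sum_(k <oo) P (avoid k `&` [set w | Y k.+1 w = y]))%E).
  rewrite nneseries_esumT; last by move=> k; exact: measure_ge0.
  under [leRHS]eq_esum do rewrite avoid_jump//.
  rewrite -esum_interchange; last by move=> z k Sz _; exact: ap0.
  apply: le_esum => z Sz; rewrite -nneseries_esumT; last by move=> k; exact: ap0.
  rewrite muleC -nneseriesZl; last by move=> k _; exact: avoid_at_ge0.
  by apply: lee_nneseries => [k _ _|k _]; rewrite muleC// ap0.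
have [->|/eqP yx] := eqVneq y x.
  exact: le_trans avoid_return_le1 visits_start.
rewrite /visits [leRHS]nneseries_recl//.
apply: (@le_trans _ _ (\sum_(1 <= k <oo) avoid_at k y)%E); last first.
  by rewrite leeDr// avoid_at_ge0.
rewrite -nneseries_addn; last by move=> k; exact: avoid_at_ge0.
apply: lee_nneseries => [k _ _|k _]; first exact: measure_ge0.
rewrite addn1.
by rewrite avoid_jump// avoid_atS.
Qed.

Let weight y : R := fine (visits y) / q y.
Let total : \bar R := (\esum_(y in S) (weight y)%:E)%E.

Let weight_ge0 y : S y -> 0 <= weight y.
Proof.
move=> Sy; apply: divr_ge0; first exact: fine_ge0.
exact: le_trans (ltW qm_gt0) (qm_le Sy).
Qed.

Let total_fin : total \is a fin_num.
Proof.
rewrite ge0_fin_numE; last by apply: esum_ge0 => y Sy; rewrite lee_fin weight_ge0.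
apply: (@le_lt_trans _ _ (qm^-1%:E * \esum_(y in S) visits y)%E); last first.
  by rewrite lte_mul_pinfty// lee_fin invr_ge0 ltW.
have qm0 : 0 <= qm^-1 by rewrite invr_ge0 ltW.
rewrite -(esumZl qm0)//; apply: le_esum => y Sy.
rewrite -(fineK (visits_fin y)) -EFinM lee_fin /weight mulrC.
rewrite ler_wpM2r ?fine_ge0// lef_pV2 ?posrE ?qm_le//.
exact: lt_le_trans qm_gt0 (qm_le Sy).
Qed.

Let total_gt0 : 0 < fine total.
Proof.
have q0 y : S y -> 0 < q y by move=> Sy; exact: lt_le_trans qm_gt0 (qm_le Sy).
rewrite -lte_fin fineK// /total (esumD1 Sx); last by move=> y Sy; rewrite lee_fin weight_ge0.
apply: (@lt_le_trans _ _ (weight x)%:E).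
  rewrite lte_fin divr_gt0 ?q0// (@lt_le_trans _ _ 1)//.
  by rewrite -lee_fin fineK.
by rewrite leeDl// esum_ge0// => y [Sy _]; rewrite lee_fin weight_ge0.
Qed.

Let nu y : R := if y \in S then weight y / fine total else 0.

Lemma exists_stationary : exists pi, stationary X pi.
Proof.
have Zi0 : 0 <= (fine total)^-1 by rewrite invr_ge0 ltW.
have q0 y : S y -> 0 < q y by move=> Sy; exact: lt_le_trans qm_gt0 (qm_le Sy).
have nuE y : S y -> nu y = (fine total)^-1 * weight y.
  by move=> Sy; rewrite /nu mem_set// mulrC.
have nu_ge0 y : 0 <= nu y.
  rewrite /nu; case: ifPn => //; rewrite inE => Sy.
  by rewrite mulr_ge0// weight_ge0.
have nu_mass : (\esum_(y in S) (nu y)%:E = 1)%E.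
  rewrite (eq_esum (b := fun y => (fine total)^-1%:E * (weight y)%:E)%E); last first.
    by move=> y Sy; rewrite nuE.
  rewrite esumZl//.
  by rewrite -/total -(fineK total_fin) -EFinM mulVf// gt_eqF.
(* The flow [nu * q] is the visit measure up to a constant, so its sub-invariance and finiteness are
   those of [visits]. *)
have nu_q y : S y -> nu y * q y = (fine total)^-1 * fine (visits y).
  by move=> Sy; rewrite nuE// -mulrA divfK// gt_eqF// q0.
have nu_sub y : S y -> (\esum_(z in S) (nu z * q z * p z y)%:E <= (nu y * q y)%:E)%E.
  move=> Sy; rewrite nu_q// EFinM fineK//.
  rewrite (eq_esum (b := fun z => (fine total)^-1%:E * (visits z * (p z y)%:E))%E); last first.
    by move=> z Sz; rewrite nu_q// -mulrA EFinM EFinM fineK.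
  rewrite esumZl//; last by move=> z Sz; rewrite mule_ge0// lee_fin p0.
  by apply: lee_wpmul2l; [rewrite lee_fin|exact: visits_sub].
have nu_flow : (\esum_(z in S) (nu z * q z)%:E < +oo)%E.
  rewrite (eq_esum (b := fun z => (fine total)^-1%:E * visits z)%E); last first.
    by move=> z Sz; rewrite nu_q// EFinM fineK.
  by rewrite esumZl// lte_mul_pinfty// lee_fin.
have [Pm PmE] := @law_mixture R T S rate X nu consS nu_ge0.
have PmT : Pm setT = 1%E.
  rewrite PmE -nu_mass; apply: eq_esum => y _.
  by rewrite probability_setT mule1.
have fddm : started_from nu Pm.
  move=> k y t Sy t0; rewrite PmE (esumD1 (Sy 0%N (leq0n _))); last first.
    by move=> z _; rewrite mule_ge0// lee_fin.
  rewrite (law_started (Sy 0%N (leq0n _)) Sy t0) /point_mass eqxx mul1r.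
  rewrite esum1 ?adde0; first by rewrite -EFinM mulrA.
  move=> z [Sz /= zy]; rewrite (law_started Sz Sy t0) /point_mass.
  by case: eqP => // _; rewrite !mul0r mule0.
exists nu; split.
  split => //; last by move=> y nSy; rewrite /nu memNset.
by move=> t y t0 Sy; rewrite -PmE (law_chain_at consS PmT nu_ge0 nu_mass fddm nu_sub nu_flow).
Qed.

End Excursions.
End LawFacts.

(** * Foster's criterion for chains given by finite lists of events *)

Section FosterCriterion.
Variables (R : realType) (T : choiceType) (S : set T) (rate : T -> T -> R).
Variable L : T -> seq (T * R).
Hypothesis rateE : forall x y, S x ->
  rate x y = \sum_(e <- L x) (y == e.1)%:R * e.2.
Hypothesis L_pos : forall x e, S x -> e \in L x -> [/\ 0 < e.2, S e.1 & e.1 <> x].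
Variable qm : R.
Hypotheses (qm_gt0 : 0 < qm)
  (qm_le : forall x, S x -> qm <= \sum_(e <- L x) e.2).
Variable x0 : T.
Hypotheses (Sx0 : S x0)
  (from_x0 : forall x, S x -> reachable_from rate x0 x)
  (to_x0 : forall x, S x -> reachable_from rate x x0).
Local Notation q := (exit_rate S rate).
Local Notation p := (jump_prob S rate).

Let esum_rate (g : T -> R) x : S x -> (forall y, S y -> 0 <= g y) ->
  (\esum_(y in S `\ x) (rate x y * g y)%:E = (\sum_(e <- L x) e.2 * g e.1)%:E)%E.
Proof.
move=> Sx g0.
rewrite (eq_esum (b := fun y => \sum_(e <- L x | e \in L x)
    ((y == e.1)%:R * e.2 * g y)%:E)%E); last first.
  by move=> y _; rewrite rateE// mulr_suml sumEFin [in RHS]big_seq_cond -big_seq_cond [in LHS]big_seq.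
rewrite esum_sum; last first.
  move=> y e [Sy _] /(L_pos Sx)[e0 _ _].
  by rewrite lee_fin !mulr_ge0 ?g0// ltW.
rewrite -big_seq -sumEFin big_seq [RHS]big_seq; apply: eq_bigr => e eL.
have [e0 Se ex] := L_pos Sx eL.
rewrite (@esumD1 _ _ _ _ e.1); [|by split|].
  by rewrite eqxx mul1r esum1 ?adde0// => y [_ /= ye]; case: eqP => // _; rewrite !mul0r.
by move=> y [Sy _]; rewrite lee_fin !mulr_ge0 ?g0// ltW.
Qed.

Let exit_rateE x : S x -> q x = \sum_(e <- L x) e.2.
Proof.
move=> Sx; rewrite /exit_rate; have := esum_rate (g := fun=> 1) Sx (fun _ _ => ler01).
under eq_esum do rewrite mulr1.
by move=> ->; apply: eq_bigr => e _; rewrite mulr1.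
Qed.

Let q_gt0 x : S x -> 0 < q x.
Proof. by move=> Sx; rewrite exit_rateE// (lt_le_trans qm_gt0)// qm_le. Qed.

Let rate_ge0 x y : S x -> 0 <= rate x y.
Proof.
move=> Sx; rewrite rateE// big_seq sumr_ge0// => e /(L_pos Sx)[e0 _ _].
by rewrite mulr_ge0// ltW.
Qed.

Let jump_prob_ge0 x y : S x -> 0 <= p x y.
Proof.
move=> Sx; rewrite /jump_prob; case: eqP => // _.
by rewrite divr_ge0 ?rate_ge0// ltW// q_gt0.
Qed.

Let esum_jump (g : T -> R) x : S x -> (forall y, S y -> 0 <= g y) ->
  (\esum_(y in S) (p x y * g y)%:E = ((\sum_(e <- L x) e.2 * g e.1) / q x)%:E)%E.
Proof.
move=> Sx g0.
rewrite (esumD1 Sx); last by move=> y Sy; rewrite lee_fin mulr_ge0 ?jump_prob_ge0 ?g0.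
rewrite {1}/jump_prob eqxx mul0r add0e mulrC EFinM -esum_rate//.
have qi0 : 0 <= (q x)^-1 by rewrite invr_ge0 ltW// q_gt0.
rewrite -(esumZl qi0); last first.
  by move=> y [Sy _]; rewrite lee_fin mulr_ge0 ?rate_ge0 ?g0.
apply: eq_esum => y [Sy /= /eqP yx].
by rewrite -EFinM /jump_prob eq_sym (negbTE yx); congr EFin; ring.
Qed.

Let step_in_list x y : S x -> 0 < rate x y -> exists2 e, e \in L x & e.1 = y.
Proof.
move=> Sx; rewrite rateE// => r0.
have /hasP[e eL /eqP ey] : has (fun e => y == e.1) (L x).
  apply: contraTT r0 => /hasPn no; rewrite -leNgt big_seq big1// => e /no/negbTE->.
  by rewrite mul0r.
by exists e.
Qed.

Let closedS x y : S x -> 0 < rate x y -> S y.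
Proof. by move=> Sx /(step_in_list Sx)[e /(L_pos Sx)[_ Se _] <-]. Qed.

Let countableS : countable S.
Proof.
(* [layer n] collects the states reached from [x0] by [n] events. *)
pose layer := fix layer n := if n is n'.+1
  then \bigcup_(x in layer n') [set e.1 | e in [set` L x]] else [set x0].
have layer_count n : countable (layer n).
  elim: n => [|n IHn]; first exact: finite_set_countable (finite_set1 x0).
  apply: bigcup_countable => // x _; apply: finite_set_countable.
  exact: finite_image (finite_seq (L x)).
apply: (@sub_countable _ _ _ (\bigcup_n layer n)); last exact: bigcup_countable.
apply: subset_card_le => x /from_x0 /clos_rt_rtn1_iff reach.
suff [] : S x /\ (\bigcup_n layer n) x by [].
elim: reach => [|y z yz _ [Sy [n _ ny]]]; first by split => //; exists 0%N.
have [e eL ez] := step_in_list Sy yz.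
split; first exact: closedS yz.
by exists n.+1 => //; exists y => //; exists e.
Qed.

Lemma events_conservative : conservative S rate.
Proof.
split; [exact: countableS|exact: q_gt0|exact: jump_prob_ge0|].
move=> x Sx; have := esum_jump (g := fun=> 1) Sx (fun _ _ => ler01).
under eq_esum do rewrite mulr1.
by move=> ->; under eq_bigr do rewrite mulr1; rewrite -exit_rateE// divff// gt_eqF// q_gt0.
Qed.

Let reach_path x y : S x -> reachable_from rate x y -> jump_path S rate x y.
Proof.
move=> Sx /clos_rt_rtn1_iff.
elim=> [|a b ab _ [k [s [s0 sk Ss ps]]]].
  exists 0%N, (fun=> x); split => // i; by rewrite leqn0.
have Sa : S a by rewrite -sk; exact: Ss.
have [aeb|/eqP anb] := eqVneq a b; first by exists k, s; rewrite -aeb.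
exists k.+1, (fun i => if (i <= k)%N then s i else b); split => //.
- by rewrite ltnn.
- by move=> i ik /=; case: ifPn => [/Ss//|_]; exact: closedS ab.
- move=> i; rewrite ltnS => ik /=; rewrite ik; case: ifPn => [/ps//|].
  rewrite -leqNgt => ki; have -> : i = k by apply/eqP; rewrite eqn_leq ik.
  by rewrite sk /jump_prob; case: eqP => // _; rewrite divr_gt0// q_gt0.
Qed.

Let path_all x y : S x -> S y -> jump_path S rate x y.
Proof.
move=> Sx Sy; apply: reach_path => //.
exact: rt_trans (to_x0 Sx) (from_x0 Sy).
Qed.

Variables (V : T -> R) (eps : R).
Hypotheses (V_ge0 : forall x, S x -> 0 <= V x) (eps_gt0 : 0 < eps)
  (drift : forall x, S x -> x <> x0 ->
    \sum_(e <- L x) e.2 * (V e.1 - V x) <= - eps * \sum_(e <- L x) e.2).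

Let lyapunov_x0 : lyapunov S rate x0 V eps.
Proof.
split => // [y Sy|y Sy yx]; rewrite esum_jump//; first exact: ltry.
have q0 := q_gt0 Sy.
rewrite -EFinD lee_fin -lerBrDr ler_pdivrMr// exit_rateE//.
have := drift Sy yx; under eq_bigr do rewrite mulrBr.
rewrite sumrB -mulr_suml; lra.
Qed.

(* Raising [V] by a constant off [b] makes [b], instead of [a], the only state
   where the drift may fail to be negative. *)
Let lyapunov_edge a b U : S a -> S b -> 0 < p a b ->
  lyapunov S rate a U eps -> exists U', lyapunov S rate b U' eps.
Proof.
move=> Sa Sb pab [U0 _ Ufin Ud].
have [_ _ _ p1] := events_conservative.
pose s y := fine (\esum_(z in S) (p y z * U z)%:E)%E.
have pU0 y : S y -> (0 <= \esum_(z in S) (p y z * U z)%:E)%E.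
  by move=> Sy; apply: esum_ge0 => z Sz; rewrite lee_fin mulr_ge0 ?jump_prob_ge0 ?U0.
have sE y : S y -> (\esum_(z in S) (p y z * U z)%:E = (s y)%:E)%E.
  by move=> Sy; rewrite fineK// ge0_fin_numE ?pU0// Ufin.
(* At [a] the indicator of not being [b] drops by [p a b] in mean, and [C] makes this drop pay for
   [s a + eps], leaving the slack [U a]. At other states off [b] the indicator has its maximal value
   1 and cannot grow. *)
pose C := (s a + eps) / p a b.
have sa0 : 0 <= s a by rewrite fine_ge0// pU0.
have C0 : 0 <= C by rewrite divr_ge0 ?addr_ge0// ltW.
have off y : S y -> (\esum_(z in S) (p y z * (z != b)%:R)%:E = (1 - p y b)%:E)%E.
  move=> Sy; rewrite (esumD1 Sb); last by move=> z Sz; rewrite lee_fin mulr_ge0 ?jump_prob_ge0.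
  have := p1 y Sy; rewrite (esumD1 Sb); last by move=> z Sz; rewrite lee_fin jump_prob_ge0.
  rewrite eqxx mulr0 add0e.
  rewrite (eq_esum (b := fun z => (p y z * (z != b)%:R)%:E)); last first.
    by move=> z [_ /= /eqP/negbTE->]; rewrite mulr1.
  by case: (\esum_(z in S `\ b) _)%E => [r| |]// [] <-; congr EFin; ring.
have U'E y : S y ->
    (\esum_(z in S) (p y z * (U z + C * (z != b)%:R))%:E = (s y + C * (1 - p y b))%:E)%E.
  move=> Sy; rewrite EFinD EFinM -off// -sE// -esumZl//; last first.
    by move=> z Sz; rewrite lee_fin mulr_ge0 ?jump_prob_ge0.
  rewrite -esumD; last 2 first.
  - by move=> z Sz; rewrite lee_fin mulr_ge0 ?jump_prob_ge0 ?U0.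
  - by move=> z Sz; rewrite mule_ge0// lee_fin mulr_ge0 ?jump_prob_ge0.
  by apply: eq_esum => z Sz; rewrite -EFinM -EFinD; congr EFin; ring.
exists (fun y => U y + C * (y != b)%:R); split => //.
- by move=> y Sy; rewrite addr_ge0 ?U0// mulr_ge0.
- by move=> y Sy; rewrite U'E// ltry.
move=> y Sy yb; rewrite U'E// -EFinD lee_fin.
have -> : (y != b)%:R = 1 :> R by case: eqP yb.
have pyb := jump_prob_ge0 b Sy.
have [->|/eqP ya] := eqVneq y a.
  have -> : s a + C * (1 - p a b) + eps = C + (s a + eps - C * p a b) by ring.
  have -> : C * p a b = s a + eps by rewrite /C divfK// gt_eqF.
  by rewrite subrr addr0 mulr1 lerDr U0.
have := Ud y Sy ya; rewrite sE// -EFinD lee_fin.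
have := mulr_ge0 C0 pyb; lra.
Qed.

Let lyapunov_all x : S x -> exists U, lyapunov S rate x U eps.
Proof.
move=> Sx; have [k [s [s0 <- Ss ps]]] := path_all Sx0 Sx.
elim: k Ss ps => [|k IHk] Ss ps; first by exists V; rewrite s0.
have [||U lU] := IHk.
- by move=> i ik; apply: Ss; exact: leqW.
- by move=> i ik; apply: ps; exact: leqW.
by apply: lyapunov_edge lU => //; [exact: Ss|exact: Ss|exact: ps].
Qed.

Theorem foster_criterion (X : ctmc S rate) :
  [/\ irreducible X, positive_recurrent X & exists! pi, stationary X pi].
Proof.
have consS := events_conservative.
have qmq y : S y -> qm <= q y by move=> Sy; rewrite exit_rateE// qm_le.
have irrX : irreducible X by apply: jump_path_irreducible.
split => //.
  by move=> x Sx; have [U lU] := lyapunov_all Sx; exact: (passage_time_lty consS X Sx lU qm_gt0 qmq).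
have [pi st] := exists_stationary consS X Sx0 lyapunov_x0 qm_gt0 qmq.
exists pi; split => // pi' st'; apply: stationary_unique st st' => //.
by move=> t x _ Sx; exact: transition_mass_le1.
Qed.

End FosterCriterion.

(* [N] is the number of tasks and [r] the SLTA threshold index. The term [r]
   dominates at [N = 0] and [D * N] for large [N]; the concave bounded terms
   make the drift negative for small [N >= 1] and on the finitely many states
   where [r] may still increase, since they charge a transition to a smaller
   [N] or [r] geometrically more than one to a larger [N] or [r]. *)
Lemma drift_function (R : realType) (la mu : R) : 0 < la -> 0 < mu ->
  exists (F : nat -> nat -> R) (eps : R), [/\ 0 < eps, forall N r, 0 <= F N r &
    forall N r r', (0 < r)%N -> (r' <= r.+1)%N -> (r' = r.+1 -> (r <= N.+1)%N) ->
      (N = 0%N -> r = r'.+1) ->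
      mu * N%:R * (F N.-1 r - F N r) + la * (F N.+1 r' - F N r)
      <= - eps * (mu * N%:R + la)].
Proof.
move=> la0 mu0.
(* For the last case below: with [N.+1] tasks and an index that may still grow, the exponent
   [N + 2 * r] is at most [(3 * K1).+1], which determines [C]. *)
have expo (N r K : nat) : (N < K)%N -> (r <= N.+2)%N -> (N + 2 * r <= (3 * K).+1)%N.
  by clear; lia.
have large (a : R) : exists K : nat, a <= mu * K%:R.
  exists (Num.truncn (`|a| / mu)).+1.
  have /andP[_ /ltW] := truncn_itv (divr_ge0 (normr_ge0 a) (ltW mu0)).
  by rewrite ler_pdivrMr// mulrC; apply: le_trans; exact: ler_norm.
(* The factor [1 / 2] lets a departure release at least half of the larger geometric term, and
   [la * k <= mu / 4] keeps the loss through arrivals to at most half of this gain. *)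
pose k := Num.min (1 / 2) (mu / (4 * la)).
have k0 : 0 < k by rewrite lt_min !divr_gt0// mulr_gt0.
have k12 : k <= 1 / 2 by rewrite ge_min lexx.
have lak : la * k <= mu / 4.
  apply: (@le_trans _ _ (la * (mu / (4 * la)))).
    by rewrite ler_pM2l// ge_min lexx orbT.
  by rewrite le_eqVlt; apply/orP; left; apply/eqP; field; rewrite gt_eqF.
have kX_gt0 n : 0 < k ^+ n by exact: exprn_gt0.
have kX_anti n n' : (n <= n')%N -> k ^+ n' <= k ^+ n.
  by move=> nn'; apply: ler_wiXn2l => //; lra.
have kX_le1 n : k ^+ n <= 1 by rewrite -(expr0 k) kX_anti.
(* Above [K0] the term [D * N] alone gives the drift when [r] does not grow. Up to [K0] the first
   geometric term gains at least [eta], of which [D] is small enough to lose at most half. *)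
have [K0 K0P] := large (3 * la).
pose eta := k ^+ K0 * mu / 16.
have eta0 : 0 < eta by rewrite divr_gt0// mulr_gt0.
pose D := Num.min (1 / 4) (eta / (2 * la)).
have D0 : 0 < D by rewrite lt_min !divr_gt0// mulr_gt0.
have D14 : D <= 1 / 4 by rewrite ge_min lexx.
have Dla : D * la <= eta / 2.
  apply: (@le_trans _ _ (eta / (2 * la) * la)).
    by rewrite ler_pM2r// ge_min lexx orbT.
  by rewrite le_eqVlt; apply/orP; left; apply/eqP; field; rewrite gt_eqF.
(* Above [K1] the term [D * N] also pays for an increase of [r]; on the states below where [r] may
   increase, [C] is large enough for the second geometric term to pay. *)
have [K1 K1P] := large (2 * la * (1 + 2 * D) / D).
have K1D : 2 * la * (1 + 2 * D) <= D * (mu * K1%:R).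
  by rewrite [leRHS]mulrC -ler_pdivrMr.
have c0 : 0 < mu * k ^+ (3 * K1).+1 / 4 by rewrite divr_gt0// mulr_gt0.
pose C := (D * la + 2 * la + mu * K1%:R) / (mu * k ^+ (3 * K1).+1 / 4).
have C0 : 0 <= C by rewrite divr_ge0 ?addr_ge0 ?mulr_ge0// ltW.
have CP : C * (mu * k ^+ (3 * K1).+1 / 4) = D * la + 2 * la + mu * K1%:R.
  by rewrite /C divfK// gt_eqF.
(* The drift left up to [K0], divided by the largest total rate there; in the other cases [D / 4]
   serves. *)
pose e3 := eta / 2 / (mu * K0%:R + la).
have m0 : 0 < mu * K0%:R + la.
  by have : 0 <= mu * K0%:R by [rewrite mulr_ge0// ltW]; lra.
have e30 : 0 < e3 by rewrite /e3 divr_gt0// divr_gt0.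
have e3P : e3 * (mu * K0%:R + la) = eta / 2 by rewrite /e3 divfK// gt_eqF.
pose eps := Num.min (D / 4) e3.
have eps0 : 0 < eps by rewrite lt_min e30 divr_gt0.
have epsD : eps <= D / 4 by rewrite ge_min lexx.
have eps3 : eps <= e3 by rewrite ge_min lexx orbT.
(* An arrival that lowers [r] lowers [N + 2 * r] by one, so at [N = 0] the large coefficient [C]
   does no harm, and the drop of [r] by 1 outweighs the increases of at most [1 / 4] of each of the
   two middle terms. *)
pose F N r := r%:R + D * N%:R + 1 / 4 * (1 - k ^+ N) + C * (1 - k ^+ (N + 2 * r)) : R.
exists F, eps; split => // [N r|N r r' r0 rr' up N0].
  have DN : 0 <= D * N%:R by rewrite mulr_ge0// ltW.
  have CX : 0 <= C * (1 - k ^+ (N + 2 * r)) by rewrite mulr_ge0// subr_ge0.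
  have rR : 0 <= r%:R :> R by [].
  have := kX_le1 N; rewrite /F; lra.
case: N up N0 => [|N] up N0.
  have {N0 up rr'} -> := N0 erefl.
  rewrite mulr0 mul0r !add0r /F -natr1 mulr0 addr0 expr0 expr1 add0n add1n.
  have : k ^+ (2 * r'.+1) <= k ^+ (2 * r').+1.
    by apply: kX_anti; rewrite mulnS addSn ltnS leq_addl.
  set a := k ^+ _; set b := k ^+ _ => ab.
  have Cab := ler_wpM2l C0 ab.
  rewrite [leRHS]mulrC mulrN -mulrN ler_pM2l//; lra.
set z := k ^+ (N + 2 * r); have z0 : 0 < z by exact: kX_gt0.
set x := k ^+ N; have x0 : 0 < x by exact: kX_gt0.
set n : R := N.+1%:R; have n1 : 1 <= n by rewrite ler1n.
pose d : R := r'%:R - r%:R.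
have total : mu * n * (F N r - F N.+1 r) + la * (F N.+2 r' - F N.+1 r) <=
    la * d + D * (la - mu * n) - x * (mu * n) / 16 - C * (z * (mu * n)) / 4.
  have -> : F N r - F N.+1 r = - D - 1 / 4 * (x - k * x) - C * (z - k * z).
    by rewrite /F addSn !exprS -/x -/z -natr1; ring.
  have -> : F N.+2 r' - F N.+1 r = d + D + 1 / 4 * (k * x - k * (k * x)) +
      C * (k * z - k ^+ (N.+2 + 2 * r')).
    by rewrite /F addSn !exprS -/x -/z /d -[N.+2%:R]natr1; ring.
  (* Nonnegativity of the new geometric term suffices, so the estimate holds for any [r']. *)
  set w := k ^+ _; have w0 : 0 <= w by exact/ltW/kX_gt0.
  have mun : mu <= mu * n by rewrite ler_peMr// ltW.
  have h1 : la * (k * z) <= mu * n / 4 * z by rewrite mulrA ler_pM2r//; lra.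
  have h2 : la * (k * x) <= mu * n / 4 * x by rewrite mulrA ler_pM2r//; lra.
  have h3 : 0 <= la * w by rewrite mulr_ge0// ltW.
  have h4 : k * (mu * n * z) <= 1 / 2 * (mu * n * z).
    by rewrite ler_wpM2r// !mulr_ge0 ?(ltW mu0) ?(ltW z0)//; lra.
  have h5 : k * (mu * n * x) <= 1 / 2 * (mu * n * x).
    by rewrite ler_wpM2r// !mulr_ge0 ?(ltW mu0) ?(ltW x0)//; lra.
  have h6 : 0 <= la * (k * (k * x)) by rewrite !mulr_ge0// ltW.
  have h7 : 0 <= mu * n * x by rewrite !mulr_ge0 ?(ltW mu0) ?(ltW x0)//; lra.
  have hz : la * (k * z - w) - mu * n * (z - k * z) <= - (z * (mu * n)) / 4 by lra.
  have hx : la * (k * x - k * (k * x)) - mu * n * (x - k * x) <= - (x * (mu * n)) / 4 by lra.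
  have := ler_wpM2l C0 hz; lra.
apply: le_trans total _.
have n_ge0 : 0 <= n by [].
have Dla_ge0 : 0 <= D * la by rewrite mulr_ge0// ltW.
have mun_ge0 : 0 <= mu * n by rewrite mulr_ge0// ltW.
have zC0 : 0 <= C * (z * (mu * n)) / 4.
  by rewrite divr_ge0// mulr_ge0// mulr_ge0// ltW.
have xm0 : 0 <= x * (mu * n) / 16.
  by rewrite divr_ge0// mulr_ge0// ltW.
have mn0 : 0 <= mu * n + la by rewrite addr_ge0// ltW.
have big_n K : (K < N.+1)%N -> mu * K%:R <= mu * n.
  by move=> KN; rewrite ler_pM2l// ler_nat ltnW.
have small_n K : (N.+1 <= K)%N -> mu * n <= mu * K%:R.
  by move=> KN; rewrite ler_pM2l// ler_nat.
have := ler_wpM2r mn0 epsD; have := ler_wpM2r mn0 eps3 => le3 leD.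
(* Beyond [N.+2] the index cannot grow; otherwise an increase costs at most [la]. *)
have [rN|rN] := leqP r N.+2; last first.
  have d0 : la * d <= 0.
    rewrite mulr_ge0_le0 ?(ltW la0)// subr_le0 ler_nat.
    move: rr'; rewrite leq_eqVlt => /predU1P[/up|]; last by rewrite ltnS.
    by rewrite leqNgt rN.
  have [KN|NK] := ltnP K0 N.+1.
    have := big_n K0 KN => bn.
    have : D * (3 * la) <= D * (mu * n) by rewrite ler_pM2l//; lra.
    lra.
  have xK : eta <= x * (mu * n) / 16.
    rewrite /eta ler_pM2r ?invr_gt0// ler_pM ?(ltW mu0) ?(ltW (kX_gt0 K0))//.
    - exact: kX_anti (ltnW NK).
    - by rewrite ler_peMr// ltW.
  have := small_n K0 NK => sn.
  have : e3 * (mu * n + la) <= e3 * (mu * K0%:R + la) by rewrite ler_pM2l//; lra.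
  have : 0 <= D * (mu * n) by rewrite mulr_ge0// ltW.
  lra.
have d1 : la * d <= la.
  by rewrite -[leRHS]mulr1 ler_pM2l// lerBlDr nat1r ler_nat.
have [KN|NK] := ltnP K1 N.+1.
  have := big_n K1 KN => bn.
  have Dn : D * (mu * K1%:R) <= D * (mu * n) by rewrite ler_pM2l.
  have {K1D Dn} := le_trans K1D Dn.
  lra.
have zK : mu * k ^+ (3 * K1).+1 / 4 <= z * (mu * n) / 4.
  rewrite ler_pM2r ?invr_gt0// mulrC ler_pM ?(ltW mu0)//.
  - by apply/ltW/kX_gt0.
  - exact/kX_anti/expo.
  - by rewrite ler_peMr// ltW.
have := ler_wpM2l C0 zK; rewrite CP.
have := small_n K1 NK => sn.
have : D / 4 * (mu * n + la) <= mu * n + la by rewrite ler_piMl//; lra.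
have : 0 <= D * (mu * n) by rewrite mulr_ge0// ltW.
lra.
Qed.

(** * Occupancy states *)

Section Occupancy.
Variables (R : realType) (m n : nat) (A : 'I_m.+1 -> nat).
Hypothesis n_gt0 : (0 < n)%N.
Implicit Types (k : 'I_m.+1 -> nat -> nat) (p : coord m) (q : occupancy R m).

(* The occupancy state with [k i j] pools of class [i] having at least [j]
   tasks. *)
Definition occ k : occupancy R m := fun i j => (k i j)%:R / n%:R.

Definition profile k (J : nat) : Prop :=
  [/\ forall i j, (k i j.+1 <= k i j)%N, forall i, k i 0%N = A i &
      forall i j, (J <= j)%N -> k i j = 0%N].

Let nR0 : n%:R != 0 :> R. Proof. by rewrite pnatr_eq0 -lt0n. Qed.
Let nR_gt0 : 0 < n%:R :> R. Proof. by rewrite ltr0n. Qed.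

Lemma occ_inj k k' : occ k = occ k' -> k = k'.
Proof.
move=> e; apply/funext => i; apply/funext => j.
have := congr1 (fun q => q i j) e; rewrite /occ => /(mulIf (invr_neq0 nR0)) /eqP.
by rewrite eqr_nat => /eqP.
Qed.

(** A nonincreasing integer sequence that never vanishes stays at least 1, so its terms divided by
    [n] have an infinite sum. *)
Let summable_height (f : nat -> nat) (G : coord m -> \bar R) (i : 'I_m.+1) :
  summable setT G -> (forall j, `|G (i, j)| = ((f j)%:R / n%:R : R)%:E)%E ->
  (forall j, (f j.+1 <= f j)%N) -> exists J, forall j, (J <= j)%N -> f j = 0%N.
Proof.
move=> sG Gf f_anti.
have f_le j j' : (j <= j')%N -> (f j' <= f j)%N.
  by move=> /subnK <-; elim: (j' - j)%N => [//|d]; apply: leq_trans; rewrite addSn.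
suff [J J0] : exists J, f J = 0%N.
  by exists J => j Jj; apply/eqP; rewrite -leqn0 -J0 f_le.
apply: contrapT => /forallNP f_neq0.
have f_gt0 j : (0 < f j)%N by rewrite lt0n; apply/eqP/f_neq0.
have B0 M : ((M%:R / n%:R : R)%:E <= \esum_(p in setT) `|G p|)%E.
  rewrite (esumID (range (fun j => (i, j))))//.
  apply: (@le_trans _ _ (\esum_(p in range (fun j => (i, j))) `|G p|)%E); last first.
    by rewrite setTI leeDl// esum_ge0.
  rewrite esum_image; last by move=> j j' _ _ [].
  rewrite -nneseries_esumT//; apply: le_trans (nneseries_lim_ge M _) => //.
  rewrite -[M in X in (X <= _)%E]subn0 -[(M - 0)%:R]sumr_const_nat mulr_suml -sumEFin.
  apply: lee_sum => j _; rewrite Gf lee_fin ler_pM2r ?invr_gt0//.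
  by rewrite ler1n.
have := sG; rewrite /summable; case: esum B0 => [s| |] B0// _; last by have := B0 0%N.
have s0 : 0 <= s by have := B0 0%N; rewrite mul0r lee_fin.
have := B0 (Num.truncn (s * n%:R)).+1; rewrite lee_fin ler_pdivrMr// leNgt => /negP; apply.
by have /andP[] := truncn_itv (mulr_ge0 s0 (ltW nR_gt0)).
Qed.

Let finite_rows J : finite_set [set p : coord m | (p.2 < J)%N].
Proof.
pose s := [seq (i, j) | i <- enum 'I_m.+1, j <- iota 0 J].
apply: (sub_finite_set _ (finite_seq s)) => -[i j] /= jJ.
by apply/allpairsP; exists (i, j); rewrite mem_enum mem_iota.
Qed.

Lemma QnP q : Qn n A q <-> exists k J, q = occ k /\ profile k J.
Proof.
split => [[sq qP]|[k [J [-> [k_anti k0 kJ]]]]].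
  pose k i j := Num.truncn (n%:R * q i j).
  have kE i j : (k i j)%:R = n%:R * q i j.
    by rewrite /k truncnK//; have [] := qP i j.
  have qE : q = occ k.
    apply/funext => i; apply/funext => j.
    by rewrite /occ kE mulrC mulKf.
  have k_anti i j : (k i j.+1 <= k i j)%N.
    by rewrite -(ler_nat R) !kE ler_pM2l//; have [] := qP i j.
  have kJ i : exists J, forall j, (J <= j)%N -> k i j = 0%N.
    apply: (summable_height sq) => // j /=.
    by rewrite ger0_norm qE// divr_ge0.
  have [J JP] := choice kJ.
  exists k, (\max_i J i)%N; split => //; split => // [i|i j Jj].
    apply/eqP; rewrite -(eqr_nat R) kE; have [_ _ _ ->] := qP i 0%N.
    by rewrite /alpha_ mulrC divfK.
  by apply: JP; apply: leq_trans Jj; exact: leq_bigmax.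
have k_le i j : (k i j <= A i)%N.
  by rewrite -k0; elim: j => // j; apply: leq_trans.
split.
  rewrite /summable (esumID [set p : coord m | (p.2 < J)%N])//.
  rewrite [X in (_ + X)%E]esum1 ?adde0; last first.
    by move=> [i j] [_ /= /negP]; rewrite -leqNgt => Jj; rewrite /occ kJ// mul0r normr0.
  rewrite setTI esum_fset//; rewrite fsbig_finite//= sumEFin; exact: ltry.
move=> i j; split.
- by rewrite /occ mulrC divfK// natr_nat.
- by rewrite /occ ler_pM2r ?invr_gt0// ler_nat.
- by rewrite /occ ler_pM2r ?invr_gt0// ler_nat k0.
- by rewrite /occ /alpha_ k0.
Qed.

Lemma sum_Iplus J (G : coord m -> R) :
  (forall p, (J < p.2)%N -> G p = 0) ->
  \sum_(p \in @Iplus m) G p = \sum_(i < m.+1) \sum_(j < J) G (i, j.+1).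
Proof.
move=> G0; pose s := [seq (i, j) | i <- enum 'I_m.+1, j <- iota 1 J] : seq (coord m).
have us : uniq s.
  by apply: allpairs_uniq; [exact: enum_uniq|exact: iota_uniq|move=> [i j] [i' j'] _ _].
rewrite -(@fsbig_widen _ _ _ _ [set` s]); last 2 first.
- by move=> p /= /allpairsP[[i j]] [_]; rewrite mem_iota => /andP[j1 _] ->.
- move=> [i j] [/= j1]; rewrite /Iplus/= => /negP ns; apply: G0; rewrite ltnNge.
  apply: contra ns => jJ; apply/allpairsP; exists (i, j); split => //.
    by rewrite mem_enum.
  by rewrite mem_iota add1n ltnS j1.
rewrite -fsbig_seq// big_allpairs big_enum; apply: eq_bigr => i _.
rewrite -(big_mkord xpredT (fun j => G (i, j.+1))) /index_iota subn0.
by rewrite (iotaDl 1 0) big_map.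
Qed.

Definition add_task k p : 'I_m.+1 -> nat -> nat := fun i j => (k i j + ((i, j) == p))%N.
Definition remove_task k p : 'I_m.+1 -> nat -> nat := fun i j => (k i j - ((i, j) == p))%N.

Lemma shift_add_task k p : shift (occ k) p n%:R^-1 = occ (add_task k p).
Proof.
apply/funext => i; apply/funext => j; rewrite /shift /occ /add_task.
by case: eqP => _; rewrite ?addn0// natrD mulrDl mul1r.
Qed.

Lemma shift_remove_task k p : (0 < k p.1 p.2)%N -> shift (occ k) p (- n%:R^-1) = occ (remove_task k p).
Proof.
move=> kp; apply/funext => i; apply/funext => j; rewrite /shift /occ /remove_task.
case: eqP => [pE|_]; rewrite ?subn0// natrB; first by rewrite mulrBl mul1r.
by move: kp; rewrite -pE.
Qed.

Lemma remove_taskK k p : (0 < k p.1 p.2)%N -> add_task (remove_task k p) p = k.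
Proof.
move=> kp; apply/funext => i; apply/funext => j; rewrite /add_task /remove_task.
by case: eqP => [pE|_]; rewrite ?subn0 ?addn0// subnK//; move: kp; rewrite -pE.
Qed.

Lemma profile_add_task k J i j : profile k J -> (k i j.+1 < k i j)%N ->
  profile (add_task k (i, j.+1)) (maxn J j.+2).
Proof.
move=> [k_anti k0 kJ] kij; split => [i' j'|i'|i' j'].
- rewrite /add_task; case: (_ =P (i, j.+1)) => [[-> ->]|_].
    by case: eqP => [[/eqP]|_]; rewrite ?addn0 ?addn1// eqn_leq ltnn andbF.
  by rewrite addn0 (leq_trans (k_anti i' j'))// leq_addr.
- by rewrite /add_task xpair_eqE andbF addn0.
- rewrite geq_max => /andP[/kJ k0' jj']; rewrite /add_task k0' add0n.
  by case: eqP => // -[_ jE]; move: jj'; rewrite jE ltnn.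
Qed.

Lemma profile_remove_task k J i j : profile k J -> (k i j.+2 < k i j.+1)%N ->
  profile (remove_task k (i, j.+1)) J.
Proof.
move=> [k_anti k0 kJ] kij; split => [i' j'|i'|i' j'].
- rewrite /remove_task; case: (_ =P (i, j.+1)) => [[-> ->]|_].
    by rewrite xpair_eqE (ltn_eqF (ltnSn j)) andbF subn0 (leq_trans (leq_subr _ _)).
  rewrite subn0; case: eqP => [[-> ->]|_]; last by rewrite subn0.
  by rewrite subn1 -ltnS prednK// (leq_ltn_trans _ kij).
- by rewrite /remove_task xpair_eqE andbF subn0.
- by move=> /kJ; rewrite /remove_task => ->; rewrite sub0n.
Qed.

Lemma occ_add_task_neq k p : occ (add_task k p) <> occ k.
Proof.
move=> /occ_inj /(congr1 (fun k => k p.1 p.2)); rewrite /add_task -surjective_pairing eqxx.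
by move=> /eqP; rewrite addn1 eqn_leq ltnn.
Qed.

Lemma occ_remove_task_neq k p : (0 < k p.1 p.2)%N -> occ (remove_task k p) <> occ k.
Proof.
move=> kp /occ_inj /(congr1 (fun k => k p.1 p.2)); rewrite /remove_task -surjective_pairing eqxx.
by move=> /eqP; rewrite subn1 eqn_leq -{3}(prednK kp) ltnn andbF.
Qed.

Lemma profileW k J J' : (J <= J')%N -> profile k J -> profile k J'.
Proof. by move=> JJ' [k_anti k0 kJ]; split => // i j /(leq_trans JJ'); exact: kJ. Qed.

(** A pool with [l] tasks is counted at the levels 1 to [l]. The cutoff [J] is an arbitrary choice;
    [ntasksE] shows that every valid one gives the same sum. *)
Definition ntasks q : nat :=
  let J := xget 0%N [set J | exists2 k, q = occ k & profile k J] in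
  \sum_(i < m.+1) \sum_(j < J) Num.truncn (n%:R * q i j.+1).

Let tail_sum k J J' i : (J <= J')%N -> profile k J ->
  (\sum_(j < J') k i j.+1 = \sum_(j < J) k i j.+1)%N.
Proof.
move=> JJ' [_ _ kJ]; rewrite [RHS](big_ord_widen J' (fun j => k i j.+1))// [RHS]big_mkcond/=.
by apply: eq_bigr => j _; case: ltnP => // Jj; rewrite kJ// leqW.
Qed.

Lemma ntasksE k J : profile k J ->
  ntasks (occ k) = (\sum_(i < m.+1) \sum_(j < J) k i j.+1)%N.
Proof.
move=> kJ; rewrite /ntasks; case: xgetP => [J' _ [k' /occ_inj <- kJ']|/(_ J)[]]; last by exists k.
have trE i j : Num.truncn (n%:R * occ k i j) = k i j.
  by rewrite /occ mulrC divfK// natrK.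
apply: eq_bigr => i _; under eq_bigr do rewrite trE.
by have [JJ'|/ltnW JJ'] := leqP J J'; [|symmetry]; exact: tail_sum.
Qed.

Lemma ntasks_add_task k J p : profile k J -> profile (add_task k p) J -> Iplus p ->
  ntasks (occ (add_task k p)) = (ntasks (occ k)).+1.
Proof.
case: p => i [|j]//= kJ bJ _; rewrite !(ntasksE kJ) (ntasksE bJ).
have jJ : (j < J)%N.
  rewrite ltnNge; apply/negP => Jj; have [_ _ /(_ i j.+1 (leqW Jj))] := bJ.
  by rewrite /add_task eqxx addn1.
rewrite (bigD1 i)//= [in RHS](bigD1 i)//= -addSn; congr (_ + _)%N.
  rewrite (bigD1 (Ordinal jJ))//= [in RHS](bigD1 (Ordinal jJ))//= -addSn; congr (_ + _)%N.
    by rewrite /add_task eqxx addn1.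
  apply: eq_bigr => j' jj'; rewrite /add_task; case: eqP => [[jE]|]; rewrite ?addn0//.
  by case/eqP: jj'; apply/val_inj.
apply: eq_bigr => i' ii'; apply: eq_bigr => j' _; rewrite /add_task.
by case: eqP => [[iE]|]; rewrite ?addn0//; move: ii'; rewrite iE eqxx.
Qed.

Lemma ntasks0 k J : profile k J -> ntasks (occ k) = 0%N -> occ k = empty_state R n A.
Proof.
move=> kJ; have [k_anti k0 kJ'] := kJ.
rewrite (ntasksE kJ) => /eqP; rewrite sum_nat_eq0 => /forallP z.
apply/funext => i; apply/funext => -[|j]; rewrite /occ /empty_state/=; first by rewrite k0.
have [jJ|Jj] := ltnP j J; last by rewrite kJ' ?mul0r// leqW.
have := z i; rewrite sum_nat_eq0 => /forallP/(_ (Ordinal jJ))/=/eqP->.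
by rewrite mul0r.
Qed.

Lemma profile_empty : profile (fun i j => if j == 0%N then A i else 0%N) 1.
Proof. by split => [i j|i|i [|j]]. Qed.

Lemma empty_occ : empty_state R n A = occ (fun i j => if j == 0%N then A i else 0%N).
Proof.
by apply/funext => i; apply/funext => j; rewrite /empty_state /occ; case: ifP; rewrite ?mul0r.
Qed.

Definition prof_of q : 'I_m.+1 -> nat -> nat := fun i j => Num.truncn (n%:R * q i j).

Definition height q : nat := xget 0%N [set J | profile (prof_of q) J].

Lemma prof_ofK k : prof_of (occ k) = k.
Proof.
apply/funext => i; apply/funext => j.
by rewrite /prof_of /occ mulrC divfK// natrK.
Qed.

Lemma Qn_prof q : Qn n A q -> q = occ (prof_of q) /\ profile (prof_of q) (height q).
Proof.
move=> /QnP[k [J [-> kJ]]]; rewrite /height prof_ofK; split => //.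
by case: xgetP => [//|/(_ J)].
Qed.

Variable mu : R.
Hypothesis mu_gt0 : 0 < mu.

(** Levels with no pool to depart from are filtered out since [foster_criterion] takes events of
    positive rate; their rate is 0, so sums over events are unchanged. *)
Definition departures k (J : nat) : seq (occupancy R m * R) :=
  [seq (occ (remove_task k p), mu * p.2%:R * (k p.1 p.2 - k p.1 p.2.+1)%:R)
  | p <- [seq (i, j.+1) | i <- enum 'I_m.+1, j <- iota 0 J]
  & (k p.1 p.2.+1 < k p.1 p.2)%N].

Lemma sum_departures k J (g : occupancy R m -> R) : profile k J ->
  \sum_(e <- departures k J) g e.1 * e.2 =
  \sum_(i < m.+1) \sum_(j < J) g (shift (occ k) (i, j.+1) (- n%:R^-1)) *
    (n%:R * mu * j.+1%:R * (occ k i j.+1 - occ k i j.+2)).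
Proof.
move=> [k_anti k0 kJ]; rewrite big_map big_filter big_mkcond big_allpairs_dep/= big_enum.
apply: eq_bigr => i _; rewrite -[RHS](big_mkord xpredT (fun j => g (shift (occ k) (i, j.+1) _) *
    (n%:R * mu * j.+1%:R * (occ k i j.+1 - occ k i j.+2)))) /index_iota subn0.
apply: eq_bigr => j _; rewrite /occ -mulrBl -natrB ?k_anti//.
case: ifPn => [kij|]; last first.
  rewrite -leqNgt => kij; have /eqP-> : (k i j.+1 - k i j.+2 == 0)%N by rewrite subn_eq0.
  by rewrite mul0r !mulr0.
rewrite /= shift_remove_task; last exact: leq_ltn_trans kij.
by congr (_ * _); field.
Qed.

Lemma departure_rateE k J q : profile k J ->
  departure_rate mu n (occ k) q = \sum_(e <- departures k J) (q == e.1)%:R * e.2.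
Proof.
move=> kJ; rewrite (sum_departures (fun q' => (q == q')%:R) kJ) /departure_rate.
apply: (@sum_Iplus J (fun p => _)) => -[i j] /= Jj; have [_ _ k0] := kJ.
by rewrite /occ k0 ?k0 ?subrr ?mulr0// ?leqW// ltnW.
Qed.

Lemma departures_mass k J : profile k J ->
  \sum_(e <- departures k J) e.2 = mu * (ntasks (occ k))%:R.
Proof.
move=> kJ; have [k_anti _ k0] := kJ.
have := sum_departures (fun=> 1) kJ; under eq_bigr do rewrite mul1r.
move=> ->; rewrite (ntasksE kJ) natr_sum mulr_sumr; apply: eq_bigr => i _.
(* Summation by parts; the boundary term vanishes above the height. *)
have abel M : \sum_(j < M) n%:R * mu * j.+1%:R * (occ k i j.+1 - occ k i j.+2) =
    mu * ((\sum_(j < M) k i j.+1)%:R - M%:R * (k i M.+1)%:R).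
  elim: M => [|M IHM]; first by rewrite !big_ord0 mul0r subr0 mulr0.
  rewrite !big_ord_recr/= IHM natrD -natr1 /occ; field.
  exact: nR0.
under eq_bigr do rewrite mul1r.
by rewrite abel k0 ?mulr0 ?subr0.
Qed.

Lemma departuresP k J e : profile k J -> e \in departures k J ->
  exists k', [/\ e.1 = occ k', profile k' J, (ntasks (occ k')).+1 = ntasks (occ k),
    0 < e.2 & e.1 <> occ k].
Proof.
move=> kJ /mapP[[i j]]; rewrite mem_filter => /andP[/= kij /allpairsP[[i' j']]].
move=> [_ _ [iE jE]] ->; move: kij; rewrite {}iE {}jE {i j}/= => kij.
have kp : (0 < k i' j'.+1)%N by exact: leq_ltn_trans kij.
have dJ := profile_remove_task kJ kij.
exists (remove_task k (i', j'.+1)); split => //=.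
- by rewrite -(@ntasks_add_task (remove_task k (i', j'.+1)) J (i', j'.+1)) ?remove_taskK.
- by rewrite !mulr_gt0// ltr0n subn_gt0.
- exact: occ_remove_task_neq.
Qed.

Lemma departures_neq_nil k J : profile k J -> (0 < ntasks (occ k))%N ->
  exists e, e \in departures k J.
Proof.
move=> kJ; have [k_anti k0 kJ0] := kJ; rewrite (ntasksE kJ).
rewrite lt0n sum_nat_eq0 negb_forall => /existsP[i]; rewrite implyTb sum_nat_eq0.
rewrite negb_forall => /existsP[j0]; rewrite implyTb -lt0n => kij.
have ex : exists j, (k i j.+2 < k i j.+1)%N.
  apply: contrapT => /forallNP nex.
  have : (k i j0.+1 <= k i (j0 + J).+1)%N.
    elim: J {kJ kJ0 j0 kij} (j0 : nat) => [|J IHJ] j; first by rewrite addn0.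
    apply: leq_trans (IHJ j) _; rewrite addnS leqNgt; apply/negP; exact: nex.
  rewrite (kJ0 i (j0 + J).+1); last by rewrite leqW// leq_addl.
  by rewrite leqNgt kij.
have [j kj] := ex; exists (occ (remove_task k (i, j.+1)), mu * j.+1%:R * (k i j.+1 - k i j.+2)%:R).
apply/mapP; exists (i, j.+1) => //; rewrite mem_filter/= kj.
apply/allpairsP; exists (i, j); split; rewrite ?mem_enum//= mem_iota add0n ltnNge.
by apply/negP => Jj; move: kj; rewrite (kJ0 i j.+1) ?leqW.
Qed.

Lemma departures_drift k J (V : occupancy R m -> R) (F : nat -> R) : profile k J ->
  (forall k', profile k' J -> V (occ k') = F (ntasks (occ k'))) ->
  \sum_(e <- departures k J) e.2 * (V e.1 - V (occ k)) =
  mu * (ntasks (occ k))%:R * (F (ntasks (occ k)).-1 - F (ntasks (occ k))).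
Proof.
move=> kJ VF; rewrite -(departures_mass kJ) mulr_suml big_seq [RHS]big_seq.
apply: eq_bigr => e /(departuresP kJ)[k' [-> k'J tasks _ _]].
by rewrite !VF// -tasks.
Qed.

End Occupancy.

(** * The two policies *)

Section RankingOrder.
Variables (R : realType) (m : nat) (u : 'I_m.+1 -> R -> R).
Hypothesis u_concave : forall i,
  convex_function (`[0, +oo[%classic : set R) (fun x => - u i x).
Implicit Types (p : coord m) (B : set (coord m)).

(** Midpoint concavity at [l], [l.+1], [l.+2], iterated. *)
Lemma Delta_anti i j j' : (j <= j')%N -> Delta u i j' <= Delta u i j.
Proof.
move=> /subnK <-; elim: (j' - j)%N => [|d]; first by rewrite add0n.
rewrite addSn; apply: le_trans; set l := (d + j)%N.
have in0 (h : nat) : (h%:R : R) \in (`[0, +oo[%classic : set R).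
  by rewrite inE/= in_itv/= andbT.
have h0 : 0 <= 2^-1 :> R by rewrite invr_ge0.
have h1 : 2^-1 <= 1 :> R by rewrite invf_le1// ler1n.
have := u_concave i (Itv01 h0 h1) (in0 l) (in0 l.+2).
rewrite convRE /conv/= /unstable.onem.
have -> : 2^-1 *: (l%:R : R^o) + (1 - 2^-1) *: (l.+2%:R : R^o) = l.+1%:R :> R.
  by rewrite -[l.+2%:R]natr1 -[l.+1%:R]natr1 /GRing.scale/=; field.
rewrite /Delta; lra.
Qed.

Lemma lex_lt_irr p : lex_lt p p = false.
Proof. by rewrite /lex_lt !ltnn andbF. Qed.

Lemma lex_lt_trans p2 p1 p3 : lex_lt p1 p2 -> lex_lt p2 p3 -> lex_lt p1 p3.
Proof.
rewrite /lex_lt => /orP[l1|/andP[/eqP-> l1]] /orP[l2|/andP[/eqP<- l2]].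
- by rewrite (ltn_trans l1 l2).
- by rewrite l1.
- by rewrite l2.
- by rewrite eqxx (ltn_trans l1 l2) orbT.
Qed.

Lemma lex_lt_total p p' : [|| p == p', lex_lt p p' | lex_lt p' p].
Proof.
case: p p' => i j [i' j']; rewrite /lex_lt/= xpair_eqE.
case: (ltngtP i i') => [||/val_inj->]; rewrite ?orbT// !eqxx.
by case: (ltngtP j j') => //; rewrite ?orbT.
Qed.

Lemma rank_lt_irr p : rank_lt u p p = false.
Proof. by rewrite /rank_lt ltxx lex_lt_irr andbF. Qed.

Lemma rank_lt_trans p2 p1 p3 : rank_lt u p1 p2 -> rank_lt u p2 p3 -> rank_lt u p1 p3.
Proof.
rewrite /rank_lt => /orP[l1|/andP[/eqP-> l1]] /orP[l2|/andP[/eqP<- l2]].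
- by rewrite (lt_trans l1 l2).
- by rewrite l1.
- by rewrite l2.
- by rewrite eqxx (lex_lt_trans l2 l1) orbT.
Qed.

Lemma rank_lt_total p p' : [|| p == p', rank_lt u p p' | rank_lt u p' p].
Proof.
have := lex_lt_total p p'; rewrite /rank_lt.
by case: ltgtP => //=; rewrite ?orbT//; case: (p == p') => //=; rewrite orbC.
Qed.

Lemma rank_le_refl p : rank_le u p p. Proof. by rewrite /rank_le eqxx. Qed.

Lemma rank_le_trans p2 p1 p3 : rank_le u p1 p2 -> rank_le u p2 p3 -> rank_le u p1 p3.
Proof.
rewrite /rank_le => /predU1P[->//|l1] /predU1P[<-|l2]; first by rewrite l1 orbT.
by rewrite (rank_lt_trans l1 l2) orbT.
Qed.

Lemma rank_leNgt p p' : rank_le u p p' = ~~ rank_lt u p' p.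
Proof.
rewrite /rank_le; have := rank_lt_total p p'.
have [->|pp'] := eqVneq p p'; first by rewrite rank_lt_irr.
move=> /= /orP[l|l].
  by rewrite l; apply/esym/negP => /(rank_lt_trans l); rewrite rank_lt_irr.
by rewrite l; apply/negbTE/negP => /(rank_lt_trans l); rewrite rank_lt_irr.
Qed.

Let seq_max (s : seq (coord m)) : s != [::] ->
  exists2 p, p \in s & forall p', p' \in s -> rank_le u p' p.
Proof.
elim: s => // p s IHs _; have [->|/IHs[p1 p1s p1max]] := eqVneq s [::].
  by exists p; rewrite ?mem_head// => p'; rewrite inE => /eqP->; exact: rank_le_refl.
have [pp1|p1p] := boolP (rank_le u p p1).
  by exists p1; rewrite ?inE ?p1s ?orbT// => p' /predU1P[->//|/p1max].
exists p; rewrite ?mem_head// => p' /predU1P[->|/p1max p'p1]; first exact: rank_le_refl.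
apply: rank_le_trans p'p1 _; move: p1p; rewrite !rank_leNgt => /negPn pp1.
by apply/negP => /(rank_lt_trans pp1); rewrite rank_lt_irr.
Qed.

Lemma rank_le_same_class i j j' : (j <= j')%N -> rank_le u (i, j') (i, j).
Proof.
rewrite leq_eqVlt => /predU1P[->|jj']; first exact: rank_le_refl.
have le_pred : (j.-1 <= j'.-1)%N by case: j j' jj' => [|j] [|j']//= /ltnW.
have := Delta_anti i le_pred.
rewrite le_eqVlt /rank_le /rank_lt /lex_lt/= eqxx jj' orbT andbT.
by move=> /orP[->|->]; rewrite ?orbT.
Qed.

(** Within a class the smallest level ranks highest, by concavity and, for ties, by the reversed
    lexicographic order. So the maximum is among the first elements of the classes, which are
    finitely many. *)
Lemma rank_maxP B : B `<=` @Iplus m -> B !=set0 ->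
  B (rank_max u B) /\ forall p, B p -> rank_le u p (rank_max u B).
Proof.
move=> BI B0.
suff [p Bp pmax] : exists2 p, B p & forall p', B p' -> rank_le u p' p.
  rewrite /rank_max; case: xgetP => [p' _ []//|/(_ p)[]]; split => //.
pose c i := xget 0%N [set j | B (i, j) /\ forall j', B (i, j') -> (j <= j')%N].
have cP i j : B (i, j) -> B (i, c i) /\ (c i <= j)%N.
  move=> Bp; have ex : exists j, `[< B (i, j) >] by exists j; apply/asboolP.
  case: (ex_minnP ex) => j0 /asboolP Bj0 j0min; rewrite /c.
  case: xgetP => [j1 _ [Bj1 j1min]|/(_ j0)[]]; first by split => //; exact: j1min.
  by split => // j' Bj'; apply: j0min; apply/asboolP.
pose s := [seq (i, c i) | i <- enum 'I_m.+1 & `[< B (i, c i) >]] : seq (coord m).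
have sB p : p \in s -> B p by move=> /mapP[i]; rewrite mem_filter => /andP[/asboolP ? _] ->.
have s_in i j : B (i, j) -> (i, c i) \in s.
  move=> /cP[Bc _]; apply/mapP; exists i => //.
  by rewrite mem_filter mem_enum andbT; apply/asboolP.
have [p ps pmax] : exists2 p, p \in s & forall p', p' \in s -> rank_le u p' p.
  apply: seq_max; have [[i j] /s_in] := B0.
  by case: s sB s_in.
exists p; first exact: sB.
move=> [i j] Bp; apply: rank_le_trans (pmax _ (s_in _ _ Bp)).
by apply: rank_le_same_class; have [] := cP _ _ Bp.
Qed.

End RankingOrder.

Lemma event_rate_gt0 (R : realType) (T : choiceType) (L : seq (T * R)) e :
  (forall e', e' \in L -> 0 < e'.2) -> e \in L ->
  0 < \sum_(e' <- L) (e.1 == e'.1)%:R * e'.2.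
Proof.
move=> L0 eL; rewrite (perm_big _ (perm_to_rem eL)) big_cons eqxx mul1r ltr_pwDl ?L0//.
by rewrite big_seq sumr_ge0// => e' /mem_rem e'L; rewrite mulr_ge0// ltW ?L0.
Qed.

(** * The chain under JLMU *)

Section JLMU.
Variables (R : realType) (m : nat) (u : 'I_m.+1 -> R -> R).
Hypothesis u_concave : forall i,
  convex_function (`[0, +oo[%classic : set R) (fun x => - u i x).
Variables (la mu : R) (n : nat) (A : 'I_m.+1 -> nat).
Hypotheses (la_gt0 : 0 < la) (mu_gt0 : 0 < mu) (n_gt0 : (0 < n)%N)
  (sumA : (\sum_(i < m.+1) A i)%N = n).

Local Notation S := (jlmu_states u la mu n A).
Local Notation rate := (jlmu_rate u la mu n).

Let jlmu_events (q : occupancy R m) : seq (occupancy R m * R) :=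
  departures n mu (prof_of n q) (height n A q) ++
  [:: (shift q (sigma u q) n%:R^-1, n%:R * la)].

(** Some class has a pool because the [A i] add up to [n > 0], and its levels fall from [A i] to 0;
    hence [sigma] is a true maximum and not the default value. *)
Let sigmaP k J : profile A k J -> exists i j,
  sigma u (occ R n k) = (i, j.+1) /\ (k i j.+1 < k i j)%N.
Proof.
move=> [k_anti k0 kJ]; have nR : 0 < n%:R :> R by rewrite ltr0n.
have [||] := @rank_maxP R m u u_concave
    [set p | Iplus p /\ occ R n k p.1 p.2 < occ R n k p.1 p.2.-1].
- by move=> p [].
- have [i Ai] : exists i, (0 < A i)%N.
    apply: contrapT => /forallNP nA; move: n_gt0; rewrite -sumA big1// => i _.
    by apply/eqP; rewrite -leqn0 leqNgt; apply/negP/nA.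
  have [j kj] : exists j, (k i j.+1 < k i j)%N.
    apply: contrapT => /forallNP nk.
    have : (A i <= k i J)%N.
      elim: (J) => [|j IHj]; first by rewrite k0.
      by apply: leq_trans IHj _; rewrite leqNgt; apply/negP/nk.
    by rewrite kJ// leqNgt Ai.
  by exists (i, j.+1); split => //=; rewrite /occ ltr_pM2r ?invr_gt0// ltr_nat.
rewrite -/(sigma u (occ R n k)); case: sigma => i [|j] [] //= _.
rewrite /occ ltr_pM2r ?invr_gt0// ltr_nat => kj _.
by exists i, j.
Qed.

Let jlmu_rateE q q' : S q -> rate q q' = \sum_(e <- jlmu_events q) (q' == e.1)%:R * e.2.
Proof.
move=> [/(Qn_prof n_gt0)[qE pq] _]; rewrite big_cat big_seq1 /jlmu_rate /=; congr (_ + _).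
by rewrite {1}qE (departure_rateE n_gt0 mu q' pq).
Qed.

Let jlmu_event q e : Qn n A q -> e \in jlmu_events q ->
  [/\ 0 < e.2, Qn n A e.1 & e.1 <> q].
Proof.
move=> /(Qn_prof n_gt0); set k := prof_of n q; set J := height n A q => -[qE kJ].
rewrite mem_cat inE => /orP[/(departuresP n_gt0 mu_gt0 kJ)[k' [-> k'J _ e0 ne]]|/eqP->/=].
  by split => //; [apply/QnP => //; exists k', J|rewrite qE].
have [i [j []]] := sigmaP kJ; rewrite -qE => -> kj; rewrite qE shift_add_task; split.
- by rewrite mulr_gt0// ltr0n.
- by apply/QnP => //; exists (add_task k (i, j.+1)), (maxn J j.+2); split => //; exact: profile_add_task.
- exact: occ_add_task_neq.
Qed.

Let jlmu_step q e : S q -> e \in jlmu_events q -> S e.1 /\ 0 < rate q e.1.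
Proof.
move=> Sq eL; have [Qq reach_q] := Sq; have [e0 Qe _] := jlmu_event Qq eL.
have rate_gt0 : 0 < rate q e.1.
  by rewrite jlmu_rateE//; apply: event_rate_gt0 => // e' /(jlmu_event Qq)[].
by split => //; split => //; apply: rt_trans reach_q _; exact: rt_step.
Qed.

Let jlmu_empty : S (empty_state R n A).
Proof.
split; last exact: rt_refl.
by apply/QnP => //; do 2!eexists; split; [exact: empty_occ|exact: profile_empty].
Qed.

Let jlmu_to_empty q : S q -> reachable_from rate q (empty_state R n A).
Proof.
have [N] := ubnP (ntasks n A q); elim: N q => // N IHN q; rewrite ltnS => qN Sq.
have [/(Qn_prof n_gt0)[qE kJ] _] := Sq; rewrite {1}qE in qN.
have [N0|/(departures_neq_nil n_gt0 mu kJ)[e eL]] := posnP (ntasks n A (occ R n (prof_of n q))).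
  by rewrite qE (ntasks0 n_gt0 kJ N0); exact: rt_refl.
have eL' : e \in jlmu_events q by rewrite mem_cat eL.
have [Se qe] := jlmu_step Sq eL'.
apply: rt_trans (rt_step _ _ _ _ qe) (IHN _ _ Se).
have [k' [-> _ tasks _ _]] := departuresP n_gt0 mu_gt0 kJ eL.
by rewrite -ltnS tasks ltnS.
Qed.

Lemma jlmu_chain (X : ctmc S rate) :
  [/\ irreducible X, positive_recurrent X & exists! pi, stationary X pi].
Proof.
have nla_gt0 : 0 < n%:R * la by rewrite mulr_gt0// ltr0n.
have [F [eps [eps_gt0 F_ge0 drift]]] := drift_function nla_gt0 mu_gt0.
have mass q : S q -> \sum_(e <- jlmu_events q) e.2 = mu * (ntasks n A q)%:R + n%:R * la.
  move=> [/(Qn_prof n_gt0)[qE kJ] _].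
  by rewrite big_cat big_seq1/= (departures_mass n_gt0 mu kJ) -qE.
(* JLMU has no threshold: the index of the drift function is frozen at 1. Arrivals alone bound the
   exit rates below by [n%:R * la]. *)
apply: (@foster_criterion R _ S rate jlmu_events _ _ (n%:R * la) nla_gt0 _
  (empty_state R n A) jlmu_empty _ _ (fun q => F (ntasks n A q) 1%N) eps _ eps_gt0).
- by move=> q q' Sq; exact: jlmu_rateE.
- move=> q e Sq eL; have [Qq _] := Sq; have [e0 _ ne] := jlmu_event Qq eL.
  by have [] := jlmu_step Sq eL.
- by move=> q Sq; rewrite mass// lerDr mulr_ge0// ltW.
- by move=> q [].
- exact: jlmu_to_empty.
- by move=> q _; exact: F_ge0.
move=> q Sq q0; rewrite mass//; have [/(Qn_prof n_gt0)[qE kJ] _] := Sq.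
have deps := departures_drift n_gt0 mu_gt0 kJ (V := fun q => F (ntasks n A q) 1%N)
  (F := fun N => F N 1%N) (fun _ _ => erefl).
rewrite -qE in deps; rewrite big_cat big_seq1/= deps.
have [i [j []]] := sigmaP kJ; rewrite -qE => -> kj.
have := profileW (leq_maxl (height n A q) j.+2) kJ; set J := maxn _ _ => kJ'.
have := profile_add_task kJ kj; rewrite -/J => bJ.
have -> : shift q (i, j.+1) n%:R^-1 = occ R n (add_task (prof_of n q) (i, j.+1)).
  by rewrite {1}qE shift_add_task.
rewrite (ntasks_add_task R n_gt0 kJ' bJ)// -qE.
(* The requirement at [N = 0] is met vacuously, as no task means the excluded empty state. *)
apply: drift => // N0; case: q0; rewrite qE; apply: (ntasks0 n_gt0 kJ).
by rewrite -qE.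
Qed.

End JLMU.

From mathcomp Require Import finmap.

(** * The ranked coordinates and the levels [ell] *)

Section RankedElements.
Variables (R : realType) (m : nat) (u : 'I_m.+1 -> R -> R).
Hypothesis u_concave : forall i,
  convex_function (`[0, +oo[%classic : set R) (fun x => - u i x).
Implicit Types p : coord m.

Let above p := [set p' : coord m | Iplus p' /\ rank_lt u p p'].

(** The next element is the maximum of what remains after removing [p] and the finite set above it;
    something remains because a single class has infinitely many levels. *)
Let ranked_exists k : exists p (F : {fset coord m}),
  [/\ Iplus p, above p = [set` F] & #|` F| = k].
Proof.
elim: k => [|k [p [F [Ip FE Fk]]]].
  have [|] := @rank_maxP R m u u_concave (@Iplus m) (fun _ => id).
    by exists (ord0, 1%N).
  set p := rank_max u _ => Ip pmax; exists p, fset0; split => //.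
  apply/seteqP; split => // p' [/pmax]; rewrite rank_leNgt.
  by move=> /negP.
have [||] := @rank_maxP R m u u_concave
    [set p' | Iplus p' /\ p' \notin (p |` F)%fset].
- by move=> p' [].
- apply: contrapT => /forallNP nex.
  have : (size [seq (ord0 : 'I_m.+1, j) | j <- iota 1 #|` F|.+2] <= #|` (p |` F)%fset|)%N.
    apply: uniq_leq_size.
      by rewrite map_inj_uniq ?iota_uniq// => j j' [].
    move=> p' /mapP[j]; rewrite mem_iota => /andP[j1 _] ->.
    by apply: contrapT => /negP nF; apply: (nex (ord0, j)).
  rewrite size_map size_iota cardfsU1 leqNgt => /negP; apply.
  by rewrite ltnS (leq_add (leq_b1 _)).
set p' := rank_max u _ => -[Ip' /=]; rewrite !inE negb_or => /andP[p'p p'F] p'max.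
have pp' : rank_lt u p' p.
  have := rank_lt_total u p p'; rewrite eq_sym (negbTE p'p)/= => /orP[l|//].
  by have : above p p' by []; rewrite FE /= (negbTE p'F).
have pF : p \notin F.
  by apply/negP => pF; have : [set` F] p by []; rewrite -FE => -[_]; rewrite rank_lt_irr.
exists p', (p |` F)%fset; split => //; last by rewrite cardfsU1 pF Fk.
apply/seteqP; split => [p1 [Ip1 l]|p1 /=].
  apply: contrapT => /negP nF; have := p'max p1 (conj Ip1 nF).
  by rewrite rank_leNgt l.
rewrite !inE => /predU1P[->|p1F]; first by split.
have : [set` F] p1 by []; rewrite -FE => -[Ip1 l]; split => //.
exact: rank_lt_trans l.
Qed.

Let rankedP r : exists F : {fset coord m},
  [/\ Iplus (ranked u r), above (ranked u r) = [set` F] & #|` F| = r.-1].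
Proof.
rewrite /ranked; case: xgetP => [p _ [Ip cp]|no].
  exists (fset_set (above p)); split => //; last exact: card_fset_set.
  by rewrite fset_setK//; apply/finite_setP; exists r.-1.
have [p [F [Ip FE Fr]]] := ranked_exists r.-1.
by case: (no p); split => //; have := introT card_eq_fsetP Fr; rewrite -FE.
Qed.

Lemma ranked_Iplus r : Iplus (ranked u r).
Proof. by have [F []] := rankedP r. Qed.

(** Otherwise the [r'.-1] elements above the one would lie among the [r.-1] above the other. *)
Lemma ranked_anti r r' : (0 < r < r')%N -> rank_lt u (ranked u r') (ranked u r).
Proof.
move=> /andP[r0 rr']; apply: contraT; rewrite -rank_leNgt => le_r.
have [F [_ FE Fr]] := rankedP r; have [F' [_ FE' Fr']] := rankedP r'.
have : (#|` F'| <= #|` F|)%N.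
  apply: fsubset_leq_card; apply/fsubsetP => p pF'.
  have : [set` F'] p by []; rewrite -FE' => -[Ip l].
  have : above (ranked u r) p.
    split => //; move: le_r; rewrite /rank_le => /predU1P[->//|l'].
    exact: rank_lt_trans l' l.
  by rewrite FE.
by rewrite Fr Fr' leqNgt -ltnS !prednK// ?rr'// (ltn_trans r0).
Qed.

(** Only finitely many coordinates lie above [ranked u r], so the maximum defining [ell] exists. *)
Let ellP r i : (ell u r i = 0%N \/
    (Iplus (i, ell u r i) /\ rank_lt u (ranked u r) (i, ell u r i))) /\
  forall j, (0 < j)%N -> rank_lt u (ranked u r) (i, j) -> (j <= ell u r i)%N.
Proof.
have [F [_ FE _]] := rankedP r.
have ex : exists j, `[< j = 0%N \/ (Iplus (i, j) /\ rank_lt u (ranked u r) (i, j)) >].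
  by exists 0%N; apply/asboolP; left.
have ub j : `[< j = 0%N \/ (Iplus (i, j) /\ rank_lt u (ranked u r) (i, j)) >] ->
    (j <= \max_(p <- F) p.2)%N.
  move=> /asboolP[->//|ij]; have : above (ranked u r) (i, j) by [].
  by rewrite FE => ijF; exact: (@leq_bigmax_seq _ _ xpredT (fun p : coord m => p.2) (i, j) ijF isT).
case: (ex_maxnP ex ub) => j0 /asboolP j0P j0max; rewrite /ell.
case: xgetP => [j1 _ [j1P j1max]|/(_ j0)[]]; last first.
  by split => // j jP; apply: j0max; apply/asboolP.
by split => // j j0' l; apply: j1max; right.
Qed.

Lemma ell_ge r i j : (0 < j)%N -> rank_lt u (ranked u r) (i, j) -> (j <= ell u r i)%N.
Proof. by have [_] := ellP r i; exact. Qed.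

Lemma ell_ranked_gt0 r s : (0 < s < r)%N -> (0 < ell u r (ranked u s).1)%N.
Proof.
move=> /ranked_anti; have : (0 < (ranked u s).2)%N := ranked_Iplus s.
case: (ranked u s) => i j /= j0 l; exact: leq_trans (ell_ge j0 l).
Qed.

(** The [r.-1] coordinates above the [r]-th are among the pairs [(i, j)] with
    [1 <= j <= ell u r i]. *)
Lemma sum_ell_ge r : (r.-1 <= \sum_(i < m.+1) ell u r i)%N.
Proof.
have [F [_ FE <-]] := rankedP r.
pose s := [seq (i, j) | i <- enum 'I_m.+1, j <- iota 1 (ell u r i)] : seq (coord m).
suff : (#|` F| <= size s)%N.
  rewrite /s size_allpairs_dep sumnE big_map big_enum/=.
  by under eq_bigr do rewrite size_iota.
apply: uniq_leq_size => // -[i j] ijF.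
have : [set` F] (i, j) by []; rewrite -FE => -[j0 l].
apply/allpairsPdep; exists i, j; split; rewrite ?mem_enum// mem_iota add1n ltnS.
by rewrite ell_ge// andbT.
Qed.

End RankedElements.

(** * The chain under SLTA *)

Section SLTA.
Variables (R : realType) (m : nat) (u : 'I_m.+1 -> R -> R).
Hypothesis u_concave : forall i,
  convex_function (`[0, +oo[%classic : set R) (fun x => - u i x).
Variables (la mu : R) (n : nat) (A : 'I_m.+1 -> nat) (beta : R).
Hypotheses (la_gt0 : 0 < la) (mu_gt0 : 0 < mu) (n_gt0 : (0 < n)%N)
  (sumA : (\sum_(i < m.+1) A i)%N = n)
  (nondeg : slta_nondegenerate u n A beta).

Local Notation S := (slta_states u la mu n A beta).
Local Notation rate := (slta_rate u la mu n beta).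
Local Notation state k := (occ R n k).
Local Notation empty := (empty_state R n A).
Local Notation tasks := (ntasks n A).
Implicit Types (k : 'I_m.+1 -> nat -> nat) (q : occupancy R m).

Let nR_gt0 : 0 < n%:R :> R. Proof. by rewrite ltr0n. Qed.
Let A_gt0 i : (0 < A i)%N. Proof. by case: nondeg. Qed.

Let poolsE k J i l : profile A k J ->
  pools n (state k) i l = (k i l - k i l.+1)%:R.
Proof.
move=> [k_anti _ _]; rewrite /pools /occ natrB//; field.
by rewrite gt_eqF.
Qed.

Let pools_ge0 k J i l : profile A k J -> 0 <= pools n (state k) i l.
Proof. by move=> kJ; rewrite (poolsE _ _ kJ). Qed.

Let sum_pools k J i M : profile A k J ->
  \sum_(l < M) pools n (state k) i l = (A i - k i M)%:R.
Proof.
move=> kJ; have [k_anti k0 _] := kJ.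
have kA l : (k i l <= A i)%N by rewrite -k0; elim: l => // l; exact: leq_trans.
elim: M => [|M IHM]; first by rewrite big_ord0 k0 subnn.
by rewrite big_ord_recr/= IHM (poolsE _ _ kJ) -natrD addnBA// subnK.
Qed.

Let green_classE k J r i : profile A k J ->
  green_class u n (state k) r i = (A i - k i (ell u r i))%:R.
Proof. by move=> kJ; exact: sum_pools kJ. Qed.

Let green_class_ge0 k J r i : profile A k J -> 0 <= green_class u n (state k) r i.
Proof. by move=> kJ; rewrite (green_classE _ _ kJ). Qed.

(** Without green tokens every pool of class [i] has at least [ell u r i] tasks; one pool per class,
    which nondegeneracy provides, already gives [r.-1] tasks by [sum_ell_ge]. *)
Let green_le_tasks k J r : profile A k J -> green u n (state k) r = 0 ->
  (r <= (tasks (state k)).+1)%N.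
Proof.
move=> kJ g0; have [k_anti k0 kJ0] := kJ.
have full i : k i (ell u r i) = A i.
  have kA : (k i (ell u r i) <= A i)%N.
    by rewrite -k0; elim: (ell u r i) => // l; exact: leq_trans.
  have : green_class u n (state k) r i = 0.
    apply/eqP; move/eqP: g0; rewrite psumr_eq0; last first.
      by move=> i' _; exact: green_class_ge0 kJ.
    by move=> /allP/(_ i); rewrite mem_index_enum implyTb; exact.
  rewrite (green_classE _ _ kJ) => /eqP; rewrite pnatr_eq0 subn_eq0 => Ak.
  by apply/eqP; rewrite eqn_leq kA.
pose J' := maxn J (\max_i ell u r i)%N.
have kJ' := profileW (leq_maxl _ _ : (J <= J')%N) kJ.
suff : (\sum_(i < m.+1) ell u r i <= tasks (state k))%N.
  by move=> le; rewrite -ltnS; case: r (sum_ell_ge u_concave r) le {full g0 J' kJ'} => // r le1 /(leq_trans le1).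
rewrite (ntasksE R n_gt0 kJ'); apply: leq_sum => i _.
have ellJ : (ell u r i <= J')%N by rewrite leq_max leq_bigmax orbT.
rewrite -[leqLHS]card_ord -sum1_card (big_ord_widen J' (fun=> 1%N) ellJ) [leqLHS]big_mkcond/=.
apply: leq_sum => l _; case: ifP => // l_ell.
apply: leq_trans (_ : (A i <= k i l.+1)%N); first exact: A_gt0.
rewrite -full -(subnK l_ell); elim: (ell u r i - l.+1)%N => // d.
by rewrite addSn; apply: leq_trans.
Qed.

Let next_r_gt0 k r : (0 < r)%N -> (0 < next_r u n beta (state k) r)%N.
Proof.
move=> r0; rewrite /next_r; case: ifP => [/and3P[r1 _ _]|_]; last by case: ifP.
by rewrite -ltnS prednK.
Qed.

Let next_r_le k r : (next_r u n beta (state k) r <= r.+1)%N.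
Proof.
rewrite /next_r; case: ifP => _; last by case: ifP.
exact: leq_trans (leq_pred r) (leqnSn r).
Qed.

Let next_r_up k J r : profile A k J -> (0 < r)%N ->
  next_r u n beta (state k) r = r.+1 -> (r <= (tasks (state k)).+1)%N.
Proof.
move=> kJ r0; rewrite /next_r; case: ifP => _.
  by move=> /eqP; rewrite ltn_eqF// ltnS leq_pred.
case: ifP => [/andP[/eqP g0 _] _|_ /eqP]; first exact: green_le_tasks kJ g0.
by rewrite ltn_eqF.
Qed.

(** In the empty system all pools of a class with positive [ell] are green. For [r > 1] this covers
    the class of [ranked u 1], large enough to reach [n%:R * beta], and [prev_class u r], which must
    own a green token for [r] to decrease. *)
Let next_r_empty r : (1 < r)%N -> r = (next_r u n beta empty r).+1.
Proof.
move=> r1; have [_ beta_le] := nondeg; rewrite empty_occ.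
set k := fun i j => _; have kJ : profile A k 1 by exact: profile_empty.
have full i : (0 < ell u r i)%N -> green_class u n (state k) r i = (A i)%:R.
  by move=> e0; rewrite (green_classE _ _ kJ) /k gtn_eqF// subn0.
rewrite /next_r r1/=.
have -> : n%:R * beta <= green u n (state k) r.
  apply: (@le_trans _ _ (green_class u n (state k) r (ranked u 1).1)).
    rewrite full; last exact: (ell_ranked_gt0 u_concave).
    apply: (@le_trans _ _ (n%:R * alpha_ R n A (ranked u 1).1)); first by rewrite ler_pM2l.
    by rewrite /alpha_ mulrC divfK// gt_eqF.
  rewrite /green (bigD1 (ranked u 1).1)//= lerDl sumr_ge0// => i _.
  exact: green_class_ge0 kJ.
rewrite full ?ltr0n ?A_gt0/= ?prednK//; first exact: ltnW.
rewrite /prev_class; apply: (ell_ranked_gt0 u_concave).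
by case: (r) r1 => [|[|r']]//= _; rewrite ltnS.
Qed.

Let assign_ge0 k J r p : profile A k J -> 0 <= assign_prob u n (state k) r p.
Proof.
move=> kJ; have p0 := pools_ge0 p.1 p.2.-1 kJ; rewrite /assign_prob.
do ![case: ifP => // ?]; rewrite divr_ge0// ?ltW//.
Qed.

Let assign_gt0 k J r i j : profile A k J -> 0 < assign_prob u n (state k) r (i, j.+1) ->
  (k i j.+1 < k i j)%N.
Proof.
move=> kJ ap; rewrite ltnNge; apply/negP => kij; move: ap.
have p0 : pools n (state k) i j = 0.
  by rewrite (poolsE _ _ kJ); move: kij; rewrite -subn_eq0 => /eqP->.
by rewrite /assign_prob /= p0 !mul0r; do ![case: ifP => _]; rewrite ltxx.
Qed.

Let assign_far k J r p : profile A k J -> (J < p.2)%N ->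
  assign_prob u n (state k) r p = 0.
Proof.
move=> kJ; have [_ _ k0] := kJ; case: p => i [|j]//= Jj.
have p0 : pools n (state k) i j = 0 by rewrite (poolsE _ _ kJ) !k0// leqW.
by rewrite /assign_prob /= p0 !mul0r; do ![case: ifP => _].
Qed.

(** Each branch divides by the total of its own tokens; in the second one [green_other] vanishes, so
    [green] is the count of [prev_class u r] alone. *)
Let assign_sum k J r : profile A k J ->
  (forall i, (ell u r i < J)%N) ->
  \sum_(i < m.+1) \sum_(j < J) assign_prob u n (state k) r (i, j.+1) = 1.
Proof.
move=> kJ ellJ; rewrite /assign_prob/=.
have restrict (a : 'I_m.+1 -> nat) (Q : pred 'I_m.+1) D : (forall i, (a i <= J)%N) ->
    \sum_(i < m.+1) \sum_(j < J)
      (if (j < a i)%N && Q i then pools n (state k) i j / D else 0) =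
    (\sum_(i < m.+1 | Q i) \sum_(j < a i) pools n (state k) i j) / D.
  move=> aJ; rewrite mulr_suml [RHS]big_mkcond; apply: eq_bigr => i _.
  case: ifP => Qi; last by rewrite big1// => j _; rewrite andbF.
  rewrite (big_ord_widen J (fun j => pools n (state k) i j) (aJ i)) mulr_suml [RHS]big_mkcond/=.
  by apply: eq_bigr => j _; rewrite andbT; case: ifP => // _; rewrite mul0r.
have gc0 i : 0 <= green_class u n (state k) r i by exact: green_class_ge0 kJ.
have [go|go] := ltP 0 (green_other u n (state k) r).
  rewrite (restrict (ell u r) (fun i => i != prev_class u r)); last by move=> i; exact/ltnW.
  by rewrite divff// gt_eqF.
have [g|g] := ltP 0 (green u n (state k) r).
  rewrite (restrict (ell u r) (fun i => i == prev_class u r)); last by move=> i; exact/ltnW.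
  rewrite big_pred1_eq -/(green_class u n (state k) r _).
  have go0 : green_other u n (state k) r = 0.
    by apply/eqP; rewrite eq_le go sumr_ge0.
  have -> : green_class u n (state k) r (prev_class u r) = green u n (state k) r.
    by rewrite /green (bigD1 (prev_class u r))//= -/(green_other u n (state k) r) go0 addr0.
  by rewrite divff// gt_eqF.
have [y|y] := ltP 0 (yellow u n (state k) r).
  rewrite -[RHS](divff (lt0r_neq0 y)).
  have := restrict (fun i => (ell u r i).+1) (fun i => i == (ranked u r).1)
    (yellow u n (state k) r) ellJ.
  rewrite big_pred1_eq => <-; apply: eq_bigr => i _; apply: eq_bigr => j _.
  by rewrite /has_yellow ltnS andbC.
under eq_bigr do rewrite -mulr_suml (sum_pools _ _ kJ).
have [_ _ k0] := kJ; under eq_bigr do rewrite k0// subn0.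
by rewrite -mulr_suml -natr_sum sumA divff// gt_eqF.
Qed.

(** A common range for all sums in [assign_sum]: the height covers the pools, and [.+1] makes room
    for the yellow level [ell u r i]. *)
Let reach q (r : nat) : nat := maxn (height n A q) (\max_i (ell u r i).+1)%N.

Let arrivals q r : seq (slta_state R m * R) :=
  [seq ((shift q p n%:R^-1, next_r u n beta q r), n%:R * la * assign_prob u n q r p)
  | p <- [seq (i, j.+1) | i <- enum 'I_m.+1, j <- iota 0 (reach q r)]
  & 0 < assign_prob u n q r p].

Let slta_events (s : slta_state R m) : seq (slta_state R m * R) :=
  [seq ((e.1, s.2), e.2) | e <- departures n mu (prof_of n s.1) (height n A s.1)] ++
  arrivals s.1 s.2.

Let reachP q r : Qn n A q -> profile A (prof_of n q) (reach q r) /\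
  forall i, (ell u r i < reach q r)%N.
Proof.
move=> /(Qn_prof n_gt0)[_ kJ]; split; first by apply: profileW kJ; exact: leq_maxl.
move=> i; rewrite /reach leq_max; apply/orP; right.
exact: (@leq_bigmax _ (fun i => (ell u r i).+1) i).
Qed.

Let sum_arrivals q r (g : slta_state R m -> R) : Qn n A q ->
  \sum_(e <- arrivals q r) g e.1 * e.2 =
  \sum_(i < m.+1) \sum_(j < reach q r)
    g (shift q (i, j.+1) n%:R^-1, next_r u n beta q r) *
    (n%:R * la * assign_prob u n q r (i, j.+1)).
Proof.
move=> Qq; have [kJ _] := reachP r Qq; have [qE _] := Qn_prof n_gt0 Qq.
rewrite big_map big_filter big_mkcond big_allpairs_dep/= big_enum.
apply: eq_bigr => i _.
rewrite -[RHS](big_mkord xpredT (fun j => g (shift q (i, j.+1) n%:R^-1, next_r u n beta q r) *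
  (n%:R * la * assign_prob u n q r (i, j.+1)))) /index_iota subn0.
apply: eq_bigr => j _; case: ifPn => //; rewrite -leNgt => a0.
have -> : assign_prob u n q r (i, j.+1) = 0.
  by apply/eqP; rewrite eq_le a0 qE (assign_ge0 _ _ kJ).
by rewrite !mulr0.
Qed.

Let arrivals_mass q r : Qn n A q -> \sum_(e <- arrivals q r) e.2 = n%:R * la.
Proof.
move=> Qq; have [kJ ellJ] := reachP r Qq; have [qE _] := Qn_prof n_gt0 Qq.
have := sum_arrivals r (fun=> 1) Qq; under eq_bigr do rewrite mul1r.
move=> ->; under eq_bigr do under eq_bigr do rewrite mul1r.
under eq_bigr do rewrite -mulr_sumr; rewrite -mulr_sumr.
by have := assign_sum kJ ellJ; rewrite -qE => ->; rewrite mulr1.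
Qed.

Let slta_rateE s s' : S s -> rate s s' = \sum_(e <- slta_events s) (s' == e.1)%:R * e.2.
Proof.
case: s s' => q r [q' r'] [/= Qq _ _]; have [qE kJ0] := Qn_prof n_gt0 Qq.
have [kJ _] := reachP r Qq.
rewrite big_cat/= big_map (sum_arrivals r (fun s => ((q', r') == s)%:R) Qq).
rewrite /slta_rate/=; congr (_ + _).
  rewrite {1}qE (departure_rateE n_gt0 mu q' kJ0) mulr_sumr.
  by apply: eq_bigr => e _; rewrite xpair_eqE mulrA -natrM mulnb andbC.
rewrite (@sum_Iplus _ _ (reach q r)); last first.
  by move=> p /(assign_far r kJ); rewrite -qE => ->; rewrite !mulr0.
rewrite mulr_sumr; apply: eq_bigr => i _; rewrite mulr_sumr; apply: eq_bigr => j _.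
by rewrite xpair_eqE mulrA -natrM mulnb andbC.
Qed.

Let slta_event q r e : Qn n A q -> e \in slta_events (q, r) ->
  [/\ 0 < e.2, Qn n A e.1.1, e.1.1 <> q & e.1.2 = r \/ e.1.2 = next_r u n beta q r].
Proof.
move=> Qq; have [qE kJ0] := Qn_prof n_gt0 Qq; have [kJ _] := reachP r Qq.
rewrite mem_cat => /orP[/mapP[e' /(departuresP n_gt0 mu_gt0 kJ0)[k' [e'E k'J _ e0 ne]] ->]|].
  split => //=; [|by rewrite qE|by left].
  by rewrite e'E; apply/QnP => //; exists k', (height n A q).
move=> /mapP[[i j0]]; rewrite mem_filter => /andP[ap /allpairsP[[i' j] [_ _ /= [iE jE]]]] -> /=.
move: ap; rewrite {}iE {}jE {i j0} => ap; have := ap.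
rewrite {1}qE => /(assign_gt0 kJ) kij; split; [|..|by right].
- by rewrite !mulr_gt0.
- rewrite qE shift_add_task; apply/QnP => //.
  by exists (add_task (prof_of n q) (i', j.+1)), (maxn (reach q r) j.+2); split => //; exact: profile_add_task.
- have := @occ_add_task_neq R m n n_gt0 (prof_of n q) (i', j.+1).
  by rewrite -shift_add_task// -qE.
Qed.

Let slta_step s e : S s -> e \in slta_events s -> S e.1 /\ 0 < rate s e.1.
Proof.
move=> Ss eL; have [Qs r0 reach_s] := Ss.
have [qE kJ0] := Qn_prof n_gt0 Qs.
have eL' : e \in slta_events (s.1, s.2) by rewrite -surjective_pairing.
have [e0 Qe _ er] := slta_event Qs eL'.
have rate_gt0 : 0 < rate s e.1.
  rewrite slta_rateE//; apply: event_rate_gt0 => // e'.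
  by rewrite [s]surjective_pairing => /(slta_event Qs)[].
split => //; split => //; last by apply: rt_trans reach_s _; exact: rt_step.
by case: er => -> //; rewrite qE next_r_gt0.
Qed.

Let slta_empty : S (empty, 1%N).
Proof.
split => //; last exact: rt_refl.
by apply/QnP => //; do 2!eexists; split; [exact: empty_occ|exact: profile_empty].
Qed.

Let slta_drain q r : S (q, r) ->
  S (empty, r) /\ reachable_from rate (q, r) (empty, r).
Proof.
have [N] := ubnP (tasks q); elim: N q => // N IHN q; rewrite ltnS => qN Sq.
have [/(Qn_prof n_gt0)[/= qE kJ] _ _] := Sq; rewrite {1}qE in qN.
have [N0|/(departures_neq_nil n_gt0 mu kJ)[e eL]] := posnP (tasks (state (prof_of n q))).
  have qe : q = empty by rewrite qE (ntasks0 n_gt0 kJ N0).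
  by rewrite qe in Sq *; split => //; exact: rt_refl.
have eL' : ((e.1, r), e.2) \in slta_events (q, r).
  by rewrite mem_cat; apply/orP; left; apply/mapP; exists e.
have [Se qe] := slta_step Sq eL'.
have eN : (tasks e.1 < N)%N.
  have [k' [-> _ tasksS _ _]] := departuresP n_gt0 mu_gt0 kJ eL.
  by rewrite -ltnS tasksS ltnS.
have [Sr er] := IHN _ eN Se.
by split => //; apply: rt_trans (rt_step _ _ _ _ qe) er.
Qed.

(** Draining by departures keeps [r], and one arrival into the empty system lowers it by one; the
    two alternate until [r] is 1. *)
Let slta_to_empty s : S s -> reachable_from rate s (empty, 1%N).
Proof.
case: s => q r Sq; have [_ r0 _] := Sq.
elim: r q r0 Sq => // r IHr q _ Sq; have [Sr drain] := slta_drain Sq.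
case: r IHr Sq Sr drain => [|r] IHr Sq Sr drain; first exact: drain.
apply: rt_trans drain _.
have [Qe _ _] := Sr.
have [e eL] : exists e, e \in arrivals empty r.+2.
  case arrE : (arrivals empty r.+2) => [|e L]; last by exists e; rewrite mem_head.
  have := arrivals_mass r.+2 Qe; rewrite arrE big_nil => /esym/eqP.
  by rewrite mulf_eq0 !gt_eqF.
have eL' : e \in slta_events (empty, r.+2) by rewrite mem_cat eL orbT.
have [Se re] := slta_step Sr eL'; apply: rt_trans (rt_step _ _ _ _ re) _.
have er : e.1.2 = r.+1.
  have /mapP[p _ ->] /= := eL; apply/eqP; rewrite -eqSS.
  by rewrite -(next_r_empty (_ : (1 < r.+2)%N)).
rewrite [e.1]surjective_pairing er in Se *.
by have := IHr e.1.1 isT Se; rewrite /=.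
Qed.

Lemma slta_chain (X : ctmc S rate) :
  [/\ irreducible X, positive_recurrent X & exists! pi, stationary X pi].
Proof.
have nla_gt0 : 0 < n%:R * la by rewrite mulr_gt0.
have [F [eps [eps_gt0 F_ge0 drift]]] := drift_function nla_gt0 mu_gt0.
have mass s : S s -> \sum_(e <- slta_events s) e.2 = mu * (tasks s.1)%:R + n%:R * la.
  move=> [Qs _ _]; have [qE kJ] := Qn_prof n_gt0 Qs.
  by rewrite big_cat/= big_map/= (departures_mass n_gt0 mu kJ) -qE arrivals_mass.
apply: (@foster_criterion R _ S rate slta_events _ _ (n%:R * la) nla_gt0 _
  (empty, 1%N) slta_empty _ _ (fun s => F (tasks s.1) s.2) eps _ eps_gt0).
- by move=> s s' Ss; exact: slta_rateE.
- move=> s e Ss eL; have [Se _] := slta_step Ss eL; have [Qs _ _] := Ss.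
  move: eL; rewrite {1}[s]surjective_pairing => /(slta_event Qs)[e0 _ ne _].
  by split => // es; apply: ne; rewrite es.
- by move=> s Ss; rewrite mass// lerDr mulr_ge0// ltW.
- by move=> s [].
- exact: slta_to_empty.
- by move=> s _; exact: F_ge0.
move=> [q r] Ss s0; rewrite mass//; have [/= Qq r0 _] := Ss.
have [qE kJ0] := Qn_prof n_gt0 Qq; have [kJ _] := reachP r Qq.
have deps := departures_drift n_gt0 mu_gt0 kJ0 (V := fun q => F (tasks q) r)
  (F := fun N => F N r) (fun _ _ => erefl).
rewrite -qE in deps; rewrite big_cat/= big_map/= deps.
have arr e : e \in arrivals q r ->
    F (tasks e.1.1) e.1.2 = F (tasks q).+1 (next_r u n beta q r).
  move=> /mapP[[i j0]]; rewrite mem_filter => /andP[ap /allpairsP[[i' j] [_ _ /= [iE jE]]]] -> /=.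
  move: ap; rewrite {}iE {}jE {i j0}; rewrite {1}qE => /(assign_gt0 kJ) kj.
  have -> : shift q (i', j.+1) n%:R^-1 = state (add_task (prof_of n q) (i', j.+1)).
    by rewrite {1}qE shift_add_task.
  have := profileW (leq_maxl (reach q r) j.+2) kJ; set J := maxn _ _ => kJ'.
  have := profile_add_task kJ kj; rewrite -/J => bJ.
  by rewrite (ntasks_add_task R n_gt0 kJ' bJ)// -qE.
rewrite (_ : \sum_(e <- arrivals q r) _ =
  n%:R * la * (F (tasks q).+1 (next_r u n beta q r) - F (tasks q) r)); last first.
  rewrite -(arrivals_mass r Qq) mulr_suml big_seq [RHS]big_seq.
  by apply: eq_bigr => e /arr ->.
apply: drift => //.
- by rewrite qE next_r_le.
- by rewrite {1}qE => /(next_r_up kJ r0); rewrite -qE.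
(* Away from [(empty, 1)] an empty system has [r > 1], as [next_r_empty] requires. *)
- move=> N0; have qe : q = empty.
    by rewrite qE; apply: (ntasks0 n_gt0 kJ); rewrite -qE.
  rewrite qe -next_r_empty// ltn_neqAle r0 andbT eq_sym.
  by apply: contra_notN s0 => /eqP->; rewrite qe.
Qed.

End SLTA.

Theorem proposition7 (R : realType) (m : nat)
  (u : 'I_m.+1 -> R -> R)
  (hu : forall i, convex_function (`[0, +oo[%classic : set R) (fun x => - u i x))
  (lambda mu : R) (hlambda : 0 < lambda) (hmu : 0 < mu)
  (A : nat -> 'I_m.+1 -> nat)
  (hA : forall n, (\sum_(i < m.+1) A n i)%N = n)
  (alpha : 'I_m.+1 -> R)
  (halpha01 : forall i, 0 < alpha i < 1)
  (halpha : forall i, (alpha_ R n (A n) i @[n --> \oo] --> alpha i)) :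
  (forall n : nat, (0 < n)%N ->
     forall X : ctmc (jlmu_states u lambda mu n (A n))
                     (jlmu_rate u lambda mu n),
       [/\ irreducible X, positive_recurrent X &
           exists! pi, stationary X pi])
  /\
  (forall (beta : nat -> R) (gamma0 : R) (sigma_star : coord m),
     (forall n, (0 < n)%N -> 0 < beta n) ->
     is_sigma_star u alpha (lambda / mu) sigma_star ->
     (\esum_(p in [set p | Iplus p /\ rank_lt u sigma_star p]) (alpha p.1)%:E
        < (lambda / mu)%:E)%E ->
     0 < gamma0 < 2^-1 ->
     beta n @[n --> \oo] --> 0 ->
     (0 < limn_einf (fun n => (n%:R `^ gamma0 * beta n)%:E))%E ->
     (forall n : nat, (0 < n)%N ->
        slta_nondegenerate u n (A n) (beta n) ->
        forall X : ctmc (slta_states u lambda mu n (A n) (beta n))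
                        (slta_rate u lambda mu n (beta n)),
          [/\ irreducible X, positive_recurrent X &
              exists! pi, stationary X pi])
     /\
     (\forall n \near \oo, slta_nondegenerate u n (A n) (beta n))).
Proof.
split=> [n n0 X|beta gamma0 sigma_star _ _ _ _ beta0 _]; first exact: jlmu_chain.
split=> [n n0 nondeg X|]; first exact: slta_chain.
(* With finitely many classes, all fractions of pools eventually exceed half of their positive
   limits: every class then has a pool, and [beta n], tending to 0, falls below the fraction of
   class [i0]. *)
pose i0 := (ranked u 1).1.
have alpha_gt0 i : 0 < alpha i by case/andP: (halpha01 i).
have near_gt i : \forall n \near \oo, alpha i / 2 < alpha_ R n (A n) i.
  have lt_alpha : alpha i / 2 < alpha i.
    by rewrite ltr_pdivrMr// ltr_pMr// ltr1n.
  exact: cvgr_gt (halpha i) _ lt_alpha.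
have near_beta : \forall n \near \oo, beta n < alpha i0 / 2.
  by apply: cvgr_lt beta0 _ _; rewrite divr_gt0.
have near_all : \forall n \near \oo, forall i, alpha i / 2 < alpha_ R n (A n) i.
  exact: filter_forall near_gt.
near=> n; split => [i|].
  have : 0 < alpha_ R n (A n) i.
    by apply: lt_trans (near near_all n _ i) => //; rewrite divr_gt0.
  rewrite lt0n => alpha_n; apply/eqP => A0.
  by move: alpha_n; rewrite /alpha_ A0 mul0r ltxx.
apply/ltW/(lt_trans (near near_beta n _)) => //.
by apply: (near near_all n _).
Unshelve. all: by end_near.
Qed.
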